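(* Let $n\ge1$ and $f,g\in PO(1,n)\cong\mathbf I(\mathbb H^n)$. Then $\sigma_f=\sigma_g$ if and only if the centralizers $PO(1,n)_f=\{h:hf=fh\}$ and $PO(1,n)_g$ are conjugate subgroups of $PO(1,n)$.
   Context: $\mathbb R^{1,n}$ is $\mathbb R^{n+1}$ with $Q(x,y)=-x_0y_0+\sum_{i=1}^n x_iy_i$; $O(1,n)$ is its isometry group and $PO(1,n)$ the subgroup of $T$ with $Q(Tv)<0$ whenever $Q(v)<0$ (equivalently positive upper-left entry); $\mathbf I(\mathbb H^n)\cong PO(1,n)$ for $\mathbb H^n=\{Q(x)=-1,x_0>0\}$. For $T\in PO(1,n)$, the real primary components of $\mathbb R^{n+1}$ are $\ker p(T)^{N}$ ($N$ large) for the distinct monic irreducible real factors $p$ of the characteristic polynomial. Space-time decomposition: $V_s$ is the sum of the primary components on which $Q$ is positive definite, $V_t$ the sum of the remaining ones; $\mathbb R^{n+1}=V_t\oplus V_s$ orthogonally. Let $T_t=T|_{V_t}$, $T_s=T|_{V_s}$ (orthogonal), $r=\dim V_t$. Type: $e$ (elliptic) if $T_t=\mathrm{id}$; $p$ (parabolic) if $T_t$ is unipotent but $\ne\mathrm{id}$; $h$ (hyperbolic) if $T_t$ has an eigenvalue $\ne1$. Segre symbol: $\sigma_T=[t;r;\tilde\sigma_{T_s}]$, where for an orthogonal map $B$, $\tilde\sigma_B$ consists of the multiset of $\dim_{\mathbb C}\ker(B-\lambda)$ over distinct conjugate pairs $\{\lambda,\bar\lambda\}$ of non-real eigenvalues and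 the multiset of $\dim\ker(B-\varepsilon)$ over eigenvalues $\varepsilon\in\{\pm1\}$ of $B$. *)

(* Defs.v *)
From HB Require Import structures.
From mathcomp Require Import all_boot all_order all_algebra.
From Stdlib Require Import ClassicalEpsilon.
Set Implicit Arguments. Unset Strict Implicit. Unset Printing Implicit Defensive.
Import Order.TTheory GRing.Theory Num.Theory.
Local Open Scope ring_scope.

Section Lorentz.
Variables (R : rcfType) (n : nat).
Local Notation M := 'M[R]_(n.+1).
Local Notation V := 'rV[R]_(n.+1).

Definition Jmx : M := \matrix_(i, j) (if i == j then (if i == ord0 then -1 else 1) else 0).

(* vectors are row vectors; the matrix T acts by v |-> (T v^T)^T = v *m T^T *)
Definition Qf (v : V) : R := (v *m Jmx *m v^T) ord0 ord0.

Definition isPO (T : M) : bool := (T^T *m Jmx *m T == Jmx) && (0 < T ord0 ord0).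

(* kernel of (the column action of) A, as a row space *)
Definition mxker (A : M) : M := kermx A^T.

(* real primary component ker p(T)^N, N = n+1 large enough *)
Definition primcomp (T : M) (p : {poly R}) : M := mxker (horner_mx T p ^+ n.+1).

Definition is_factor (T : M) (p : {poly R}) : Prop :=
  p \is monic /\ irreducible_poly p /\ p %| char_poly T.

Definition posdef (W : M) : Prop :=
  forall v : V, (v <= W)%MS -> v != 0 -> 0 < Qf v.

Definition centralizer (f : M) (h : M) : Prop := isPO h /\ h *m f = f *m h.

Definition conj_centralizers (f g : M) : Prop :=
  exists k : M, isPO k /\
    forall h : M, centralizer g h <-> centralizer f (invmx k *m h *m k).
End Lorentz.

Inductive ptype := Ell | Par | Hyp.

(* Segre symbol [t; r; (multiset over conjugate pairs); (multiset over +-1)],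
   multisets represented as sorted lists *)
Definition segre_data := (ptype * nat * seq nat * seq nat)%type.

Definition is_segre (R : rcfType) (n : nat) (T : 'M[R]_(n.+1)) (s : segre_data) : Prop :=
  let: (t, r, cs, rs) := s in
  exists (ps_s ps_t : seq {poly R}),
    (forall p, p \in ps_s <-> is_factor T p /\ posdef (primcomp T p)) /\
    (forall p, p \in ps_t <-> is_factor T p /\ ~ posdef (primcomp T p)) /\
    uniq ps_s /\ uniq ps_t /\
    let Vs := (\sum_(p <- ps_s) primcomp T p)%MS in
    let Vt := (\sum_(p <- ps_t) primcomp T p)%MS in
    let isid := forall v : 'rV[R]_(n.+1), (v <= Vt)%MS -> v *m T^T = v in
    let unip := forall v : 'rV[R]_(n.+1), (v <= Vt)%MS ->
                  v *m ((T - 1) ^+ n.+1)^T = 0 in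
    (* T_t has an eigenvalue (possibly non-real) different from 1 *)
    let eig1 := exists p : {poly R}, [/\ p \is monic, irreducible_poly p,
                  p != 'X - 1 & (mxker (horner_mx T p) :&: Vt)%MS != 0] in
    [/\ t = Ell <-> isid, t = Par <-> (unip /\ ~ isid) & t = Hyp <-> eig1] /\
    r = \rank Vt /\
    (* distinct conjugate pairs {l, conj l} of non-real eigenvalues of T_s
       <-> real monic irreducible quadratics p with ker p(T_s) <> 0;
       dim_C ker(T_s - l) = (dim_R ker p(T_s)) / 2 *)
    (exists qs : seq {poly R}, uniq qs /\
       (forall p, p \in qs <-> [/\ p \is monic, irreducible_poly p, size p = 3%N &
                               (mxker (horner_mx T p) :&: Vs)%MS != 0]) /\
       cs = sort leq [seq (\rank (mxker (horner_mx T p) :&: Vs)%MS)./2 | p <- qs]) /\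
    rs = sort leq [seq d <- [seq \rank (mxker (T - e%:M) :&: Vs)%MS | e <- [:: 1; -1]]
                   | d != 0%N].

Definition segre (R : rcfType) (n : nat) (T : 'M[R]_(n.+1)) : segre_data :=
  epsilon (inhabits (Ell, 0%N, [::], [::])) (is_segre T).

(* Main.v *)
(* Over a real closed field an irreducible factor of the characteristic
   polynomial of f in PO(1,n) is linear or a quadratic without roots. If the
   form is not definite on its primary component, the component contains a
   nonspacelike eigenvector with a positive eigenvalue; hence the time part is
   either unipotent (a single component, for the eigenvalue 1) or a hyperbolic
   plane spanned by two null eigenvectors. On a definite component f is a real
   scalar or a scalar plus a multiple of a complex structure.

   Equal Segre symbols: matching orthonormal frames of the components of f and g
   (and normal forms of the time parts) gives an isometry X such that on every
   component X f X^-1 is a polynomial in g and conversely, so that conjugation by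
   X exchanges the commutants; X or -X lies in PO(1,n).

   Conjugate centralizers: one may assume Z(f) = Z(g). For v in a definite
   component of f the reflection in span(v, f v) lies in Z(f), so g preserves all
   these spans and acts on the component as a polynomial in f. Hence the definite
   components of f and g coincide with their degrees, and so do the time parts.
   The type is then read off from reflections in spacelike vectors of the time
   part and from its dimension, which is 2 for hyperbolic and at least 3 for
   parabolic isometries. *)

Require Import Defs.
From HB Require Import structures.
From mathcomp Require Import all_boot all_order all_algebra.
From mathcomp Require Import complex ring lra.
From Stdlib Require Import ClassicalEpsilon.
Set Implicit Arguments. Unset Strict Implicit. Unset Printing Implicit Defensive.
Import Order.TTheory GRing.Theory Num.Theory.
Local Open Scope ring_scope.

(** * Irreducible polynomials over a real closed field *)

Section RealClosedPoly.
Variable R : rcfType.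
Implicit Types p q : {poly R}.

Definition quad (s d : R) : {poly R} := 'X^2 - s *: 'X + d%:P.

Lemma size_quad s d : size (quad s d) = 3%N.
Proof.
rewrite /quad -addrA size_polyDl size_polyXn //.
apply: leq_ltn_trans (size_polyD _ _) _.
rewrite gtn_max size_polyN (leq_ltn_trans (size_scale_leq _ _)) ?size_polyX //=.
exact: leq_ltn_trans (size_polyC_leq1 _) _.
Qed.

Lemma monic_quad s d : quad s d \is monic.
Proof.
rewrite monicE lead_coefE size_quad /quad !coefD coefXn coefN coefZ coefX coefC /=.
by rewrite mulr0 oppr0 !addr0.
Qed.

Lemma horner_quad s d x : (quad s d).[x] = x ^+ 2 - s * x + d.
Proof. by rewrite /quad !hornerE. Qed.

Lemma irreducible_quad s d : s ^+ 2 < 4 * d -> irreducible_poly (quad s d).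
Proof.
move=> sd; apply: cubic_irreducible; first by rewrite size_quad.
move=> x; apply/negP => /rootP; rewrite horner_quad => h.
have := sqr_ge0 (2 * x - s); nra.
Qed.

(** Take a root a + ib in the algebraic closure R[i]. If b is non-zero, the remainder of [p] modulo
    the real quadratic with this root is affine and vanishes at a + ib; its imaginary part kills the
    slope, its real part the constant. *)
Lemma rcf_factor p : (1 < size p)%N ->
  exists2 q, q %| p &
    (exists a, q = 'X - a%:P) \/ (exists s d, q = quad s d /\ s ^+ 2 < 4 * d).
Proof.
move=> sp.
pose toC : {rmorphism R -> complex.complex R} := complex.real_complex_def (Phant R).
have [|[a b] rz] := @closed_rootP (complex.complex R) (map_poly toC p) _.
  by rewrite size_map_poly neq_ltn sp orbT.
have [b0|b0] := eqVneq b 0.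
  exists ('X - a%:P); last by left; exists a.
  rewrite b0 in rz.
  by rewrite dvdp_XsubCl -(fmorph_root toC).
exists (quad (2 * a) (a ^+ 2 + b ^+ 2)); last first.
  right; exists (2 * a), (a ^+ 2 + b ^+ 2); split=> //.
  have : 0 < b ^+ 2 by rewrite exprn_even_gt0.
  lra.
set q := quad _ _.
have := divp_eq p q; set r := p %% q => pE.
have sr : (size r <= 2)%N by rewrite -ltnS -(size_quad (2 * a) (a ^+ 2 + b ^+ 2)) ltn_modp -size_poly_gt0 size_quad.
have rE : r = r`_1 *: 'X + (r`_0)%:P.
  apply/polyP => -[|[|i]]; rewrite !(coefD, coefZ, coefX, coefC) /= ?mulr0 ?mulr1 ?add0r ?addr0 //.
  by rewrite nth_default // (leq_trans sr).
move: rz; rewrite pE rE => /rootP.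
rewrite rmorphD rmorphM /= hornerD hornerM.
have -> : (map_poly toC q).[complex.Complex a b] = 0.
  rewrite /q /quad rmorphD rmorphB /= map_polyZ map_polyXn map_polyX map_polyC.
  rewrite !hornerE /= expr2.
  apply/eqP; rewrite complex.eq_complex /=; apply/andP; split; apply/eqP; ring.
rewrite mulr0 add0r rmorphD /= map_polyZ map_polyX map_polyC !hornerE /=.
move/eqP; rewrite complex.eq_complex /= => /andP[/eqP e1 /eqP e2].
have r1 : r`_1 = 0.
  have : r`_1 * b = 0 by lra.
  by move/eqP; rewrite mulf_eq0 (negPf b0) orbF => /eqP.
have r0 : r`_0 = 0 by move: e1; rewrite r1; lra.
by rewrite r1 r0 scale0r !addr0 dvdp_mull.
Qed.

Lemma monic_irreducible_rcfP p : p \is monic -> irreducible_poly p ->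
  (exists a, p = 'X - a%:P) \/ (exists s d, p = quad s d /\ s ^+ 2 < 4 * d).
Proof.
move=> mp [sp ip]; have [q qp hq] := rcf_factor sp.
have mq : q \is monic /\ size q != 1%N.
  case: hq => [[a ->]|[s [d [-> _]]]]; first by rewrite monicXsubC size_XsubC.
  by rewrite monic_quad size_quad.
have := ip q mq.2 qp; rewrite eqp_monic ?mq.1 // => /eqP <-; exact: hq.
Qed.

Lemma rcf_irreducible_factor p : (1 < size p)%N ->
  exists q, [/\ q \is monic, irreducible_poly q & q %| p].
Proof.
move/rcf_factor=> [q qp hq]; exists q; split=> //.
  by case: hq => [[a ->]|[s [d [-> _]]]]; rewrite ?monicXsubC ?monic_quad.
case: hq => [[a ->]|[s [d [-> sd]]]]; first exact: irredp_XsubC.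
exact: irreducible_quad.
Qed.

Lemma irreducible_coprime_or_dvd p q : irreducible_poly p ->
  coprimep p q \/ p %| q.
Proof. by move=> ip; rewrite irreducible_poly_coprime //; case: (p %| q); [right | left]. Qed.

Lemma irreducible_dvd_eq p q : p \is monic -> q \is monic ->
  irreducible_poly p -> irreducible_poly q -> p %| q -> p = q.
Proof.
move=> mp mq [sp _] [_ iq] pq; apply/eqP; rewrite -eqp_monic //.
by apply: iq => //; rewrite neq_ltn sp orbT.
Qed.

Lemma monic_irreducible_coprime p q : p \is monic -> q \is monic ->
  irreducible_poly p -> irreducible_poly q -> p != q -> coprimep p q.
Proof.
move=> mp mq ip iq pq; case: (irreducible_coprime_or_dvd q ip) => // pq'.
by rewrite (irreducible_dvd_eq mp mq ip iq pq') eqxx in pq.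
Qed.

Lemma irreducible_dvd_prod p (l : seq {poly R}) : irreducible_poly p ->
  p %| \prod_(q <- l) q -> exists2 q, q \in l & p %| q.
Proof.
move=> ip; elim: l => [|q l IH].
  rewrite big_nil dvdp1 => sp; case: ip => sp' _; by rewrite (eqP sp) in sp'.
rewrite big_cons; case: (irreducible_coprime_or_dvd q ip) => [cpq|pq _].
  rewrite Gauss_dvdpr // => /IH[r rl pr]; exists r => //; by rewrite inE rl orbT.
by exists q; rewrite ?mem_head.
Qed.

Lemma monic_factorization p : p \is monic ->
  exists2 l : seq {poly R}, p = \prod_(q <- l) q &
    forall q, q \in l -> q \is monic /\ irreducible_poly q.
Proof.
have [m] := ubnP (size p); elim: m p => // m IH p sp mp.
have [sp1|sp1] := leqP (size p) 1.
  exists [::] => //; rewrite big_nil.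
  have p1 : size p == 1%N by rewrite eqn_leq sp1 size_poly_gt0 monic_neq0.
  by case/size_poly1P: p1 => c _ pc; move: mp; rewrite pc monicE lead_coefC => /eqP ->.
have [q [mq iq /dvdpP[r pE]]] := rcf_irreducible_factor sp1.
have mr : r \is monic by move: mp; rewrite pE monicMr.
have sr : (size r < m)%N.
  have [sq _] := iq.
  have := sp; rewrite pE size_proper_mul; last first.
    by rewrite (monicP mr) (monicP mq) mulr1 oner_neq0.
  have : (0 < size r)%N by rewrite size_poly_gt0 monic_neq0.
  case: (size q) sq => [|[|k]] // _; case: (size r) => [|j] // _.
  rewrite addSn addnS /= ltnS; apply: leq_trans; by rewrite ltnS addnS ltnS leq_addr.
have [l rE hl] := IH r sr mr.
exists (q :: l); first by rewrite big_cons -rE pE mulrC.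
by move=> q'; rewrite inE => /orP[/eqP ->|/hl].
Qed.

(** No factor occurs more often than the list is long. This is what makes one uniform exponent
    sufficient for all primary components. *)
Lemma dvdp_prod_undup_exp (l : seq {poly R}) N : (size l <= N)%N ->
  \prod_(q <- l) q %| \prod_(q <- undup l) q ^+ N.
Proof.
move=> sl.
rewrite -(prodr_undup_exp_count l xpredT id).
elim: (undup l) => [|q s IH]; first by rewrite !big_nil dvdpp.
rewrite !big_cons dvdp_mul // dvdp_exp2l // (leq_trans (count_size _ _)) //.
Qed.

End RealClosedPoly.

(** * The Lorentz form *)

Section LorentzForm.
Variables (R : rcfType) (n : nat).
Local Notation M := 'M[R]_(n.+1).
Local Notation V := 'rV[R]_(n.+1).
Local Notation J := (Jmx R n).
Implicit Types (u v w z : V) (A : M).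

Definition form u v : R := (u *m J *m v^T) ord0 ord0.

Lemma QfE v : Qf v = form v v. Proof. by []. Qed.

Lemma form_mx u v : u *m J *m v^T = (form u v)%:M.
Proof. by rewrite [LHS]mx11_scalar. Qed.

Lemma trmx_J : J^T = J.
Proof.
by apply/matrixP => i j; rewrite !mxE eq_sym; case: eqP => // ->.
Qed.

Lemma mul_JJ : J *m J = 1%:M.
Proof.
apply/matrixP => i j; rewrite !mxE (bigD1 i) //= big1 => [|k ki]; last first.
  by rewrite mxE eq_sym (negPf ki) mul0r.
rewrite !mxE eqxx addr0; case: (eqVneq i j) => [->|_]; last by rewrite mulr0.
by case: ifP; rewrite ?mulr1 // mulrNN mulr1.
Qed.

Lemma J_unit : J \in unitmx.
Proof. by have [] := mulmx1_unit mul_JJ. Qed.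

Lemma formC u v : form u v = form v u.
Proof.
have -> : form u v = (u *m J *m v^T)^T ord0 ord0 by rewrite mxE.
by rewrite !trmx_mul trmxK trmx_J mulmxA.
Qed.

Lemma formDl u v w : form (u + v) w = form u w + form v w.
Proof. by rewrite /form !mulmxDl mxE. Qed.
Lemma formDr u v w : form w (u + v) = form w u + form w v.
Proof. by rewrite !(formC w) formDl. Qed.
Lemma formZl a u w : form (a *: u) w = a * form u w.
Proof. by rewrite /form -!scalemxAl mxE. Qed.
Lemma formZr a u w : form w (a *: u) = a * form w u.
Proof. by rewrite !(formC w) formZl. Qed.
Lemma formNl u w : form (- u) w = - form u w.
Proof. by rewrite -scaleN1r formZl mulN1r. Qed.
Lemma formNr u w : form w (- u) = - form w u.
Proof. by rewrite !(formC w) formNl. Qed.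
Lemma form0l w : form 0 w = 0.
Proof. by rewrite -(scale0r w) formZl mul0r. Qed.
Lemma form0r w : form w 0 = 0.
Proof. by rewrite formC form0l. Qed.
Definition formE := (formDl, formDr, formNl, formNr, formZl, formZr, form0l, form0r).

Lemma form_coord u v : form u v =
  - u ord0 ord0 * v ord0 ord0 + \sum_(i < n) u ord0 (lift ord0 i) * v ord0 (lift ord0 i).
Proof.
have uJ j : (u *m J) ord0 j = u ord0 j * (if j == ord0 then -1 else 1).
  rewrite mxE (bigD1 j) //= big1 => [|i ij]; last by rewrite mxE (negPf ij) mulr0.
  by rewrite mxE eqxx addr0.
rewrite /form mxE big_ord_recl uJ eqxx mxE mulrN1; congr (_ + _).
by apply: eq_bigr => i _; rewrite uJ mxE /= mulr1.
Qed.

Lemma form_gt0_space v : v ord0 ord0 = 0 -> v != 0 -> 0 < form v v.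
Proof.
move=> v0 vn0; rewrite form_coord v0 mulr0 add0r.
have [i vi] : exists i, v ord0 (lift ord0 i) != 0.
  apply/existsP; apply: contraNT vn0; rewrite negb_exists => /forallP h.
  apply/eqP/rowP => j; rewrite mxE; case: (unliftP ord0 j) => [i|] -> //.
  by have := h i; rewrite negbK => /eqP.
rewrite (bigD1 i) //= ltr_wpDr ?sumr_ge0 // => [j _|]; rewrite -expr2 ?sqr_ge0 //.
by rewrite lt0r sqrf_eq0 vi sqr_ge0.
Qed.

Lemma nonspacelike_coord0 v : v != 0 -> form v v <= 0 -> v ord0 ord0 != 0.
Proof.
by move=> vn0; apply: contraTneq => v0; rewrite -ltNge form_gt0_space.
Qed.

(* Subtracting the multiple of [u] that kills the time coordinate of [v]
   leaves a vector with zero time coordinate, on which the form is definite. *)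
Lemma nonspacelike_orth u v : u != 0 -> form u u <= 0 -> form v v <= 0 ->
  form u v = 0 -> exists c, v = c *: u.
Proof.
move=> un0 qu qv uv; have u0 := nonspacelike_coord0 un0 qu.
exists (v ord0 ord0 / u ord0 ord0); set c := _ / _.
apply/eqP; rewrite -subr_eq0; apply: contraT => wn0.
have w0 : (v - c *: u) ord0 ord0 = 0 by rewrite !mxE /c divfK // subrr.
have := form_gt0_space w0 wn0; rewrite !formE (formC v) uv.
have := sqr_ge0 c; nra.
Qed.

(** With [c] the positive ratio of the time coordinates, [v - c *: u] has time coordinate zero, so
    its norm is nonnegative; expanding it bounds [form u v] from above. *)
Lemma nonspacelike_form_le0 u v : form u u <= 0 -> form v v <= 0 ->
  0 < u ord0 ord0 -> 0 < v ord0 ord0 -> form u v <= 0.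
Proof.
move=> qu qv u0 v0; pose c := v ord0 ord0 / u ord0 ord0.
have c0 : 0 < c by rewrite divr_gt0.
have w0 : (v - c *: u) ord0 ord0 = 0 by rewrite !mxE /c divfK ?subrr // gt_eqF.
have : 0 <= form (v - c *: u) (v - c *: u).
  have [->|wn0] := eqVneq (v - c *: u) 0; first by rewrite form0l.
  exact/ltW/form_gt0_space.
rewrite !formE (formC v) => h.
have : c * form u v <= 0 by nra.
by rewrite pmulr_rle0.
Qed.

Lemma form_mulmx A u v : A *m J *m A^T = J -> form (u *m A) (v *m A) = form u v.
Proof.
move=> hA; rewrite /form trmx_mul !mulmxA.
by rewrite -(mulmxA u A) -(mulmxA u) hA.
Qed.

(** [J *m A^T *m J] is a left inverse of [A], hence also a right inverse, so invariance under the
    column action passes to the row action. *)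
Lemma isPO_row A : isPO A -> A *m J *m A^T = J.
Proof.
move=> /andP[/eqP hA _].
have h1 : (J *m A^T *m J) *m A = 1%:M by rewrite -!mulmxA (mulmxA A^T) hA mul_JJ.
have h2 := mulmx1C h1.
have : A *m J *m A^T *m J *m J = J by rewrite -[RHS]mul1mx -h2 !mulmxA.
by rewrite -mulmxA mul_JJ mulmx1.
Qed.

Lemma isPO_tr A : isPO A -> isPO A^T.
Proof.
move=> hA; have := isPO_row hA; move: hA => /andP[_ h0] hr.
by rewrite /isPO trmxK hr eqxx mxE.
Qed.

Lemma isPO_trE A : isPO A^T = isPO A.
Proof. by apply/idP/idP => /isPO_tr; rewrite ?trmxK. Qed.

Lemma isom_invmx A : A *m J *m A^T = J -> A \in unitmx /\ invmx A = J *m A^T *m J.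
Proof.
move=> hA.
have h1 : A *m (J *m A^T *m J) = 1%:M by rewrite !mulmxA hA mul_JJ.
have [Au _] := mulmx1_unit h1; split=> //.
by rewrite -[LHS]mulmx1 -h1 mulKmx.
Qed.

Lemma isPO_unit A : isPO A -> A \in unitmx.
Proof. by move/isPO_row/isom_invmx => []. Qed.

Lemma form_invmx A u v : A *m J *m A^T = J -> form (u *m A) v = form u (v *m invmx A).
Proof.
move=> hA; have [Au _] := isom_invmx hA.
by rewrite -[RHS](form_mulmx _ _ hA) mulmxKV.
Qed.

Lemma e0_form v : form v (delta_mx 0 0) = - v ord0 ord0.
Proof.
rewrite form_coord mxE eqxx mulr1 big1 ?addr0 // => i _.
by rewrite mxE /= mulr0.
Qed.

(** The time coordinate of [v *m A] is minus the pairing of [v] with the preimage [f] of the first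
    basis vector, a future vector of norm -1. The pairing of two future nonspacelike vectors is at
    most 0, and if it vanished [v] would be a multiple of [f], hence zero. *)
Lemma isPO_future A v : isPO A -> form v v <= 0 -> 0 < v ord0 ord0 ->
  0 < (v *m A) ord0 ord0.
Proof.
move=> hA qv v0; have hr := isPO_row hA; have [Au Ai] := isom_invmx hr.
pose e : V := delta_mx 0 0; pose f := e *m invmx A.
have ff : form f f = -1.
  by rewrite -(form_mulmx _ _ hr) /f mulmxKV // e0_form mxE.
have f0 : 0 < f ord0 ord0.
  rewrite -[f ord0 ord0]opprK -e0_form formC -form_invmx // e0_form opprK.
  by rewrite -rowE mxE; case/andP: hA.
have -> : (v *m A) ord0 ord0 = - form v f.
  by rewrite /f -form_invmx // e0_form opprK.
have fn0 : f != 0 by apply: contraTneq f0 => ->; rewrite mxE ltxx.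
rewrite oppr_gt0 lt_neqAle nonspacelike_form_le0 ?ff ?lerN10 // andbT.
apply: contraTneq v0 => vf; rewrite formC in vf.
have [|c vE] := nonspacelike_orth fn0 _ qv vf; first by rewrite ff lerN10.
by move: vf; rewrite vE formZr ff mulrN1 => /eqP; rewrite oppr_eq0 => /eqP ->; rewrite scale0r mxE ltxx.
Qed.

Lemma isPO_future0 A : A *m J *m A^T = J ->
  isPO A = (0 < (delta_mx ord0 ord0 *m A : V) ord0 ord0).
Proof.
move=> hA; have [Au Ai] := isom_invmx hA.
rewrite /isPO -rowE mxE; case: (0 < _); rewrite ?andbF // andbT.
have h1 : J *m A^T *m J *m A = 1%:M by rewrite -Ai mulVmx.
apply/eqP; have : J *m (J *m A^T *m J *m A) = J by rewrite h1 mulmx1.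
by rewrite !mulmxA mul_JJ mul1mx.
Qed.

Lemma isPO_mul A B : isPO A -> isPO B -> isPO (A *m B).
Proof.
move=> hA hB; have rA := isPO_row hA; have rB := isPO_row hB.
rewrite isPO_future0; last first.
  by rewrite trmx_mul !mulmxA -(mulmxA A) -(mulmxA A) rB rA.
rewrite mulmxA; apply: isPO_future => //.
  by rewrite (form_mulmx _ _ rA) e0_form mxE lerN10.
by rewrite -isPO_future0.
Qed.

Lemma isPO_inv A : isPO A -> isPO (invmx A).
Proof.
move=> hA; have rA := isPO_row hA; have [Au Ai] := isom_invmx rA.
have ri : invmx A *m J *m (invmx A)^T = J.
  case/andP: hA => /eqP h _.
  by rewrite Ai !trmx_mul trmxK trmx_J !mulmxA -(mulmxA _ J J) mul_JJ mulmx1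
     -!mulmxA (mulmxA J A) (mulmxA A^T) (mulmxA A^T) h !mulmxA mul_JJ mul1mx.
rewrite isPO_future0 //.
rewrite -[X in 0 < X]opprK -e0_form formC -form_invmx // e0_form opprK.
by rewrite -isPO_future0.
Qed.

(** The image of the first basis vector has norm -1, so its time coordinate is non-zero and its sign
    decides between [A] and [- A]. *)
Lemma isPO_opp A : A *m J *m A^T = J -> isPO A \/ isPO (- A).
Proof.
move=> hA; have hN : (- A) *m J *m (- A)^T = J.
  by rewrite linearN /= mulmxN !mulNmx opprK.
pose e : V := delta_mx ord0 ord0.
rewrite (isPO_future0 hA) (isPO_future0 hN) mulmxN [X in _ \/ 0 < X]mxE oppr_gt0.
apply/orP; rewrite orbC -neq_lt; apply: nonspacelike_coord0.
  apply: contraTneq (oner_neq0 R) => eA.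
  have := form_mulmx e e hA; rewrite eA form0l e0_form mxE => /eqP.
  by rewrite eq_sym oppr_eq0 => ->.
by rewrite form_mulmx // e0_form mxE lerN10.
Qed.

(** The sign of the time coordinate of a nonspacelike vector is preserved, and on an eigenvector it
    is multiplied by the sign of [c]. *)
Lemma isPO_eigen_gt0 A v c : isPO A -> v != 0 -> form v v <= 0 -> v *m A = c *: v ->
  0 < c.
Proof.
move=> hA vn0 qv vA; have := nonspacelike_coord0 vn0 qv; rewrite neq_lt => /orP[v0|v0].
  have : 0 < (- v *m A) ord0 ord0.
    by rewrite isPO_future ?formE ?opprK // mxE oppr_gt0.
  by rewrite mulNmx vA !mxE -mulrN pmulr_lgt0 // oppr_gt0.
by have := isPO_future hA qv v0; rewrite vA mxE pmulr_lgt0.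
Qed.

Lemma isom_eigen A v c : A *m J *m A^T = J -> v *m A = c *: v ->
  form v v = 0 \/ c ^+ 2 = 1.
Proof.
move=> hA vA; have := form_mulmx v v hA; rewrite vA !formE => /eqP.
rewrite mulrA -expr2 -subr_eq0 -{2}(mul1r (form v v)) -mulrBl mulf_eq0.
by rewrite subr_eq0 => /orP[/eqP|/eqP]; [right|left].
Qed.

Lemma sqr1_gt0 (c : R) : c ^+ 2 = 1 -> 0 < c -> c = 1.
Proof. by move=> h c0; apply/eqP; rewrite -(@eqrXn2 _ 2) ?ler01 ?ltW // h expr1n. Qed.

Definition perp m (U : 'M[R]_(m, n.+1)) : M := kermx (J *m U^T).

Lemma sub_perp m k (U : 'M[R]_(m, n.+1)) (W : 'M_(k, n.+1)) :
  (W <= perp U)%MS = (W *m J *m U^T == 0).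
Proof. by rewrite /perp sub_kermx mulmxA. Qed.

Lemma perpP m (U : 'M[R]_(m, n.+1)) v :
  reflect (forall u, (u <= U)%MS -> form v u = 0) (v <= perp U)%MS.
Proof.
rewrite sub_perp; apply: (iffP eqP) => [h u /submxP[x ->]|h].
  by rewrite /form trmx_mul mulmxA h mul0mx mxE.
apply/rowP => j; have := h (row j U) (row_sub j U).
by rewrite /form tr_row colE mulmxA -colE mxE => ->; rewrite mxE.
Qed.

Lemma perp_sym m k (U : 'M[R]_(m, n.+1)) (W : 'M_(k, n.+1)) :
  (W <= perp U)%MS = (U <= perp W)%MS.
Proof.
rewrite !sub_perp -(inj_eq trmx_inj) trmx0 !trmx_mul trmxK trmx_J mulmxA //.
Qed.

Lemma rank_perp m (U : 'M[R]_(m, n.+1)) : \rank (perp U) = (n.+1 - \rank U)%N.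
Proof.
rewrite /perp mxrank_ker -mxrank_tr trmx_mul trmxK trmx_J mxrankMfree //.
by rewrite row_free_unit J_unit.
Qed.

Lemma perp_full m (U : 'M[R]_(m, n.+1)) : (U :&: perp U = 0)%MS -> (U + perp U :=: 1%:M)%MS.
Proof.
move=> h; apply/eqmxP; rewrite submx1 sub1mx /row_full.
have := mxrank_sum_cap U (perp U); rewrite h mxrank0 addn0 rank_perp => ->.
by apply/eqP; rewrite subnKC ?rank_leq_col.
Qed.

Lemma perp_decomp m (U : 'M[R]_(m, n.+1)) v : (U :&: perp U = 0)%MS ->
  exists u w, [/\ v = u + w, (u <= U)%MS & (w <= perp U)%MS].
Proof.
move=> /perp_full h; have : (v <= U + perp U)%MS by rewrite h submx1.
by case/sub_addsmxP => -[x y] /= ->; exists (x *m U), (y *m perp U); rewrite !submxMl.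
Qed.

Lemma posdef_sub (U W : M) : (U <= W)%MS -> posdef W -> posdef U.
Proof. by move=> UW pW v vU; apply: pW; apply: submx_trans UW. Qed.

Lemma posdef_le (U : M) v : posdef U -> (v <= U)%MS -> form v v <= 0 -> v = 0.
Proof.
move=> pU vU qv; apply/eqP; apply: contraT => vn0.
by have := pU v vU vn0; rewrite QfE ltNge qv.
Qed.

Lemma posdef_cap_perp (U : M) : posdef U -> (U :&: perp U = 0)%MS.
Proof.
move=> pU; apply/eqP/rowV0P => v; rewrite sub_capmx => /andP[vU /perpP vp].
by apply: (posdef_le pU vU); rewrite vp.
Qed.

(** A nonspacelike vector orthogonal to the nonspacelike [z] is a multiple of [z]; inside [perp L]
    it would lie in the radical of [L]. *)
Lemma posdef_perp m (L : 'M[R]_(m, n.+1)) z : (L :&: perp L = 0)%MS -> (z <= L)%MS -> z != 0 ->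
  form z z <= 0 -> posdef (perp L).
Proof.
move=> hL zL zn0 qz v vL vn0; rewrite QfE ltNge; apply/negP => qv.
have [|c vE] := nonspacelike_orth zn0 qz qv; first by rewrite formC; move/perpP: vL; apply.
have : (v <= L :&: perp L)%MS by rewrite sub_capmx vL andbT vE scalemx_sub.
by rewrite hL submx0 (negPf vn0).
Qed.

Lemma posdef_perp_timelike z : form z z < 0 -> posdef (perp z).
Proof.
move=> qz v /perpP vz vn0; rewrite QfE ltNge; apply/negP => qv.
have zn0 : z != 0 by apply: contraTneq qz => ->; rewrite form0l ltxx.
have [|c vE] := nonspacelike_orth zn0 (ltW qz) qv; first by rewrite formC vz.
have := vz z (submx_refl z); rewrite vE formZl => /eqP.
rewrite mulf_eq0 (lt_eqF qz) orbF => /eqP c0.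
by rewrite vE c0 scale0r eqxx in vn0.
Qed.

(** By injectivity [U *m A] is all of [U], so [U] is also stable under the inverse of [A], which is
    the adjoint of [A]. *)
Lemma perp_stable m A (U : 'M[R]_(m, n.+1)) : A *m J *m A^T = J -> (U *m A <= U)%MS ->
  (perp U *m A <= perp U)%MS.
Proof.
move=> hA UA; have [Au Ai] := isom_invmx hA.
have UAi : (U *m invmx A <= U)%MS.
  have UAU : (U <= U *m A)%MS.
    by rewrite -(geq_leqif (mxrank_leqif_sup UA)) mxrankMfree // row_free_unit.
  by rewrite -[X in (_ <= X)%MS](mulmxK Au) submxMr.
apply/row_subP => i; rewrite row_mul; apply/perpP => u uU.
rewrite form_invmx //; have /perpP := row_sub i (perp U); apply.
exact: submx_trans (submxMr _ uU) UAi.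
Qed.

End LorentzForm.
Notation isom A := (A *m Jmx _ _ *m A^T = Jmx _ _).

(** * Primary components of a Lorentz isometry *)

Section Primary.
Variables (R : rcfType) (n : nat).
Local Notation M := 'M[R]_(n.+1).
Local Notation V := 'rV[R]_(n.+1).
Local Notation J := (Jmx R n).
Implicit Types (u v w z : V) (A : M) (p q : {poly R}).

(* Matrices in [Defs] act on columns; from here on [A] stands for a transpose,
   acting on row vectors by right multiplication. *)
Definition pcomp A p : M := kermxpoly A (p ^+ n.+1).

Lemma horner_mx_tr A p : horner_mx A^T p = (horner_mx A p)^T.
Proof.
elim/poly_ind: p => [|p c IH]; first by rewrite !rmorph0 trmx0.
rewrite !(rmorphD, rmorphM) /= !horner_mx_X !horner_mx_C IH.
have cA : horner_mx A p *m A = A *m horner_mx A p.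
  by symmetry; apply: comm_mx_horner.
by rewrite linearD /= tr_scalar_mx -[_ * A]/(_ *m A) cA trmx_mul.
Qed.

Lemma primcompE A p : primcomp A p = pcomp A^T p.
Proof. by rewrite /primcomp /mxker /pcomp /kermxpoly horner_mx_tr rmorphXn. Qed.

Lemma mxker_horner A p : mxker (horner_mx A p) = kermxpoly A^T p.
Proof. by rewrite /mxker /kermxpoly horner_mx_tr. Qed.

Lemma char_poly_tr A : char_poly A^T = char_poly A.
Proof.
rewrite /char_poly -det_tr; congr (\det _); rewrite /char_poly_mx.
by rewrite linearB /= tr_scalar_mx map_trmx trmxK.
Qed.

Lemma is_factor_tr A p : is_factor A^T p <-> is_factor A p.
Proof. by rewrite /is_factor char_poly_tr. Qed.

Lemma kerP A p v : (v <= kermxpoly A p)%MS = (v *m horner_mx A p == 0).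
Proof. by rewrite /kermxpoly sub_kermx. Qed.

Lemma hornerM_row A p q v : v *m horner_mx A (p * q) = v *m horner_mx A p *m horner_mx A q.
Proof. by rewrite rmorphM /= -mulmxE mulmxA. Qed.

Lemma horner_XsubC_row A a v : v *m horner_mx A ('X - a%:P) = v *m A - a *: v.
Proof. by rewrite rmorphB /= horner_mx_X horner_mx_C mulmxBr mul_mx_scalar. Qed.

Lemma horner_quad_row A s d v :
  v *m horner_mx A (quad s d) = v *m A *m A - s *: (v *m A) + d *: v.
Proof.
rewrite /quad rmorphD rmorphB /= linearZ /= rmorphXn /= horner_mx_X horner_mx_C.
by rewrite mulmxDr mulmxBr -scalemxAr mul_mx_scalar expr2 -mulmxE mulmxA.
Qed.

Lemma coprime_ker0 A p q v : coprimep p q ->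
  v *m horner_mx A p = 0 -> v *m horner_mx A q = 0 -> v = 0.
Proof.
move=> /(mxdirect_kermxpoly A) /eqP; rewrite -submx0 => h vp vq.
by apply/eqP; rewrite -submx0; apply: submx_trans h; rewrite sub_capmx !kerP vp vq eqxx.
Qed.

Lemma ker_sub_pcomp A p : (kermxpoly A p <= pcomp A p)%MS.
Proof.
apply/rV_subP => v; rewrite /pcomp !kerP => /eqP vp.
by rewrite exprS hornerM_row vp mul0mx.
Qed.

Lemma ker_stable A p : (kermxpoly A p *m A <= kermxpoly A p)%MS.
Proof. exact: comm_mx_stable_kermxpoly. Qed.

Lemma stable_row m (U : 'M[R]_(m, n.+1)) A v : (U *m A <= U)%MS -> (v <= U)%MS -> (v *m A <= U)%MS.
Proof. by move=> UA vU; apply: submx_trans (submxMr _ vU) UA. Qed.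

Lemma horner_stable_row (U : M) A p v : (U *m A <= U)%MS -> (v <= U)%MS ->
  (v *m horner_mx A p <= U)%MS.
Proof. by move=> UA; apply: stable_row; apply: horner_mx_stable. Qed.

Lemma perp_cap0 (U : M) v : posdef U -> (v <= U)%MS -> (v <= perp U)%MS -> v = 0.
Proof.
move=> pU vU vp; apply/eqP; rewrite -submx0 -(posdef_cap_perp pU).
by rewrite sub_capmx vU.
Qed.

(** Semisimplicity on a definite kernel: [perp K] is a stable complement, so a vector that p(A)
    sends into [K] has its [perp K] part sent into both [K] and [perp K], that is to 0. *)
Lemma posdef_ker_exp A p i v : isom A -> posdef (kermxpoly A p) ->
  v *m horner_mx A (p ^+ i) = 0 -> i != 0%N -> v *m horner_mx A p = 0.
Proof.
move=> hA pK; set K := kermxpoly A p in pK *.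
have KA : (K *m A <= K)%MS := ker_stable A p.
have PA := perp_stable hA KA.
elim: i v => // -[|i] IH v; first by rewrite expr1.
rewrite exprS hornerM_row => vp _.
have /eqP := IH _ vp isT; rewrite -kerP => vK.
have [u [w [vE uK wK]]] := perp_decomp v (posdef_cap_perp pK).
have up : u *m horner_mx A p = 0 by apply/eqP; rewrite -kerP.
move: vK; rewrite vE mulmxDl up add0r => wpK.
exact: perp_cap0 pK wpK (horner_stable_row _ PA wK).
Qed.

Lemma posdef_pcomp_row A p v : isom A -> posdef (kermxpoly A p) ->
  (v <= pcomp A p)%MS = (v <= kermxpoly A p)%MS.
Proof.
move=> hA pK; apply/idP/idP => [|vK]; last exact: submx_trans (ker_sub_pcomp A p).
by rewrite /pcomp !kerP => /eqP vp; apply/eqP; apply: posdef_ker_exp vp _.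
Qed.

Lemma posdef_pcompE A p : isom A -> posdef (pcomp A p) <-> posdef (kermxpoly A p).
Proof.
move=> hA; split=> [|pK]; first exact/posdef_sub/ker_sub_pcomp.
by move=> v; rewrite posdef_pcomp_row //; apply: pK.
Qed.

Lemma posdef_pcomp_ker A p : isom A -> posdef (pcomp A p) ->
  (pcomp A p :=: kermxpoly A p)%MS.
Proof.
move=> hA /(posdef_pcompE p hA) pK; apply/eqmxP; rewrite ker_sub_pcomp andbT.
by apply/rV_subP => v; rewrite posdef_pcomp_row.
Qed.

Lemma pcomp_stable A p : (pcomp A p *m A <= pcomp A p)%MS.
Proof. exact: ker_stable. Qed.

(** Split [v] along [U] and [perp U], both stable. The [U] part is killed by a power of q(A) as well
    as by a power of p(A), hence vanishes by coprimality. *)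
Lemma posdef_pcomp_perp A p q : isom A -> posdef (pcomp A p) -> coprimep p q ->
  (pcomp A q <= perp (pcomp A p))%MS.
Proof.
move=> hA pU cpq; set U := pcomp A p in pU *.
have UA : (U *m A <= U)%MS := pcomp_stable A p.
have PA := perp_stable hA UA.
apply/rV_subP => v; rewrite /pcomp kerP => /eqP vq.
have [u [w [vE uU wP]]] := perp_decomp v (posdef_cap_perp pU).
have uq : u *m horner_mx A (q ^+ n.+1) = 0.
  apply: perp_cap0 pU (horner_stable_row _ UA uU) _.
  have -> : u *m horner_mx A (q ^+ n.+1) = - (w *m horner_mx A (q ^+ n.+1)).
    by apply/eqP; rewrite -addr_eq0 -mulmxDl -vE vq.
  by rewrite eqmx_opp horner_stable_row.
suff -> : v = w by [].
rewrite vE (@coprime_ker0 A (p ^+ n.+1) (q ^+ n.+1) u) ?add0r //.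
  by rewrite coprimep_expl // coprimep_expr.
by apply/eqP; rewrite -kerP.
Qed.

(** Eliminating between the invariance relations of [v] and [v *m A]. When [s ^+ 2 < 4 * d] the
    factor [(1 + d) ^+ 2 - s ^+ 2] exceeds a square, so a vector of non-zero norm forces [d = 1]:
    the complex eigenvalues lie on the unit circle. *)
Lemma quad_form_key A s d v : isom A -> v *m A *m A = s *: (v *m A) - d *: v ->
  form (v *m A) v * (1 + d) = s * form v v /\
  form v v * ((1 - d) * ((1 + d) ^+ 2 - s ^+ 2)) = 0.
Proof.
move=> hr vAA.
have e1 := form_mulmx v v hr; have e2 := form_mulmx (v *m A) v hr.
have e3 := form_mulmx (v *m A) (v *m A) hr.
rewrite vAA !formE e1 in e2 e3; rewrite !(formC v) in e2 e3.
set c := form (v *m A) v in e2 e3 *; set x := form v v in e1 e2 e3 *.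
have hc : c * (1 + d) = s * x by lra.
split=> //; have h0 : (s ^+ 2 + d ^+ 2 - 1) * x = 2 * s * d * c by lra.
have : (s ^+ 2 + d ^+ 2 - 1) * x * (1 + d) = 2 * s * d * (c * (1 + d)) by rewrite h0; ring.
by rewrite hc => h; lra.
Qed.

(** A quadratic factor would make [v] and [v *m A] independent. If [v] is null they are orthogonal
    null vectors, if [v] is timelike they span a negative definite plane; a Lorentz form admits
    neither. *)
Lemma nonspacelike_factor A p v : isPO A -> p \is monic -> irreducible_poly p ->
  v != 0 -> form v v <= 0 -> v *m horner_mx A p = 0 ->
  exists2 l, 0 < l & p = 'X - l%:P.
Proof.
move=> hA mp ip vn0 qv; have hr := isPO_row hA.
case: (monic_irreducible_rcfP mp ip) => [[a pE]|[s [d [pE sd]]]]; rewrite pE.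
  rewrite horner_XsubC_row => /eqP; rewrite subr_eq0 => /eqP vA.
  by exists a => //; apply: isPO_eigen_gt0 vA.
rewrite horner_quad_row => /eqP; rewrite -addrA addr_eq0 opprD opprK => /eqP vAA.
exfalso; have d0 : 0 < d by have := sqr_ge0 s; lra.
have vAA' : v *m A *m A = s *: (v *m A) - d *: v by rewrite vAA.
have e1 := form_mulmx v v hr; have [hc key] := quad_form_key hr vAA'.
set c := form (v *m A) v in hc; set x := form v v in e1 key hc qv.
have noeig k : v *m A = k *: v -> False.
  move=> vA; move: vAA; rewrite vA -scalemxAl vA => /eqP.
  rewrite !scalerA -scaleNr -scalerDl -subr_eq0 -scalerBl scaler_eq0 (negPf vn0) orbF.
  move=> /eqP h; have := sqr_ge0 (2 * k - s); nra.
have xn0 : x != 0.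
  apply/eqP => x0; have c0 : c = 0.
    have : c * (1 + d) = 0 by rewrite hc x0 mulr0.
    by move/eqP; rewrite mulf_eq0 => /orP[/eqP //|]; lra.
  have [||k vA] := nonspacelike_orth vn0 qv (v := v *m A); rewrite ?e1 ?x0 //.
    by rewrite formC.
  exact: noeig vA.
have xl : x < 0 by rewrite lt_neqAle xn0.
have d1 : d = 1.
  move/eqP: key; rewrite !mulf_eq0 (negPf xn0) /= => /orP[/eqP|/eqP] h; first by lra.
  by exfalso; have := sqr_ge0 (1 - d); lra.
have cE : c = s / 2 * x by rewrite d1 in hc; lra.
(* The part of [v *m A] orthogonal to [v], the coefficient being [c / x]. It turns out timelike,
   like [v] itself. *)
pose w := v *m A - (s / 2) *: v.
have wv : form v w = 0.
  by rewrite /w !formE (formC v) -/c -/x cE; ring.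
have ww : form w w = x * (1 - s ^+ 2 / 4).
  by rewrite /w !formE (formC v (v *m A)) -/c -/x e1 cE; field.
have wl : form w w < 0 by rewrite ww nmulr_rlt0 //; rewrite d1 in sd; lra.
have [k wE] := nonspacelike_orth vn0 qv (ltW wl) wv.
move: wv wl; rewrite wE formZr -/x => /eqP; rewrite mulf_eq0 (negPf xn0) orbF => /eqP ->.
by rewrite scale0r form0l ltxx.
Qed.

Lemma ker_factor A p v : irreducible_poly p -> v != 0 -> v *m horner_mx A p = 0 ->
  p %| char_poly A.
Proof.
move=> ip vn0 vp; case: (irreducible_coprime_or_dvd (char_poly A) ip) => // cp.
have := coprime_ker0 cp vp; rewrite Cayley_Hamilton mulmx0 => /(_ erefl) v0.
by rewrite v0 eqxx in vn0.
Qed.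

(** Suppose p(A) is invertible. If [p] divides the minimal polynomial, the cofactor already
    annihilates [A], against minimality. If it is coprime to it, a root of [p] in R[i] is a root of
    the characteristic but not of the minimal polynomial; passing to R[i] is needed because a
    quadratic [p] has no root in [R]. *)
Lemma factor_ker_neq0 A p : irreducible_poly p -> p %| char_poly A ->
  kermxpoly A p != 0.
Proof.
move=> ip pc; apply: contraTneq isT => k0.
have pfree : row_free (horner_mx A p) by rewrite -kermx_eq0; apply/eqP.
set m := mxminpoly A.
case: (irreducible_coprime_or_dvd m ip) => [cp|/dvdpP[q mE]].
  pose toC : {rmorphism R -> R[i]%C} := complex.real_complex_def (Phant R).
  have [|z rz] := @closed_rootP R[i]%C (map_poly toC p) _.
    by rewrite size_map_poly neq_ltn; case: ip => -> _; rewrite orbT.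
  have rc : root (map_poly toC (char_poly A)) z.
    by case/dvdpP: pc => q ->; rewrite rmorphM rootM rz orbT.
  move: rc; rewrite map_char_poly -root_mxminpoly mxminpoly_map => rm.
  have : coprimep (map_poly toC p) (map_poly toC m) by rewrite coprimep_map.
  by move=> /coprimep_root /(_ rz); rewrite -rootE rm.
have q0 : horner_mx A q = 0.
  apply/eqP; rewrite -(mulmx_free_eq0 _ pfree) mulmxE -rmorphM -mE.
  by apply/eqP; exact: mx_root_minpoly.
have := mxminpoly_min q0; rewrite -/m => mq.
have mn0 : m != 0 by apply: monic_neq0; exact: mxminpoly_monic.
have qn0 : q != 0 by apply: contraNneq mn0 => q0'; rewrite mE q0' mul0r.
have := dvdp_leq qn0 mq; rewrite mE size_mul ?(irredp_neq0 ip) //.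
have [sp _] := ip; have := qn0; rewrite -size_poly_gt0; move: sp.
case: (size p) => [|[|k]] // _; case: (size q) => // j _; rewrite addSn !addnS /=.
by rewrite ltnS ltnNge leq_addr.
Qed.

Lemma kermxpoly_prod_seq A N (ps : seq {poly R}) :
  uniq ps -> (forall p q, p \in ps -> q \in ps -> p != q -> coprimep p q) ->
  (kermxpoly A (\prod_(p <- ps) p ^+ N) :=: \sum_(p <- ps) kermxpoly A (p ^+ N))%MS.
Proof.
elim: ps => [|p ps IH] /=.
  by rewrite !big_nil kermxpoly1.
move=> /andP[pps ups] cps; rewrite !big_cons.
have c : coprimep (p ^+ N) (\prod_(q <- ps) q ^+ N).
  rewrite (big_morph _ (fun x y => coprimepMr (p ^+ N) x y) (coprimep1 _)) big_all.
  apply/allP => q qps; rewrite coprimep_expl // coprimep_expr // cps ?mem_head //.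
    by rewrite inE qps orbT.
  by apply: contraNneq pps => ->.
apply: (eqmx_trans (kermxpolyM _ c)); apply: adds_eqmx => //; apply: IH => //.
by move=> x y xp yp; apply: cps; rewrite inE ?xp ?yp orbT.
Qed.

Lemma factors_exist A : exists2 ps : seq {poly R}, uniq ps &
  forall p, p \in ps <-> is_factor A p.
Proof.
have [l cE hl] := monic_factorization (char_poly_monic A).
exists (undup l) => [|p]; first exact: undup_uniq.
rewrite mem_undup; split=> [pl|[mp [ip pc]]].
  have [mp ip] := hl p pl; do 2!split=> //.
  by rewrite cE (big_rem p) //= dvdp_mulr.
rewrite cE in pc; have [q ql pq] := irreducible_dvd_prod ip pc.
have [mq iq] := hl q ql; by rewrite (irreducible_dvd_eq mp mq ip iq pq).
Qed.

Lemma factors_coprime A p q : is_factor A p -> is_factor A q -> p != q -> coprimep p q.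
Proof. by move=> [mp [ip _]] [mq [iq _]]; apply: monic_irreducible_coprime. Qed.

(** The minimal polynomial divides the characteristic one, which divides the product of the
    [n.+1]-st powers of its distinct irreducible factors. *)
Lemma pcomp_sum A (ps : seq {poly R}) : uniq ps ->
  (forall p, p \in ps <-> is_factor A p) ->
  (\sum_(p <- ps) pcomp A p :=: 1%:M)%MS.
Proof.
move=> ups hps.
apply: (eqmx_trans (eqmx_sym (@kermxpoly_prod_seq A n.+1 ps ups _))).
  by move=> p q /hps fp /hps fq; apply: factors_coprime fp fq.
apply: kermxpoly_min; apply: dvdp_trans (mxminpoly_dvd_char A) _.
have [l cE hl] := monic_factorization (char_poly_monic A).
have ul : perm_eq ps (undup l).
  apply: uniq_perm => // [|p]; first exact: undup_uniq.
  rewrite mem_undup; apply/idP/idP => [/hps[mp [ip pc]]|pl].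
    rewrite cE in pc; have [q ql pq] := irreducible_dvd_prod ip pc.
    have [mq iq] := hl q ql; by rewrite (irreducible_dvd_eq mp mq ip iq pq).
  have [mp ip] := hl p pl; apply/hps; do 2!split=> //.
  by rewrite cE (big_rem p) //= dvdp_mulr.
rewrite (perm_big _ ul) /= cE; apply: dvdp_prod_undup_exp.
(* Every irreducible factor has positive degree, so there are at most [n.+1] of them counted with
   multiplicity. *)
have : (size l < size (char_poly A))%N.
  rewrite cE; elim: l hl {cE ul} => [|q l IH] hl; first by rewrite big_nil size_poly1.
  have [mq [sq _]] := hl q (mem_head _ _).
  have hl' r : r \in l -> r \is monic /\ irreducible_poly r by move=> rl; apply: hl; rewrite inE rl orbT.
  rewrite big_cons size_monicM //; last first.
    by rewrite monic_neq0 // big_seq rpred_prod // => r rl; case: (hl' r rl).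
  have := IH hl'; case: (size q) sq => [|[|k]] // _.
  rewrite addSn /= => h; by rewrite ltnS (leq_trans h) // leq_addl.
by rewrite size_char_poly ltnS => h; apply: leq_trans h _.
Qed.

End Primary.

(** * The space-time decomposition *)

Section SpaceTime.
Variables (R : rcfType) (n : nat).
Local Notation M := 'M[R]_(n.+1).
Local Notation V := 'rV[R]_(n.+1).
Local Notation J := (Jmx R n).
Implicit Types (u v w z : V) (A : M) (p q : {poly R}).

Definition compsum A (l : seq {poly R}) : M := (\sum_(p <- l) pcomp A p)%MS.

Definition space_time A ps pt :=
  [/\ uniq ps, uniq pt,
      forall p, p \in ps <-> is_factor A p /\ posdef (pcomp A p)
    & forall p, p \in pt <-> is_factor A p /\ ~ posdef (pcomp A p)].

Lemma space_time_exists A : exists ps pt, space_time A ps pt.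
Proof.
have [l ul hl] := factors_exist A.
(* Definiteness is only a proposition; deciding it classically allows filtering the list of
   factors. *)
pose b p := if excluded_middle_informative (posdef (pcomp A p)) then true else false.
exists [seq p <- l | b p], [seq p <- l | ~~ b p].
split; rewrite ?filter_uniq // => p; rewrite mem_filter /b;
  by case: excluded_middle_informative => h /=; split=> [|[/hl]] // /hl.
Qed.

Lemma posdef_adds (U W : M) : posdef U -> posdef W -> (W <= perp U)%MS ->
  posdef (U + W)%MS.
Proof.
move=> pU pW WU v /sub_addsmxP[[x y] /= ->] vn0; rewrite QfE.
set u := x *m U; set w := y *m W; rewrite -/u -/w in vn0.
have uU : (u <= U)%MS by rewrite submxMl.
have wW : (w <= W)%MS by rewrite submxMl.
have /perpP/(_ u uU) wu := submx_trans wW WU.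
rewrite !formE (formC u) wu addr0 add0r.
have [u0|un0] := eqVneq u 0.
  by rewrite u0 form0l add0r pW //; rewrite u0 add0r in vn0.
rewrite ltr_wpDr ?pU //.
have [->|wn0] := eqVneq w 0; first by rewrite form0l.
exact/ltW/pW.
Qed.

Lemma compsum_sub A l (W : M) : (forall p, p \in l -> (pcomp A p <= W)%MS) ->
  (compsum A l <= W)%MS.
Proof.
rewrite /compsum; elim: l => [|p l IH] h; first by rewrite big_nil sub0mx.
rewrite big_cons addsmx_sub h ?mem_head // IH // => q ql.
by rewrite h // inE ql orbT.
Qed.

Lemma sub_compsum A l p : p \in l -> (pcomp A p <= compsum A l)%MS.
Proof.
rewrite /compsum; elim: l => [|q l IH] //; rewrite inE big_cons => /orP[/eqP ->|/IH h].
  exact: addsmxSl.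
exact: submx_trans h (addsmxSr _ _).
Qed.

Lemma compsum_comm_stable A l (h : M) : h *m A = A *m h ->
  (compsum A l *m h <= compsum A l)%MS.
Proof.
move=> hA; rewrite /compsum; elim: l => [|p l IH]; first by rewrite !big_nil mul0mx sub0mx.
rewrite !big_cons addsmxMr addsmxS //.
exact: comm_mx_stable_kermxpoly.
Qed.

Lemma compsum_posdef A l : isom A -> uniq l ->
  (forall p, p \in l -> is_factor A p /\ posdef (pcomp A p)) -> posdef (compsum A l).
Proof.
rewrite /compsum => hA; elim: l => [|p l IH] /= ul hl.
  by move=> v; rewrite big_nil submx0 => /eqP ->; rewrite eqxx.
move: ul => /andP[pl ul]; rewrite big_cons.
have hl' q : q \in l -> is_factor A q /\ posdef (pcomp A q).
  by move=> ql; apply: hl; rewrite inE ql orbT.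
have [fp pp] := hl p (mem_head _ _).
apply: posdef_adds => //; first exact: IH.
apply: compsum_sub => q ql; apply: posdef_pcomp_perp => //.
apply: factors_coprime fp (hl' q ql).1 _; by apply: contraNneq pl => ->.
Qed.

Lemma perp1 (W : M) : (W <= perp (1%:M : M))%MS -> W = 0.
Proof.
by rewrite sub_perp trmx1 mulmx1 mulmx_free_eq0 ?row_free_unit ?J_unit // => /eqP.
Qed.

Lemma perp_all0 v : (forall u, form v u = 0) -> v = 0.
Proof.
move=> h; apply/eqP; have : (v <= perp (1%:M : M))%MS by apply/perpP => u _.
by rewrite sub_perp trmx1 mulmx1 mulmx_free_eq0 ?row_free_unit ?J_unit.
Qed.

Lemma perpS m k (U : 'M[R]_(m, n.+1)) (W : 'M_(k, n.+1)) : (U <= W)%MS -> (perp W <= perp U)%MS.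
Proof.
move=> UW; apply/rV_subP => v /perpP h; apply/perpP => u uU; apply: h.
exact: submx_trans UW.
Qed.

Section Fixed.
Variables (A : M) (ps pt : seq {poly R}).
Hypotheses (hA : isPO A) (st : space_time A ps pt).
Let hr := isPO_row hA.
Let Vs := compsum A ps.
Let Vt := compsum A pt.

Lemma Vs_posdef : posdef Vs.
Proof. by case: st => us _ hs _; apply: compsum_posdef => // p /hs. Qed.

Lemma Vst_full : (Vs + Vt :=: 1%:M)%MS.
Proof.
case: st => us ut hs ht.
have -> : (Vs + Vt)%MS = compsum A (ps ++ pt) by rewrite /compsum big_cat.
apply: pcomp_sum => [|p].
  rewrite cat_uniq us ut andbT; apply/hasPn => p /ht[_ h]; apply/negP => /hs[_ h'].
  exact: h.
rewrite mem_cat; split=> [/orP[/hs[]|/ht[]] //|fp].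
have [h|h] := excluded_middle_informative (posdef (pcomp A p)).
  by apply/orP; left; apply/hs.
by apply/orP; right; apply/ht.
Qed.

Lemma Vt_perp_Vs : (Vt <= perp Vs)%MS.
Proof.
case: st => us ut hs ht; apply: compsum_sub => q /ht[fq nq].
rewrite perp_sym; apply: compsum_sub => p /hs[fp pp]; rewrite perp_sym.
apply: posdef_pcomp_perp => //; apply: factors_coprime fp fq _.
by apply: contra_not_neq nq => <-.
Qed.

(** The radical of [Vt] is orthogonal to [Vt] and to [Vs], hence to the whole space. *)
Lemma Vt_nondeg : (Vt :&: perp Vt = 0)%MS.
Proof.
apply: perp1; rewrite perp_sym.
have /eqmxP/andP[_ h1] := Vst_full; apply: submx_trans h1 _.
rewrite addsmx_sub; apply/andP; split; rewrite perp_sym; last exact: capmxSr.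
exact: submx_trans (capmxSl _ _) Vt_perp_Vs.
Qed.

Lemma perp_Vt : (perp Vt :=: Vs)%MS.
Proof.
apply/eqmxP; rewrite [X in _ && X]perp_sym Vt_perp_Vs andbT.
apply/rV_subP => v vp.
have : (v <= Vs + Vt)%MS by rewrite Vst_full submx1.
case/sub_addsmxP => -[x y] /= vE.
have yp : (y *m Vt <= perp Vt)%MS.
  have -> : y *m Vt = v - x *m Vs by rewrite vE addrC addKr.
  rewrite addmx_sub ?eqmx_opp //; apply: submx_trans (submxMl _ _) _.
  by rewrite perp_sym Vt_perp_Vs.
have : (y *m Vt <= Vt :&: perp Vt)%MS by rewrite sub_capmx submxMl.
by rewrite Vt_nondeg submx0 vE => /eqP ->; rewrite addr0 submxMl.
Qed.

(** A component is definite as soon as the plain kernel of p(A) is, so failure of definiteness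
    already shows in a vector of that kernel. *)
Lemma ptP p : p \in pt -> exists l z, [/\ 0 < l, p = 'X - l%:P, z != 0, form z z <= 0 & z *m A = l *: z].
Proof.
case: st => us ut hs ht /ht[[mp [ip pc]] np].
have [z [zK zn0 qz]] : exists z, [/\ (z <= kermxpoly A p)%MS, z != 0 & form z z <= 0].
  apply: NNPP => h; apply: np; apply/posdef_pcompE => // v vK vn0.
  by rewrite QfE ltNge; apply/negP => qv; apply: h; exists v.
rewrite kerP in zK; have [l l0 pE] := nonspacelike_factor hA mp ip zn0 qz (eqP zK).
exists l, z; split=> //; apply/eqP; rewrite -subr_eq0 -horner_XsubC_row -pE //.
Qed.

Lemma eigen_pt l z : z != 0 -> form z z <= 0 -> z *m A = l *: z -> 'X - l%:P \in pt.
Proof.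
case: st => us ut hs ht zn0 qz zA.
have zk : z *m horner_mx A ('X - l%:P) = 0 by rewrite horner_XsubC_row zA subrr.
apply/ht; split.
  split; first exact: monicXsubC.
  split; first exact: irredp_XsubC.
  by apply: ker_factor zn0 zk; apply: irredp_XsubC.
move=> /posdef_pcompE; move=> /(_ hr) pK.
by move: zn0; rewrite (posdef_le pK _ qz) ?eqxx // kerP zk.
Qed.

Lemma pt_neq0 : exists p, p \in pt.
Proof.
move: Vst_full; rewrite /Vt; case: pt => [|p l] h; last by exists p; rewrite mem_head.
pose e : V := delta_mx ord0 ord0.
have eVs : (e <= Vs)%MS.
  have : (e <= Vs + compsum A [::])%MS by rewrite h submx1.
  by rewrite /compsum big_nil addsmx0.
have := posdef_le Vs_posdef eVs; rewrite e0_form mxE eqxx lerN10 => /(_ isT) e0.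
by have /eqP := congr1 (fun v : V => v ord0 ord0) e0; rewrite !mxE eqxx oner_eq0.
Qed.

Lemma Vt_nonspacelike : exists z, [/\ (z <= Vt)%MS, z != 0 & form z z <= 0].
Proof.
have [p pp] := pt_neq0; have [l [z [l0 pE zn0 qz zA]]] := ptP pp.
exists z; split=> //; apply: submx_trans (sub_compsum A pp).
by apply: submx_trans (ker_sub_pcomp A p); rewrite kerP pE horner_XsubC_row zA subrr.
Qed.

End Fixed.

Lemma hyperbolic_plane z z' : form z z = 0 -> form z' z' = 0 -> form z z' = -1 ->
  let L := col_mx z z' in
  (L :&: perp L = 0)%MS /\ posdef (perp L).
Proof.
move=> qz qz' zz' L.
have zL : (z <= L)%MS by rewrite -addsmxE addsmxSl.
have z'L : (z' <= L)%MS by rewrite -addsmxE addsmxSr.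
have nd : (L :&: perp L = 0)%MS.
  apply/eqP/rowV0P => v; rewrite sub_capmx => /andP[].
  rewrite -{1}addsmxE => /sub_addsmxP[[x y] /= ->] /perpP h.
  move: (h z zL) (h z' z'L); rewrite [x]mx11_scalar [y]mx11_scalar !mul_scalar_mx !formE.
  rewrite qz qz' (formC z') zz' !mulr0 add0r addr0 !mulrN1 => /eqP; rewrite oppr_eq0 => /eqP ->.
  by move/eqP; rewrite oppr_eq0 => /eqP ->; rewrite !scale0r addr0.
split=> //; apply: (posdef_perp nd zL); rewrite ?qz //.
by apply: contra_eq_neq zz' => ->; rewrite form0l eq_sym oppr_eq0 oner_neq0.
Qed.

(** Eigenvectors for [a] with [a ^+ 2 != 1] are null, so a definite stable space has none;
    generalized ones are peeled off one factor at a time. *)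
Lemma posdef_eigen_inj A (W : M) a i v : isom A -> posdef W -> (W *m A <= W)%MS -> a ^+ 2 != 1 ->
  (v <= W)%MS -> v *m horner_mx A (('X - a%:P) ^+ i) = 0 -> v = 0.
Proof.
move=> hA pW WA a1; elim: i v => [|i IH] v vW.
  by rewrite expr0 rmorph1 mulmx1.
rewrite exprS mulrC hornerM_row horner_XsubC_row => /eqP; rewrite subr_eq0 => /eqP h.
have w0 : v *m horner_mx A (('X - a%:P) ^+ i) = 0.
  apply: (posdef_le pW); first exact: horner_stable_row.
  by case: (isom_eigen hA h) => [-> //|/eqP]; rewrite (negPf a1).
exact: IH w0.
Qed.

Section Dichotomy.
Variables (A : M) (ps pt : seq {poly R}).
Hypotheses (hA : isPO A) (st : space_time A ps pt).
Let hr := isPO_row hA.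
Let Vt := compsum A pt.

Definition hyperbolic_data (z z' : V) (l : R) := [/\ 0 < l, l != 1, z *m A = l *: z, z' *m A = l^-1 *: z'
  & [/\ form z z = 0, form z' z' = 0, form z z' = -1 & (Vt :=: col_mx z z')%MS]].

(** Invariance makes [z] orthogonal to the image of [A - l^-1]. Were this map invertible, [z] would
    be orthogonal to everything. *)
Lemma dual_eigenvector (l : R) z : l != 0 -> z != 0 -> z *m A = l *: z ->
  exists2 z' : V, z' != 0 & z' *m A = l^-1 *: z'.
Proof.
move=> l0 zn0 zA; apply: NNPP => h.
have fr : row_free (horner_mx A ('X - l^-1%:P)).
  rewrite -kermx_eq0; apply/rowV0P => v; rewrite sub_kermx horner_XsubC_row subr_eq0 => /eqP vA.
  by apply/eqP; apply: contraT => vn0; case: h; exists v.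
move: zn0; rewrite (_ : z = 0) ?eqxx //; apply: perp_all0 => u.
rewrite row_free_unit in fr; rewrite -(mulmxKV fr u) horner_XsubC_row.
set y := u *m _.
have := form_mulmx z y hr; rewrite zA !formE => <-.
by rewrite mulrA mulVf // mul1r subrr.
Qed.

(** A nonspacelike eigenvector for some [l] other than 1 is null and has a null partner for [l^-1].
    These two span a stable plane with definite complement, which leaves no room for further
    nonspacelike eigenvectors. *)
Lemma pt_dichotomy : pt = [:: 'X - 1%:P] \/ exists (z z' : V) l, hyperbolic_data z z' l.
Proof.
have [h|h] := excluded_middle_informative (forall p, p \in pt -> p = 'X - 1%:P).
  left; have [q qp] := pt_neq0 hA st; have [_ ut _ _] := st.
  have : perm_eq pt [:: 'X - 1%:P].
    apply: uniq_perm => // p; rewrite inE; apply/idP/eqP => [/h //|->].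
    by rewrite -(h q qp).
  by move/perm_small_eq => ->.
have [p [pp p1]] : exists p, p \in pt /\ p <> 'X - 1%:P.
  by apply: NNPP => h'; apply: h => p pp; apply: NNPP => p1; apply: h'; exists p.
clear h.
right; have [l [z [l0 pE zn0 qz zA]]] := ptP hA st pp.
have l1 : l != 1 by apply: contra_not_neq p1 => <-.
have ln0 : l != 0 by rewrite gt_eqF.
have l2 : l ^+ 2 != 1 by apply: contra_neq l1 => /sqr1_gt0; apply.
have li2 : l^-1 ^+ 2 != 1 by rewrite exprVn invr_eq1.
have qz0 : form z z = 0 by case: (isom_eigen hr zA) => // /eqP; rewrite (negPf l2).
have [z1 z1n0 z1A] := dual_eigenvector ln0 zn0 zA.
have qz1 : form z1 z1 = 0 by case: (isom_eigen hr z1A) => // /eqP; rewrite (negPf li2).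
(* Orthogonal null vectors are proportional, while the eigenvalues [l] and [l^-1] differ. *)
have zz1 : form z z1 != 0.
  apply/eqP => h0; have [||c z1E] := nonspacelike_orth zn0 _ _ h0; rewrite ?qz0 ?qz1 //.
  have := z1A; rewrite z1E -scalemxAl zA !scalerA => /eqP; rewrite -subr_eq0 -scalerBl scaler_eq0.
  rewrite (negPf zn0) orbF mulrC -mulrBl mulf_eq0 => /orP[|/eqP c0].
    by rewrite subr_eq0 -(inj_eq (mulfI ln0)) mulfV // -expr2 (negPf l2).
  by rewrite z1E c0 scale0r eqxx in z1n0.
pose z' := - (form z z1)^-1 *: z1.
have z'A : z' *m A = l^-1 *: z' by rewrite /z' -scalemxAl z1A !scalerA mulrC.
have qz' : form z' z' = 0 by rewrite /z' !formE qz1 !mulr0.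
have zz' : form z z' = -1 by rewrite /z' !formE mulNr mulVf.
clearbody z'.
exists z, z', l; split=> //; split=> //.
have [nd pL] := hyperbolic_plane qz0 qz' zz'.
set L := col_mx z z' in nd pL *.
have zL : (z <= L)%MS by rewrite -addsmxE addsmxSl.
have z'L : (z' <= L)%MS by rewrite -addsmxE addsmxSr.
have LA : (L *m A <= L)%MS.
  by rewrite mul_col_mx zA z'A -!addsmxE addsmxS // scalemx_sub.
have PA := perp_stable hr LA.
have z'n0 : z' != 0 by apply: contra_eq_neq zz' => ->; rewrite form0r eq_sym oppr_eq0 oner_neq0.
have zpt : 'X - l%:P \in pt by apply: (eigen_pt hA st zn0); rewrite ?qz0.
have z'pt : 'X - l^-1%:P \in pt by apply: (eigen_pt hA st z'n0); rewrite ?qz'.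
have ll : l != l^-1 by rewrite -(inj_eq (mulfI ln0)) mulfV // -expr2.
(* Invariance gives [form w z = b * l * form w z] and likewise for [z']; a third eigenvalue [b]
   would put [w] into the definite space [perp L]. *)
have ptE : perm_eq pt [:: 'X - l%:P; 'X - l^-1%:P].
  have [_ ut _ _] := st; apply: uniq_perm => //= [|q].
    rewrite inE andbT; apply: contra_neq ll => /(congr1 (fun q : {poly R} => q.[0])).
    by rewrite !hornerE => /oppr_inj.
  rewrite !inE; apply/idP/orP => [|[/eqP -> //|/eqP -> //]].
  move=> /(ptP hA st)[b [w [b0 qE wn0 qw wA]]].
  apply/orP; rewrite qE; apply: contraT; rewrite negb_or => /andP[h1 h2].
  have bl : b != l by apply: contra_neq h1 => ->.
  have bl' : b != l^-1 by apply: contra_neq h2 => ->.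
  have wz : form w z = 0.
    have := form_mulmx w z hr; rewrite wA zA !formE mulrA => /eqP.
    rewrite -subr_eq0 -{2}(mul1r (form w z)) -mulrBl mulf_eq0 => /orP[|/eqP //].
    rewrite subr_eq0 => /eqP h; move: bl'; rewrite -(inj_eq (mulIf ln0)) mulVf // h eqxx //.
  have wz' : form w z' = 0.
    have := form_mulmx w z' hr; rewrite wA z'A !formE mulrA => /eqP.
    rewrite -subr_eq0 -{2}(mul1r (form w z')) -mulrBl mulf_eq0 => /orP[|/eqP //].
    rewrite subr_eq0 => /eqP h; move: bl; rewrite -(inj_eq (mulIf (invr_neq0 ln0))) mulfV // h eqxx //.
  have wL : (w <= perp L)%MS.
    apply/perpP => u; rewrite -addsmxE => /sub_addsmxP[[x y] /= ->].
    by rewrite [x]mx11_scalar [y]mx11_scalar !mul_scalar_mx !formE wz wz' !mulr0 addr0.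
  by rewrite (posdef_le pL wL qw) eqxx in wn0.
have ker_in a (x : V) : x *m A = a *: x -> 'X - a%:P \in pt -> (x <= Vt)%MS.
  move=> xA xpt; apply: submx_trans (sub_compsum A xpt).
  by apply: submx_trans (ker_sub_pcomp A _); rewrite kerP horner_XsubC_row xA subrr.
have LV : (L <= Vt)%MS by rewrite -addsmxE addsmx_sub (ker_in _ _ zA) // (ker_in _ _ z'A).
(* The part of [v] in [perp L] is annihilated by powers of [A - l] and [A - l^-1], both injective on
   this definite space. *)
apply/eqmxP; rewrite LV andbT; apply/rV_subP => v vV.
have [x [y [vE xL yP]]] := perp_decomp v nd.
have yV : (y <= Vt)%MS.
  have -> : y = v - x by rewrite vE addrC addKr.
  by rewrite addmx_sub // eqmx_opp (submx_trans xL).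
suff y0 : y = 0 by rewrite vE y0 addr0.
have cps : forall p q, p \in pt -> q \in pt -> p != q -> coprimep p q.
  by have [_ _ _ ht] := st; move=> p' q /ht[fp _] /ht[fq _]; apply: factors_coprime fp fq.
have [_ ut _ _] := st.
have /eqmxP/andP[_ hsub] := @kermxpoly_prod_seq _ _ A n.+1 pt ut cps.
have := submx_trans yV hsub; rewrite kerP.
rewrite (perm_big _ ptE) /= !big_cons big_nil mulr1 hornerM_row => /eqP h.
apply: (posdef_eigen_inj hr pL PA l2 yP); apply: (posdef_eigen_inj hr pL PA li2 _ h).
exact: horner_stable_row.
Qed.

End Dichotomy.
End SpaceTime.

(** * Normal form of the parabolic part *)

Section Parabolic.
Variables (R : rcfType) (n : nat).
Local Notation M := 'M[R]_(n.+1).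
Local Notation V := 'rV[R]_(n.+1).
Local Notation J := (Jmx R n).
Implicit Types (u v w x y z : V) (A U : M) (p q : {poly R}).

(** A Jordan block of size three with a normalized Gram matrix, and the identity on its complement
    in [U]. Once [e] has norm 1, invariance forces the values [- 2^-1] and [-1]; [m] is chosen
    null. *)
Definition parabolic_data A U (m e k : V) :=
  [/\ [/\ (m <= U)%MS, (e <= U)%MS & (k <= U)%MS],
      [/\ m *m A = m + e, e *m A = e + k & k *m A = k],
      [/\ form m m = 0, form m e = - 2^-1 & form m k = -1],
      [/\ form e e = 1, form e k = 0 & form k k = 0]
    & forall w, (w <= U)%MS -> (w <= perp (col_mx m (col_mx e k)))%MS -> w *m A = w].

Lemma parabolic_gram_inj (m e k : V) (x : 'rV[R]_(1 + (1 + 1))) :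
  form m m = 0 -> form m e = - 2^-1 -> form m k = -1 ->
  form e e = 1 -> form e k = 0 -> form k k = 0 ->
  let L := col_mx m (col_mx e k) in (x *m L <= perp L)%MS -> x = 0.
Proof.
move=> mm me mk ee ek kk L.
have mL : (m <= L)%MS by rewrite -addsmxE addsmxSl.
have ekL : (col_mx e k <= L)%MS by rewrite -(addsmxE m) addsmxSr.
have eL : (e <= L)%MS by apply: submx_trans ekL; rewrite -addsmxE addsmxSl.
have kL : (k <= L)%MS by apply: submx_trans ekL; rewrite -addsmxE addsmxSr.
rewrite -[x]hsubmxK -[rsubmx x]hsubmxK /L !mul_row_col -/L.
move: (lsubmx x) (lsubmx (rsubmx x)) (rsubmx (rsubmx x)) => a b c /perpP h.
move: (h m mL) (h e eL) (h k kL).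
rewrite [a]mx11_scalar [b]mx11_scalar [c]mx11_scalar !mul_scalar_mx !formE.
rewrite !(formC e m) !(formC k) mm me mk ee ek kk.
move: (a 0 0) (b 0 0) (c 0 0) => a' b' c' h1 h2 h3.
have a0 : a' = 0 by lra.
have b0 : b' = 0 by rewrite a0 in h2; lra.
have c0 : c' = 0 by rewrite a0 b0 in h1; lra.
by rewrite a0 b0 c0 !raddf0 !row_mx0.
Qed.

Lemma parabolic_frame A U (m e k : V) : parabolic_data A U m e k ->
  let L := col_mx m (col_mx e k) in
  [/\ (L <= U)%MS, row_free L, (L :&: perp L = 0)%MS & posdef (perp L)].
Proof.
move=> [[mU eU kU] _ [mm me mk] [ee ek kk] _] L.
have inj := @parabolic_gram_inj m e k _ mm me mk ee ek kk.
have nd : (L :&: perp L = 0)%MS.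
  apply/eqP/rowV0P => v; rewrite sub_capmx => /andP[/submxP[x ->]] /inj ->.
  by rewrite mul0mx.
split=> //.
- by rewrite -addsmxE addsmx_sub mU -addsmxE addsmx_sub eU.
- rewrite -kermx_eq0; apply/rowV0P => x; rewrite sub_kermx => /eqP xL.
  by apply: inj; rewrite xL sub0mx.
apply: (posdef_perp nd (z := k)); rewrite ?kk //.
  by rewrite -(addsmxE m) (submx_trans _ (addsmxSr _ _)) // -addsmxE addsmxSr.
by apply: contra_eq_neq mk => ->; rewrite form0r eq_sym oppr_eq0 oner_neq0.
Qed.

Section Unipotent.
Variables (A U : M) (N : nat).
Hypotheses (hA : isom A) (UA : (U *m A <= U)%MS) (nd : (U :&: perp U = 0)%MS).
Hypothesis nil : forall v, (v <= U)%MS -> v *m (A - 1) ^+ N = 0.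

Let D := A - 1.
Let pw (i : nat) v : V := v *m D ^+ i.

Let pw0 v : pw 0 v = v. Proof. by rewrite /pw expr0 mulmx1. Qed.
Let pwS i v : pw i.+1 v = pw i v *m D. Proof. by rewrite /pw exprSr -mulmxE mulmxA. Qed.
Let mulD v : v *m D = v *m A - v. Proof. by rewrite /D mulmxBr mulmx1. Qed.
Let pw_U i v : (v <= U)%MS -> (pw i v <= U)%MS.
Proof.
move=> vU; elim: i => [|i IH]; first by rewrite pw0.
by rewrite pwS mulD addmx_sub ?eqmx_opp // stable_row.
Qed.
Let pwD i j v : pw i (pw j v) = pw (j + i) v.
Proof. by rewrite /pw -mulmxA mulmxE exprD. Qed.

(** Invariance of the form rewritten for [A = 1 + D]; it plays the part of skew-adjointness of [D],
    with a correction term of higher order. *)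
Let skew x y : form (x *m D) y + form x (y *m D) + form (x *m D) (y *m D) = 0.
Proof. by have := form_mulmx x y hA; rewrite !mulD !formE => ->; ring. Qed.

(* Moving one factor of [A - 1] across the form raises the total exponent. *)
Let form_pw k j a b x y : (forall v, (v <= U)%MS -> pw k.+1 v = 0) ->
  (x <= U)%MS -> (y <= U)%MS -> (k < a + b)%N -> (k < b + j)%N ->
  form (pw a x) (pw b y) = 0.
Proof.
move=> hk; have hk' b' y' : (y' <= U)%MS -> (k < b')%N -> pw b' y' = 0.
  by move=> yU kb; rewrite -(subnK kb) -pwD hk // pw_U.
elim: j a b x y => [|j IH] a b x y xU yU ab bj.
  by rewrite (hk' b) ?form0r //; rewrite addn0 in bj.
case: a ab => [|a] ab; first by rewrite (hk' b) ?form0r.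
have bj' : (k < b.+1 + j)%N by rewrite addSnnS.
have ab' : (k < a + b.+1)%N by rewrite -addSnnS.
have := skew (pw a x) (pw b y); rewrite -!pwS (IH a b.+1) // (IH a.+1 b.+1) ?addr0 //.
by rewrite addSn ltnW.
Qed.

(** If [D ^+ k.+1] is the first power vanishing on [U], images of [D ^+ a] and [D ^+ b] are
    orthogonal whenever [a + b > k]. Since orthogonal null vectors are proportional, only [k = 2]
    survives. *)
Lemma nilpotency_two : (exists2 v : V, (v <= U)%MS & v *m A != v) ->
  (forall v, (v <= U)%MS -> pw 3 v = 0) /\ exists2 v : V, (v <= U)%MS & pw 2 v != 0.
Proof.
move=> [v0 v0U v0A].
pose P k := excluded_middle_informative (forall v, (v <= U)%MS -> pw k v = 0).
have exP : exists k, (if P k then true else false).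
  by exists N; case: (P N) => // h; exfalso; apply: h => v; exact: nil.
case: (ex_minnP exP) => k1; case: (P k1) => // hk1 _ kmin.
have notP k : (k < k1)%N -> exists2 v : V, (v <= U)%MS & pw k v != 0.
  move=> kk1; apply: NNPP => h; have := kmin k; case: (P k) => [h1|h'] /=.
    by move=> /(_ isT); rewrite leqNgt kk1.
  exfalso; apply: h' => v vU; apply/eqP; apply: contraT => vn; case: h; by exists v.
case: k1 hk1 kmin notP => [|k] hk _ notP.
  by move: v0A; rewrite -(pw0 v0) (hk _ v0U) mul0mx eqxx.
have iso a b x y : (x <= U)%MS -> (y <= U)%MS -> (k < a + b)%N -> form (pw a x) (pw b y) = 0.
  by move=> xU yU ab; apply: (@form_pw k k.+1) => //; rewrite addnS ltnS leq_addl.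
have [m0 m0U m0k] := notP k (ltnSn k).
have nsp x y : x != 0 -> form x x = 0 -> form y y = 0 -> form x y = 0 -> exists c, y = c *: x.
  by move=> xn xx yy xy; apply: nonspacelike_orth => //; rewrite ?xx ?yy.
(* [k = 0] means that [A] fixes [U]; [k = 1] and [k >= 3] are contradictory. *)
case: k => [|[|[|k]]] in hk notP iso m0k *.
- move: v0A; have := hk _ v0U; rewrite pwS pw0 mulD => /eqP; rewrite subr_eq0 => ->.
  by [].
- (* [D ^ 2 = 0] forces the image of [D] to be a null line on which [D] vanishes *)
  exfalso; set k0 := pw 1 m0 in m0k.
  have iso1 x : (x <= U)%MS -> exists c, pw 1 x = c *: k0.
    by move=> xU; apply: nsp => //; apply: iso.
  have k0U : (k0 <= U)%MS by apply: pw_U.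
  have [y yU yk] : exists2 y : V, (y <= U)%MS & form k0 y != 0.
    apply: NNPP => h; move: m0k; rewrite -submx0 -nd sub_capmx k0U /=.
    move/negP; apply; apply/perpP => y yU; apply/eqP; apply: contraT => hy.
    by case: h; exists y.
  have sk a b : (a <= U)%MS -> (b <= U)%MS -> form (pw 1 a) b + form a (pw 1 b) = 0.
    move=> aU bU; have := skew a b; rewrite -{1 2 3 4}(pw0 a) -{1 2 3 4}(pw0 b) -!pwS.
    by rewrite (iso 1%N 1%N) // addr0 !pw0.
  have [c yE] := iso1 y yU.
  have := sk y y yU yU; rewrite (formC y) yE formZl => /eqP.
  rewrite -mulr2n mulrn_eq0 /= mulf_eq0 (negPf yk) orbF => /eqP c0.
  have := sk m0 y m0U yU; rewrite yE c0 scale0r form0r addr0 => /eqP.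
  by rewrite (negPf yk).
- by split=> //; exists m0.
(* For [k >= 3] the last two non-zero iterates of [m0] are null and orthogonal, so the earlier is a
   multiple of the later; applying [D] once more kills the later. *)
exfalso; have [||||c hc] := @nsp (pw k.+3 m0) (pw k.+2 m0) => //.
- by apply: iso => //; rewrite -[X in (X < _)%N]addn0 ltn_add2l.
- by apply: iso => //; rewrite !addSn !addnS !ltnS leq_addr.
- by apply: iso => //; rewrite -[X in (X < _)%N]addn0 ltn_add2l.
by move: m0k; rewrite pwS hc -scalemxAl -pwS hk // scaler0 eqxx.
Qed.

(** Start from [m0] with [D ^+ 2] non-zero on it. Its image under [D] is spacelike, for otherwise it
    would be proportional to the null vector [pw 2 m0]; scaling makes its norm 1. *)
Lemma parabolic_normal_form : (exists2 v : V, (v <= U)%MS & v *m A != v) ->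
  exists m e k : V, parabolic_data A U m e k.
Proof.
move=> hv; have [nil3 [m0 m0U m0n]] := nilpotency_two hv.
have iso a b x y : (x <= U)%MS -> (y <= U)%MS -> (2 < a + b)%N -> form (pw a x) (pw b y) = 0.
  by move=> xU yU ab; apply: (@form_pw 2 3) => //; rewrite addnS ltnS leq_addl.
have qe0 : 0 < form (pw 1 m0) (pw 1 m0).
  rewrite ltNge; apply/negP => qe.
  have [|c h] := nonspacelike_orth m0n _ qe (iso 2%N 1%N _ _ m0U m0U isT).
    by rewrite iso.
  by move: m0n; rewrite pwS h -scalemxAl -pwS nil3 // scaler0 eqxx.
set s := form _ _ in qe0; pose m1 := (Num.sqrt s)^-1 *: m0.
have m1U : (m1 <= U)%MS by rewrite scalemx_sub.
pose e := pw 1 m1; pose k := pw 2 m1.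
have eU : (e <= U)%MS by exact: pw_U.
have kU : (k <= U)%MS by exact: pw_U.
have ee : form e e = 1.
  rewrite /e /pw /m1 -!scalemxAl !formE mulrA -/s -invfM -expr2 sqr_sqrtr ?ltW //.
  by rewrite mulVf // gt_eqF.
have kk : form k k = 0 by exact: iso.
have ek : form e k = 0 by exact: iso.
have eD : e *m D = k by rewrite /e -pwS.
have kD : k *m D = 0 by rewrite /k -pwS nil3.
have m1D : m1 *m D = e by rewrite /e pwS pw0.
have m1e : form m1 e = - 2^-1.
  have := skew m1 m1; rewrite m1D ee (formC e) => h; lra.
have m1k : form m1 k = -1.
  by have := skew m1 e; rewrite m1D eD ee ek => h; lra.
clearbody e k; clearbody m1.
(* As [form m1 k = -1], this multiple of [k] cancels the norm of [m1]; since [D] kills [k], the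
   image under [D] stays [e]. *)
pose m := m1 + (form m1 m1 / 2) *: k.
have mU : (m <= U)%MS by rewrite addmx_sub // scalemx_sub.
have mD : m *m D = e by rewrite /m mulmxDl m1D -scalemxAl kD scaler0 addr0.
have mm : form m m = 0 by rewrite /m !formE (formC k m1) m1k kk; field.
have me : form m e = - 2^-1 by rewrite /m !formE (formC k) ek mulr0 addr0.
have mk : form m k = -1 by rewrite /m !formE kk mulr0 addr0.
clearbody m.
have DA (x : V) : x *m A = x + x *m D by rewrite mulD addrC subrK.
exists m, e, k; split=> //.
  by rewrite !DA mD eD kD addr0.
set L := col_mx m (col_mx e k) => w wU wL.
have mL : (m <= L)%MS by rewrite -addsmxE addsmxSl.
have ekL : (col_mx e k <= L)%MS by rewrite -(addsmxE m) addsmxSr.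
have eL : (e <= L)%MS by apply: submx_trans ekL; rewrite -addsmxE addsmxSl.
have kL : (k <= L)%MS by apply: submx_trans ekL; rewrite -addsmxE addsmxSr.
have ndL : (L :&: perp L = 0)%MS.
  apply/eqP/rowV0P => v; rewrite sub_capmx => /andP[/submxP[x ->]].
  by move=> /(parabolic_gram_inj mm me mk ee ek kk) ->; rewrite mul0mx.
have LA : (L *m A <= L)%MS.
  rewrite !mul_col_mx !DA mD eD kD addr0 -addsmxE addsmx_sub addmx_sub //=.
  by rewrite -(addsmxE (e + k)) addsmx_sub addmx_sub.
have kn0 : k != 0 by apply: contra_eq_neq mk => ->; rewrite form0r eq_sym oppr_eq0 oner_neq0.
have pL : posdef (perp L) by apply: (posdef_perp ndL kL kn0); rewrite kk.
have PA := perp_stable hA LA.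
have pwL i : (pw i w <= perp L)%MS.
  elim: i => [|i IH]; first by rewrite pw0.
  by rewrite pwS mulD addmx_sub ?eqmx_opp // stable_row.
(* On the definite space [perp L] null vectors vanish: [pw 2 w] is null because 4 > 2, and then
   [skew] makes [pw 1 w] null too. *)
have w2 : pw 2 w = 0 by apply: (posdef_le pL (pwL 2%N)); rewrite iso.
have w1 : pw 1 w = 0.
  apply: (posdef_le pL (pwL 1%N)).
  have := skew w (pw 1 w); rewrite -pwS w2 form0r form0r !addr0.
  by rewrite -{1}(pw0 w) -pwS => ->.
by rewrite DA -{2}(pw0 w) -pwS w1 addr0.
Qed.

End Unipotent.
End Parabolic.

(** * Frames and partial isometries *)

Section Frames.
Variables (R : rcfType) (n : nat).
Local Notation M := 'M[R]_(n.+1).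
Local Notation V := 'rV[R]_(n.+1).
Local Notation J := (Jmx R n).
Implicit Types (u v w x y z : V) (A G U W X : M) (p q : {poly R}).

Lemma nondeg_split m (L : 'M[R]_(m, n.+1)) W : (L <= W)%MS -> (L :&: perp L = 0)%MS ->
  (L + (W :&: perp L) :=: W)%MS /\ (\rank W = \rank L + \rank (W :&: perp L))%N.
Proof.
move=> LW nd; have e : (L + (W :&: perp L) :=: W)%MS.
  apply/eqmxP; rewrite addsmx_sub LW capmxSl /=; apply/rV_subP => v vW.
  have [u [w [vE uL wP]]] := perp_decomp v nd.
  have wW : (w <= W)%MS.
    have -> : w = v - u by rewrite vE addrC addKr.
    by rewrite addmx_sub // eqmx_opp (submx_trans uL).
  by rewrite vE addmx_sub_adds // sub_capmx wW.
split=> //; rewrite -mxrank_sum_cap e (_ : (L :&: _)%MS = 0) ?mxrank0 ?addn0 //.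
by apply/eqP; rewrite -submx0 -nd capmxS // capmxSr.
Qed.

Lemma gram_col m k (X : 'M[R]_(m, n.+1)) (Y : 'M_(k, n.+1)) :
  col_mx X Y *m J *m (col_mx X Y)^T =
  block_mx (X *m J *m X^T) (X *m J *m Y^T) (Y *m J *m X^T) (Y *m J *m Y^T).
Proof. by rewrite tr_col_mx mul_col_mx mul_mx_row !mul_col_mx block_mxEh. Qed.

Lemma gram_free m (E : 'M[R]_(m, n.+1)) : E *m J *m E^T = 1%:M -> row_free E.
Proof. by move=> h; apply/row_freeP; exists (J *m E^T); rewrite mulmxA. Qed.

Lemma gram_nondeg m (E : 'M[R]_(m, n.+1)) : E *m J *m E^T = 1%:M -> (E :&: perp E = 0)%MS.
Proof.
move=> h; apply/eqP/rowV0P => v; rewrite sub_capmx => /andP[/submxP[x ->]].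
by rewrite sub_perp -!mulmxA (mulmxA E) h mulmx1 => /eqP ->; rewrite mul0mx.
Qed.

Lemma perp_gram m k (X : 'M[R]_(m, n.+1)) (Y : 'M_(k, n.+1)) : (Y <= perp X)%MS ->
  Y *m J *m X^T = 0 /\ X *m J *m Y^T = 0.
Proof. by move=> h; split; apply/eqP; rewrite -sub_perp // perp_sym. Qed.

Lemma unit_vector W : posdef W -> W != 0 -> exists2 v : V, (v <= W)%MS & form v v = 1.
Proof.
move=> pW Wn0; pose v := nz_row W.
have vW : (v <= W)%MS := nz_row_sub W.
have qv : 0 < form v v by apply: pW; rewrite // nz_row_eq0.
exists ((Num.sqrt (form v v))^-1 *: v); first exact: scalemx_sub.
rewrite !formE mulrA -invfM -expr2 sqr_sqrtr ?ltW //.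
by rewrite mulVf // gt_eqF.
Qed.

Lemma orthonormal_basis W d : posdef W -> \rank W = d ->
  exists2 E : 'M[R]_(d, n.+1), (E :=: W)%MS & E *m J *m E^T = 1%:M.
Proof.
elim: d W => [|d IH] W pW rW.
  have W0 : W = 0 by apply/eqP; rewrite -mxrank_eq0 rW.
  by exists 0; [rewrite W0; apply/eqmxP; rewrite !sub0mx | rewrite [LHS]flatmx0 [RHS]flatmx0].
have [|v vW vv] := unit_vector pW; first by rewrite -mxrank_eq0 rW.
have gv : v *m J *m v^T = 1%:M by rewrite form_mx vv.
have [sW rk] := nondeg_split vW (gram_nondeg gv).
have rv : \rank v = 1%N by apply/eqP; rewrite -/(row_free v) gram_free.
have [||E EW EE] := IH (W :&: perp v)%MS.
- by apply: posdef_sub pW; rewrite capmxSl.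
- by move: rk; rewrite rW rv add1n => -[].
have Ev : (E <= perp v)%MS by rewrite EW capmxSr.
have [Ev1 Ev2] := perp_gram Ev.
exists (col_mx v E : 'M_(1 + d, n.+1)).
  exact: eqmx_trans (eqmx_trans (eqmx_sym (addsmxE v E)) (adds_eqmx (eqmx_refl v) EW)) sW.
by rewrite (@gram_col 1 d) gv EE Ev1 Ev2 -scalar_mx_block.
Qed.

Definition rot2 : 'M[R]_(1 + 1) := block_mx 0 1 (-1) 0.

(** The standard complex structure: [d] diagonal blocks, each a quarter turn of a plane. *)
Fixpoint complex_mx d : 'M[R]_(d.*2) :=
  if d is d'.+1 then block_mx rot2 0 0 (complex_mx d') : 'M_(1 + 1 + d'.*2) else 0.

(** [v] and [v *m F] are orthogonal, because applying [F] to both arguments changes the sign of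
    their pairing. So a unit [v] splits off an orthonormal stable plane, and its complement in [W]
    is again stable; [r] bounds the rank for the induction. *)
Lemma complex_basis F W r : posdef W -> (W *m F <= W)%MS ->
  (forall v, (v <= W)%MS -> v *m F *m F = - v) ->
  (forall u v, (u <= W)%MS -> (v <= W)%MS -> form (u *m F) (v *m F) = form u v) ->
  (\rank W <= r)%N ->
  exists d (E : 'M[R]_(d.*2, n.+1)), [/\ \rank W = d.*2,
    (E :=: W)%MS, E *m J *m E^T = 1%:M & E *m F = complex_mx d *m E].
Proof.
elim: r W => [|r IH] W pW WF FF Fi rW.
  exists 0, 0; have W0 : W = 0 by apply/eqP; rewrite -mxrank_eq0 -leqn0.
  split; first by rewrite W0 mxrank0.
  - by rewrite W0; apply/eqmxP; rewrite !sub0mx.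
  - by rewrite [LHS]flatmx0 [RHS]flatmx0.
  by rewrite [LHS]flatmx0 [RHS]flatmx0.
have [W0|Wn0] := eqVneq W 0.
  by apply: IH => //; rewrite W0 mxrank0.
have [v vW vv] := unit_vector pW Wn0.
have vFW : (v *m F <= W)%MS by apply: stable_row.
have vvF : form v (v *m F) = 0.
  have := Fi v (v *m F) vW vFW; rewrite FF // formNr (formC (v *m F)) => h; lra.
pose L := col_mx v (v *m F).
have gL : L *m J *m L^T = 1%:M.
  rewrite gram_col !form_mx Fi // vv (formC (v *m F)) vvF.
  by rewrite (scalar_mx_block 1 1 1) !raddf0.
have LW : (L <= W)%MS by rewrite -addsmxE addsmx_sub vW.
have [sW rk] := nondeg_split LW (gram_nondeg gL).
have rL : \rank L = 2%N by apply/eqP; rewrite -/(row_free L) gram_free.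
set W' := (W :&: perp L)%MS in sW rk.
have W'W : (W' <= W)%MS by rewrite capmxSl.
have W'F : (W' *m F <= W')%MS.
  apply/row_subP => i; rewrite row_mul; have := row_sub i W'; move: (row i W') => w.
  rewrite !sub_capmx => /andP[wW /perpP wL]; rewrite (stable_row WF wW) /=.
  have vL : (v <= L)%MS by rewrite -addsmxE addsmxSl.
  have vFL : (v *m F <= L)%MS by rewrite -addsmxE addsmxSr.
  apply/perpP => u; rewrite -addsmxE => /sub_addsmxP[[x y] /= ->].
  rewrite [x]mx11_scalar [y]mx11_scalar !mul_scalar_mx !formE Fi // wL //.
  have -> : form (w *m F) v = - form (w *m F) (v *m F *m F) by rewrite FF // formNr opprK.
  by rewrite Fi // wL // oppr0 !mulr0 addr0.
have [|||||d [E [rE EW gE EF]]] := IH W' => //.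
- exact: posdef_sub pW.
- by move=> w wW; apply: FF; apply: submx_trans W'W.
- by move=> u w uW wW; apply: Fi; apply: submx_trans W'W.
- by move: rW; rewrite rk rL add2n ltnS => /ltnW.
exists d.+1, (col_mx L E : 'M_(1 + 1 + d.*2, n.+1)).
have EL : (E <= perp L)%MS by rewrite EW capmxSr.
have [h1 h2] := perp_gram EL.
split.
- by rewrite rk rL rE doubleS add2n.
- exact: eqmx_trans (eqmx_trans (eqmx_sym (addsmxE L E)) (adds_eqmx (eqmx_refl L) EW)) sW.
- by rewrite (@gram_col 2 d.*2) gL gE h1 h2 -scalar_mx_block.
have rLF : L *m F = rot2 *m L.
  rewrite /L mul_col_mx FF // /rot2 mul_block_col !mul0mx add0r addr0.
  by rewrite mul1mx mulNmx mul1mx.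
rewrite [complex_mx _]/= (mul_col_mx L E) EF (@mul_block_col _ 2 d.*2 2 d.*2).
by rewrite !mul0mx addr0 add0r rLF.
Qed.

(** On [U] the conjugate of [G] by [X] is a polynomial in [A], and [A] a polynomial in the conjugate
    of [G]. This is weaker than conjugacy, as eigenvalues may differ, yet both generate the same
    algebra on [U]. *)
Definition local_twin A G U U' X :=
  [/\ (U *m A <= U)%MS, (U *m X :=: U')%MS,
      forall u v, (u <= U)%MS -> (v <= U)%MS -> form (u *m X) (v *m X) = form u v,
      exists q, forall u, (u <= U)%MS -> u *m horner_mx A q *m X = u *m X *m G
    & exists q, forall u, (u <= U)%MS -> u *m A *m X = u *m X *m horner_mx G q].

Lemma local_twin_ext A G U U' X Y : (forall u, (u <= U)%MS -> u *m X = u *m Y) ->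
  local_twin A G U U' X -> local_twin A G U U' Y.
Proof.
move=> XY [UA UX iX [q hq] [q' hq']].
have UXY : U *m X = U *m Y by apply/row_matrixP => i; rewrite !row_mul XY // row_sub.
split=> //; first by rewrite -UXY.
- by move=> u v uU vU; rewrite -!XY // iX.
- by exists q => u uU; rewrite -!XY ?hq // horner_stable_row.
by exists q' => u uU; rewrite -!XY ?hq' // stable_row.
Qed.

(** In frames with equal Gram matrices both maps are affine in the same matrix [C]. Solving
    [a + b C] for [C] expresses each as an affine polynomial in the other. *)
Lemma frame_twin d (E E' : 'M[R]_(d, n.+1)) (C : 'M[R]_d) a b a' b' A G U U' :
  (E :=: U)%MS -> (E' :=: U')%MS -> row_free E -> E *m J *m E^T = E' *m J *m E'^T ->
  E *m A = a *: E + b *: (C *m E) -> E' *m G = a' *: E' + b' *: (C *m E') ->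
  b != 0 -> b' != 0 -> exists X, local_twin A G U U' X.
Proof.
(* [Y] is a right inverse of the frame [E], so [Y *m E'] carries [E] to [E']. *)
move=> EU EU' fE gE EA EG b0 b0'; have [Y EY] := row_freeP fE.
exists (Y *m E'); have EX : E *m (Y *m E') = E' by rewrite mulmxA EY mul1mx.
have inE u : (u <= U)%MS -> exists c, u = c *m E by rewrite -EU => /submxP.
have lin (H : M) s t (c0 : 'rV_d) D (F : 'M[R]_(d, n.+1)) :
    F *m H = s *: F + t *: (D *m F) -> forall k l : R,
    c0 *m F *m horner_mx H (k *: 'X + l%:P) = c0 *m ((k * s + l) *: F + (k * t) *: (D *m F)).
  move=> FH k l; rewrite rmorphD /= linearZ /= horner_mx_X horner_mx_C mulmxDr -scalemxAr mul_mx_scalar.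
  rewrite -(mulmxA c0 F H) FH !(mulmxDr, scalerDl, scalerDr) -!scalemxAr !scalerA.
  by rewrite addrAC.
split.
- apply/row_subP => i; rewrite row_mul; have [c ->] := inE _ (row_sub i U).
  by rewrite -mulmxA EA -EU mulmx_sub // addmx_sub ?scalemx_sub ?submxMl.
- have h := eqmxMr (Y *m E') EU; rewrite EX in h; exact: eqmx_trans (eqmx_sym h) EU'.
- move=> u v /inE[c ->] /inE[e ->]; rewrite -!(mulmxA _ E) EX /form !trmx_mul.
  by rewrite !mulmxA -!(mulmxA c) -gE.
- exists ((b' / b) *: 'X + (a' - b' / b * a)%:P) => u /inE[c ->].
  rewrite (lin _ _ _ _ _ _ EA) divfK // (_ : b' / b * a + _ = a'); last by ring.
  by rewrite -!(mulmxA c) EX EG mulmxDl -!scalemxAl -(mulmxA C) EX.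
exists ((b / b') *: 'X + (a - b / b' * a')%:P) => u /inE[c ->].
rewrite -(mulmxA c E (Y *m E')) EX (lin _ _ _ _ _ _ EG) divfK // (_ : b / b' * a' + _ = a); last by ring.
by rewrite -(mulmxA c E) EA -(mulmxA c) mulmxDl -!scalemxAl -(mulmxA C) EX.
Qed.

Lemma sums_sub (S : seq M) W : (forall U, U \in S -> (U <= W)%MS) ->
  (\sum_(U <- S) U <= W)%MS.
Proof.
elim: S => [|U S IH] h; first by rewrite big_nil sub0mx.
rewrite big_cons addsmx_sub h ?mem_head // IH // => W' WS.
by rewrite h // inE WS orbT.
Qed.

(** Orthogonality is asked on both sides, nondegeneracy on the source side, where the projections
    for gluing are taken. *)
Fixpoint orth_chain (S : seq (M * M)) : Prop :=
  if S is s :: S' then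
    [/\ (s.1 :&: perp s.1 = 0)%MS, (\sum_(t <- S') t.1 <= perp s.1)%MS,
        (\sum_(t <- S') t.2 <= perp s.2)%MS & orth_chain S']
  else True.

(** The middle conclusion, on the image of the sum, carries the induction: it keeps the images of
    the later summands orthogonal to the image of the first. *)
Lemma glue_twins A G (S : seq (M * M)) : orth_chain S ->
  (forall s, s \in S -> exists X, local_twin A G s.1 s.2 X) ->
  exists X, [/\ forall s, s \in S -> local_twin A G s.1 s.2 X,
    ((\sum_(s <- S) s.1)%MS *m X <= \sum_(s <- S) s.2)%MS
    & forall u v, (u <= \sum_(s <- S) s.1)%MS -> (v <= \sum_(s <- S) s.1)%MS ->
        form (u *m X) (v *m X) = form u v].
Proof.
elim: S => [|s S IH] /= => [_ _|[nd o1 o2 oS] hS].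
  exists 0; split=> // [|u v]; first by rewrite !big_nil mul0mx sub0mx.
  by rewrite !big_nil !submx0 => /eqP -> /eqP ->; rewrite !mul0mx !form0l.
have [|Y [hY sY iY]] := IH oS.
  by move=> t tS; apply: hS; rewrite inE tS orbT.
have [X0 tw0] := hS s (mem_head _ _).
set T := (\sum_(t <- S) t.1)%MS in o1 sY iY *.
set T' := (\sum_(t <- S) t.2)%MS in o2 sY *.
have cap0 : (s.1 :&: T = 0)%MS.
  by apply/eqP; rewrite -submx0 -nd capmxS.
(* Each partial isometry acts after the projection onto its own summand. *)
pose X := proj_mx s.1 T *m X0 + proj_mx T s.1 *m Y.
have XE0 u : (u <= s.1)%MS -> u *m X0 = u *m X.
  move=> us; rewrite /X mulmxDr !(mulmxA u (proj_mx _ _)) proj_mx_id // proj_mx_0 ?mul0mx ?addr0 //.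
  by rewrite capmxC.
have XE1 u : (u <= T)%MS -> u *m Y = u *m X.
  move=> us; rewrite /X mulmxDr !(mulmxA u (proj_mx _ _)) proj_mx_0 // proj_mx_id ?mul0mx ?add0r //.
  by rewrite capmxC.
have [_ UX0 iX0 _ _] := tw0.
have T1 : (T *m X <= T')%MS.
  have <- : T *m Y = T *m X by apply/row_matrixP => i; rewrite !row_mul XE1 // row_sub.
  exact: sY.
have twX := local_twin_ext XE0 tw0.
have [_ UX iX _ _] := twX.
exists X; split.
- move=> t; rewrite inE => /orP[/eqP -> //|tS]; apply: local_twin_ext (hY t tS) => u ut.
  by apply: XE1; apply: submx_trans ut _; rewrite /T (big_rem t) //= addsmxSl.
- by rewrite !big_cons addsmxMr addsmxS // UX.
move=> u v; rewrite !big_cons -/T => /sub_addsmxP[[a b] /= ->] /sub_addsmxP[[c e] /= ->].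
have aU := submxMl a s.1; have cU := submxMl c s.1.
have bT := submxMl b T; have eT := submxMl e T.
move: (a *m _) (c *m _) (b *m _) (e *m _) aU cU bT eT => u1 v1 u2 v2 u1U v1U u2T v2T.
rewrite !mulmxDl !formE iX // -(XE1 u2) // -(XE1 v2) // iY // !XE1 //.
have orth x y : (x <= s.1)%MS -> (y <= T)%MS -> form x y = 0 /\ form (x *m X) (y *m X) = 0.
  move=> xU yT; split; rewrite formC; first by have /perpP := submx_trans yT o1; apply.
  have /perpP := submx_trans (submx_trans (submxMr X yT) T1) o2; apply.
  by rewrite -UX submxMr.
have [h1 h2] := orth _ _ u1U v2T; have [h3 h4] := orth _ _ v1U u2T.
by rewrite (formC u2 v1) (formC (u2 *m X) (v1 *m X)) h1 h2 h3 h4.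
Qed.

(** For [u] in [U] the vector [u *m h] is still in [U], so the same polynomial q(A) computes [G] on
    both, and [h] commutes with q(A). Stability under [h] is what allows a different [q] for each
    [U]. *)
Lemma commutant_transfer A G (S : seq M) : (\sum_(U <- S) U :=: 1%:M)%MS ->
  (forall U, U \in S -> (forall h, h *m A = A *m h -> (U *m h <= U)%MS) /\
     exists q, forall u, (u <= U)%MS -> u *m horner_mx A q = u *m G) ->
  forall h, h *m A = A *m h -> h *m G = G *m h.
Proof.
move=> S1 hS h hA; apply/eqP; rewrite -subr_eq0 -[X in X == 0]mul1mx -sub_kermx -S1.
apply: sums_sub => U US; have [hU [q hq]] := hS U US.
apply/rV_subP => u uU; rewrite sub_kermx mulmxBr !mulmxA -(hq u uU) -(hq (u *m h)).
  rewrite -!mulmxA (_ : h *m horner_mx A q = horner_mx A q *m h) ?subrr //.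
  exact: comm_mx_horner.
exact: stable_row (hU h hA) uU.
Qed.

End Frames.

(** * Twins of the individual components *)

Section Twins.
Variables (R : rcfType) (n : nat).
Local Notation M := 'M[R]_(n.+1).
Local Notation V := 'rV[R]_(n.+1).
Local Notation J := (Jmx R n).
Implicit Types (u v w x y z : V) (A G U W X : M) (p q : {poly R}).

Lemma scalar_on_rows m A U (E : 'M[R]_(m, n.+1)) a : (E <= U)%MS ->
  (forall u, (u <= U)%MS -> u *m A = a *: u) -> E *m A = a *: E.
Proof.
move=> EU h; apply/row_matrixP => i; rewrite row_mul linearZ /= h //.
exact: submx_trans (row_sub i E) EU.
Qed.

Lemma eigen_twin A G U U' a a' : posdef U -> posdef U' -> \rank U = \rank U' ->
  (forall u, (u <= U)%MS -> u *m A = a *: u) ->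
  (forall u, (u <= U')%MS -> u *m G = a' *: u) -> exists X, local_twin A G U U' X.
Proof.
move=> pU pU' rk hA hG.
have [E EU gE] := orthonormal_basis pU rk; have [E' EU' gE'] := orthonormal_basis pU' erefl.
apply: (@frame_twin _ _ _ E E' 0 a 1 a' 1) => //; rewrite ?oner_neq0 ?gE ?gE' ?mul0mx ?scaler0 ?addr0 //.
- exact: gram_free gE.
- by apply: scalar_on_rows hA; rewrite EU.
by apply: scalar_on_rows hG; rewrite EU'.
Qed.

(** A unit vector gives [d = 1], so [A] acts as a rotation: [s / 2] is the cosine of its angle, [b]
    the sine, and [F] the complex structure with [A = s / 2 + b F]. *)
Lemma quad_frame A U s d : isom A -> posdef U -> (U *m A <= U)%MS -> s ^+ 2 < 4 * d ->
  (forall u, (u <= U)%MS -> u *m horner_mx A (quad s d) = 0) ->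
  exists k (E : 'M[R]_(k.*2, n.+1)) a b, [/\ \rank U = k.*2, (E :=: U)%MS,
    E *m J *m E^T = 1%:M, b != 0 & E *m A = a *: E + b *: (complex_mx R k *m E)].
Proof.
move=> hA pU UA sd hq; have d0 : 0 < d by have := sqr_ge0 s; lra.
have AA u : (u <= U)%MS -> u *m A *m A = s *: (u *m A) - d *: u.
  move=> /hq; rewrite horner_quad_row => /eqP; rewrite -addrA addr_eq0 opprD opprK => /eqP ->.
  by [].
have [U0|Un0] := eqVneq U 0.
  (* Empty frame; [b = 1] is any non-zero value. *)
  exists 0, 0, 0, 1; rewrite U0 mxrank0 oner_neq0; split=> //.
  - by apply/eqmxP; rewrite !sub0mx.
  - by rewrite [LHS]flatmx0 [RHS]flatmx0.
  by rewrite [LHS]flatmx0 [RHS]flatmx0.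
have [v vU vv] := unit_vector pU Un0.
have [_] := quad_form_key hA (AA v vU).
have s2 : 0 < (1 + d) ^+ 2 - s ^+ 2 by have := sqr_ge0 (1 - d); lra.
rewrite vv mul1r => /eqP; rewrite mulf_eq0 (gt_eqF s2) orbF subr_eq0 => /eqP d1.
rewrite -d1 in AA sd.
have b2 : 0 < 1 - s ^+ 2 / 4 by lra.
pose b := Num.sqrt (1 - s ^+ 2 / 4).
have b0 : b != 0 by rewrite gt_eqF // sqrtr_gt0.
have bE : b ^+ 2 = 1 - s ^+ 2 / 4 by rewrite sqr_sqrtr // ltW.
clearbody b.
pose F := b^-1 *: (A - (s / 2)%:M).
have FE m (W : 'M[R]_(m, n.+1)) : W *m F = b^-1 *: (W *m A - (s / 2) *: W).
  by rewrite /F -scalemxAr mulmxBr mul_mx_scalar.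
have UF : (U *m F <= U)%MS by rewrite FE scalemx_sub // addmx_sub // eqmx_opp scalemx_sub.
have FF u : (u <= U)%MS -> u *m F *m F = - u.
  move=> uU; rewrite !FE -scalemxAl mulmxBl AA // -scalemxAl.
  apply/rowP => j; rewrite !mxE; move: (\sum_j0 _) (u _ _) => c e.
  apply: (mulfI (_ : b ^+ 2 != 0)); first by rewrite expf_neq0.
  by rewrite mulrN {2}bE; field.
have Fi u v' : (u <= U)%MS -> (v' <= U)%MS -> form (u *m F) (v' *m F) = form u v'.
  move=> uU vU'; have e1 := form_mulmx u v' hA; have e2 := form_mulmx u (v' *m A) hA.
  rewrite AA // formDr formNr !formZr mul1r e1 in e2.
  rewrite !FE !formE e1.
  apply: (mulfI (_ : b ^+ 2 != 0)); first by rewrite expf_neq0.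
  rewrite {2}bE.
  move: e2; set c1 := form (u *m A) v'; set c2 := form u (v' *m A) => e2.
  have -> : c1 = s * form u v' - c2 by lra.
  by field.
have [k [E [rE EU gE EF]]] := complex_basis pU UF FF Fi (leqnn _).
exists k, E, (s / 2), b; split=> //.
by rewrite -EF FE scalerA mulfV // scale1r addrC subrK.
Qed.

Lemma quad_twin A G U U' s d s' d' : isom A -> isom G -> posdef U -> posdef U' ->
  (U *m A <= U)%MS -> (U' *m G <= U')%MS -> s ^+ 2 < 4 * d -> s' ^+ 2 < 4 * d' ->
  (forall u, (u <= U)%MS -> u *m horner_mx A (quad s d) = 0) ->
  (forall u, (u <= U')%MS -> u *m horner_mx G (quad s' d') = 0) ->
  \rank U = \rank U' -> exists X, local_twin A G U U' X.
Proof.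
move=> hA hG pU pU' UA UG sd sd' qA qG.
have [k [E [a [b [-> EU gE b0 EA]]]]] := quad_frame hA pU UA sd qA.
have [k' [E' [a' [b' [-> EU' gE' b0' EG]]]]] := quad_frame hG pU' UG sd' qG.
move/double_inj => kk; case: _ / kk in E' EU' gE' EG *.
apply: (frame_twin EU EU' _ _ EA EG) => //; last by rewrite gE gE'.
exact: gram_free gE.
Qed.

Lemma pcomp_twin A G p p' : isom A -> isom G -> p \is monic -> irreducible_poly p ->
  p' \is monic -> irreducible_poly p' -> posdef (pcomp A p) -> posdef (pcomp G p') ->
  size p = size p' -> \rank (pcomp A p) = \rank (pcomp G p') ->
  exists X, local_twin A G (pcomp A p) (pcomp G p') X.
Proof.
move=> hA hG mp ip mp' ip' pU pU' sz rk.
have kA u : (u <= pcomp A p)%MS -> u *m horner_mx A p = 0.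
  by rewrite (posdef_pcomp_ker hA pU) kerP => /eqP.
have kG u : (u <= pcomp G p')%MS -> u *m horner_mx G p' = 0.
  by rewrite (posdef_pcomp_ker hG pU') kerP => /eqP.
have UA := pcomp_stable A p; have UG := pcomp_stable G p'.
move: (pcomp A p) (pcomp G p') => U U' in pU pU' rk kA kG UA UG *.
case: (monic_irreducible_rcfP mp ip) => [[a pE]|[s [d [pE sd]]]];
  case: (monic_irreducible_rcfP mp' ip') => [[a' pE']|[s' [d' [pE' sd']]]];
  rewrite pE pE' ?size_XsubC ?size_quad // in sz kA kG.
  apply: (eigen_twin (a := a) (a' := a')) => // u uU; apply/eqP; rewrite -subr_eq0 -horner_XsubC_row.
    by rewrite kA.
  by rewrite kG.
exact: quad_twin sd sd' kA kG rk.
Qed.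

Lemma timelike_vector U : (U :&: perp U = 0)%MS ->
  (exists z, [/\ (z <= U)%MS, z != 0 & form z z <= 0]) ->
  exists2 t : V, (t <= U)%MS & form t t = -1.
Proof.
move=> nd [z [zU zn0]]; rewrite le_eqVlt => /orP[/eqP zz|zz].
  have [y yU zy] : exists2 y : V, (y <= U)%MS & form z y != 0.
    apply: NNPP => h; move: zn0; rewrite -submx0 -nd sub_capmx zU /=.
    move/negP; apply; apply/perpP => y yU; apply/eqP; apply: contraT => hy.
    by case: h; exists y.
  (* As [z] is null, the norm of [y - t *: z] is affine in [t]; this [t] makes it -1. *)
  exists (y - ((form y y + 1) / (2 * form z y)) *: z).
    by rewrite addmx_sub // eqmx_opp scalemx_sub.
  by rewrite !formE (formC y z) zz; field.
exists ((Num.sqrt (- form z z))^-1 *: z); first exact: scalemx_sub.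
rewrite !formE mulrA -invfM -expr2 sqr_sqrtr ?oppr_ge0 ?ltW //.
by rewrite invrN mulNr mulVf // lt_eqF.
Qed.

(** A timelike unit vector has definite complement, so the Gram matrix can be brought to diag(-1, 1,
    ..., 1) and the rank alone determines the frame type. Both maps being scalar, [C = 0] serves. *)
Lemma identity_twin A G U U' : (U :&: perp U = 0)%MS -> (U' :&: perp U' = 0)%MS ->
  (exists z, [/\ (z <= U)%MS, z != 0 & form z z <= 0]) ->
  (exists z, [/\ (z <= U')%MS, z != 0 & form z z <= 0]) ->
  (forall u, (u <= U)%MS -> u *m A = u) -> (forall u, (u <= U')%MS -> u *m G = u) ->
  \rank U = \rank U' -> exists X, local_twin A G U U' X.
Proof.
move=> nd nd' hz hz' hA hG rk.
have frame W : (W :&: perp W = 0)%MS -> (exists z, [/\ (z <= W)%MS, z != 0 & form z z <= 0]) ->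
    forall d, \rank W = (1 + d)%N -> exists E : 'M[R]_(1 + d, n.+1), [/\ (E :=: W)%MS, row_free E &
    E *m J *m E^T = block_mx (-1)%:M 0 0 1%:M].
  move=> ndW hzW d rW; have [t tW tt] := timelike_vector ndW hzW.
  have tn0 : t != 0 by apply: contra_eq_neq tt => ->; rewrite form0l eq_sym oppr_eq0 oner_neq0.
  have ndt : (t :&: perp t = 0)%MS.
    apply/eqP/rowV0P => v; rewrite sub_capmx => /andP[/sub_rVP[a ->] /perpP/(_ t (submx_refl t))].
    by rewrite formZl tt mulrN1 => /eqP; rewrite oppr_eq0 => /eqP ->; rewrite scale0r.
  have pt : posdef (perp t) by apply: posdef_perp_timelike; rewrite tt ltrN10.
  have [sW rkW] := nondeg_split tW ndt.
  rewrite rank_rV tn0 rW in rkW; have [E EW gE] := orthonormal_basis (posdef_sub (capmxSr W _) pt) (esym (addnI rkW)).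
  have EWW : (col_mx t E :=: W)%MS.
    exact: eqmx_trans (eqmx_trans (eqmx_sym (addsmxE t E)) (adds_eqmx (eqmx_refl t) EW)) sW.
  have [h1 h2] : E *m J *m t^T = 0 /\ t *m J *m E^T = 0 by apply: perp_gram; rewrite EW capmxSr.
  exists (col_mx t E); split=> //; first by rewrite /row_free EWW rW.
  by rewrite gram_col form_mx tt gE h1 h2.
have [d rW] : exists d, \rank U = (1 + d)%N.
  exists (\rank U).-1; rewrite add1n prednK // lt0n mxrank_eq0.
  by case: hz => z [zU zn0 _]; apply: contraNneq zn0 => U0; rewrite U0 submx0 in zU.
have [E [EU fE gE]] := frame U nd hz d rW; rewrite rk in rW.
have [E' [EU' fE' gE']] := frame U' nd' hz' d rW.
apply: (@frame_twin _ _ _ E E' 0 1 1 1 1) => //; rewrite ?oner_neq0 ?gE ?gE' ?mul0mx ?scaler0 ?addr0 //.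
- by apply: (scalar_on_rows (U := U)) => [|u uU]; rewrite ?EU // scale1r hA.
by apply: (scalar_on_rows (U := U')) => [|u uU]; rewrite ?EU' // scale1r hG.
Qed.

(** In a basis of null eigenvectors both maps are affine in [C = diag(1, -1)], with half sum and
    half difference of [l] and [l^-1] as coefficients; the latter is non-zero since [l] is positive
    and not 1. *)
Lemma hyperbolic_twin A G pt pt' z z' l w w' m :
  hyperbolic_data A pt z z' l -> hyperbolic_data G pt' w w' m ->
  exists X, local_twin A G (compsum A pt) (compsum G pt') X.
Proof.
move=> [l0 l1 zA z'A [zz zz' zz'' VE]] [m0 m1 wG w'G [ww ww' ww'' WE]].
have ne (a : R) : 0 < a -> a != 1 -> (a - a^-1) / 2 != 0.
  move=> a0 a1; rewrite mulf_neq0 ?invr_neq0 ?pnatr_eq0 // subr_eq0 -(inj_eq (mulfI (lt0r_neq0 a0))).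
  rewrite mulfV ?lt0r_neq0 // -expr2; apply: contra_neq a1 => /sqr1_gt0; exact.
have act (B : M) (x y : V) a : a != 0 -> x *m B = a *: x -> y *m B = a^-1 *: y ->
   col_mx x y *m B = ((a + a^-1) / 2) *: col_mx x y +
     ((a - a^-1) / 2) *: (block_mx 1%:M 0 0 (-1)%:M *m col_mx x y).
  move=> a0 xB yB; rewrite mul_col_mx xB yB mul_block_col !mul0mx addr0 add0r mul1mx mul_scalar_mx.
  rewrite !scale_col_mx add_col_mx !scalerA -!scalerDl; congr (col_mx (_ *: _) (_ *: _)).
    by field.
  by field.
have gram (x y : V) : form x x = 0 -> form y y = 0 -> form x y = -1 ->
   col_mx x y *m J *m (col_mx x y)^T = block_mx 0 (-1)%:M (-1)%:M 0.
  by move=> xx yy xy; rewrite gram_col !form_mx xx yy (formC y) xy !raddf0.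
apply: (frame_twin (eqmx_sym VE) (eqmx_sym WE) _ _ (act _ _ _ _ _ zA z'A) (act _ _ _ _ _ wG w'G)).
- have [nd _] := hyperbolic_plane zz zz' zz''.
  rewrite -kermx_eq0; apply/rowV0P => x; rewrite sub_kermx -[x]hsubmxK mul_row_col.
  rewrite [lsubmx x]mx11_scalar [rsubmx x]mx11_scalar !mul_scalar_mx => /eqP h.
  have := congr1 (form z) h; have := congr1 (form z') h.
  rewrite !formE (formC z' z) zz zz' zz'' !mulr0 addr0 add0r !mulrN1 => /eqP.
  rewrite oppr_eq0 => /eqP -> /eqP; rewrite oppr_eq0 => /eqP ->.
  by rewrite !raddf0 row_mx0.
- by rewrite !gram.
- exact: lt0r_neq0.
- exact: lt0r_neq0.
- exact: ne.
exact: ne.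
Qed.

(** The parabolic normal form has no parameter besides the rank: [G3] is the Gram matrix of [m],
    [e], [k], and the map is 1 plus the nilpotent Jordan block [N3]. *)
Lemma parabolic_twin A G U U' m e k m' e' k' :
  parabolic_data A U m e k -> parabolic_data G U' m' e' k' ->
  \rank U = \rank U' -> exists X, local_twin A G U U' X.
Proof.
move=> dA dG rk.
pose N3 : 'M[R]_(1 + (1 + 1)) := block_mx 0 (row_mx 1%:M 0) 0 (block_mx 0 1%:M 0 0).
pose G3 : 'M[R]_(1 + (1 + 1)) :=
  block_mx 0 (row_mx (- 2^-1)%:M (-1)%:M) (col_mx (- 2^-1)%:M (-1)%:M) (block_mx 1%:M 0 0 0).
have frame (B W : M) x y z d : parabolic_data B W x y z -> \rank W = (1 + (1 + 1) + d)%N ->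
    exists E : 'M[R]_(1 + (1 + 1) + d, n.+1), [/\ (E :=: W)%MS, row_free E,
    E *m J *m E^T = block_mx G3 0 0 1%:M &
    E *m B = 1 *: E + 1 *: (block_mx N3 0 0 0 *m E)].
  move=> dB rW; have [LW fL nd pL] := parabolic_frame dB.
  case: dB => _ [xB yB zB] [xx xy xz] [yy yz zz] fix_.
  set L := col_mx x (col_mx y z) in LW fL nd pL fix_.
  have [sW rkW] := nondeg_split LW nd.
  have rL : \rank L = (1 + (1 + 1))%N by apply/eqP.
  rewrite rL rW in rkW.
  have [E EW gE] := orthonormal_basis (posdef_sub (capmxSr W _) pL) (esym (addnI rkW)).
  have EWW : (col_mx L E :=: W)%MS.
    exact: eqmx_trans (eqmx_trans (eqmx_sym (addsmxE L E)) (adds_eqmx (eqmx_refl L) EW)) sW.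
  have [h1 h2] : E *m J *m L^T = 0 /\ L *m J *m E^T = 0 by apply: perp_gram; rewrite EW capmxSr.
  exists (col_mx L E); split=> //; first by rewrite /row_free EWW rW.
    rewrite gram_col gE h1 h2; congr (block_mx _ _ _ _).
    rewrite /L gram_col [X in block_mx _ _ _ X]gram_col tr_col_mx mul_mx_row !mul_col_mx !form_mx.
    by rewrite (formC y x) (formC z x) (formC z y) xx xy xz yy yz zz !raddf0.
  have EB : E *m B = E.
    apply/row_matrixP => i; rewrite row_mul fix_ //.
      by rewrite (submx_trans (row_sub i E)) // EW capmxSl.
    by rewrite (submx_trans (row_sub i E)) // EW capmxSr.
  rewrite !scale1r mul_col_mx EB mul_block_col !mul0mx !addr0 add_col_mx addr0.
  have LB : L *m B = col_mx (x + y) (col_mx (y + z) z) by rewrite /L !mul_col_mx xB yB zB.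
  have NL : N3 *m L = col_mx y (col_mx z 0).
    rewrite /L /N3 mul_block_col mul_row_col mul_block_col.
    by rewrite !mul0mx !mul1mx !add0r !addr0.
  by rewrite LB NL /L !add_col_mx addr0.
have [d rW] : exists d, \rank U = (1 + (1 + 1) + d)%N.
  have [LU fL _ _] := parabolic_frame dA; exists (\rank U - 3)%N.
  by rewrite subnKC // -(eqP fL) mxrankS.
have [E [EU fE gE EA]] := frame _ _ _ _ _ _ dA rW; rewrite rk in rW.
have [E' [EU' fE' gE' EG]] := frame _ _ _ _ _ _ dG rW.
by apply: (frame_twin EU EU' fE _ EA EG); rewrite ?gE ?gE' // oner_neq0.
Qed.

End Twins.

(** * Conjugating commutants *)

(** Equal multisets of values are turned into a pairing of the entries; it is used to match the
    factors of two characteristic polynomials by rank. *)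
Lemma perm_map_match (S S' : eqType) (Z : eqType) (F : S -> Z) (F' : S' -> Z)
    (l : seq S) (l' : seq S') : perm_eq (map F l) (map F' l') ->
  exists z : seq (S * S'), [/\ perm_eq (unzip1 z) l, perm_eq (unzip2 z) l' &
    forall c, c \in z -> F c.1 = F' c.2].
Proof.
elim: l l' => [|x l IH] l' h.
  exists [::]; split=> //; move: (perm_size h); rewrite /= size_map.
  by case: l' {h}.
have : F x \in map F' l' by rewrite -(perm_mem h) mem_head.
case/mapP => y yl xy.
have h' : perm_eq (map F l) (map F' (rem y l')).
  by rewrite -(perm_cons (F x)) -map_cons (perm_trans h) // {1}xy -map_cons perm_map // perm_to_rem.
have [z [z1 z2 zF]] := IH _ h'; exists ((x, y) :: z); split=> /=.
- by rewrite perm_cons.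
- by rewrite perm_sym (perm_trans (perm_to_rem yl)) // perm_cons perm_sym.
by move=> c; rewrite inE => /orP[/eqP -> //|/zF].
Qed.

Lemma commute_conj (R : comNzRingType) m (K L h a : 'M[R]_m) : K *m L = 1%:M -> L *m K = 1%:M ->
  L *m h *m K *m a = a *m (L *m h *m K) <-> h *m (K *m a *m L) = K *m a *m L *m h.
Proof.
move=> KL LK; split=> e.
  have := congr1 (fun Y => K *m Y *m L) e; rewrite /= !mulmxA KL mul1mx.
  by rewrite -!mulmxA KL mulmx1.
have := congr1 (fun Y => L *m Y *m K) e; rewrite /= !mulmxA LK mul1mx.
by rewrite -!mulmxA LK mulmx1.
Qed.

Section Conjugation.
Variables (R : rcfType) (n : nat).
Local Notation M := 'M[R]_(n.+1).
Local Notation V := 'rV[R]_(n.+1).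
Local Notation J := (Jmx R n).
Implicit Types (u v w x y z : V) (A G U W X : M) (p q : {poly R}).

Lemma isom_of_form X : (forall u v, form (u *m X) (v *m X) = form u v) -> isom X.
Proof.
move=> h; apply/matrixP => i j.
have e (B : M) : (delta_mx 0 i : V) *m B *m (delta_mx 0 j : V)^T = (B i j)%:M.
  by rewrite -rowE trmx_delta -colE; apply/matrixP => a b; rewrite !mxE !ord1 eqxx.
have := h (delta_mx 0 i) (delta_mx 0 j); rewrite /form trmx_mul !mulmxA.
rewrite -2!(mulmxA (delta_mx 0 i)) -(mulmxA (delta_mx 0 i) J) ?mulmxA.
have := e (X *m J *m X^T); have := e J; rewrite !mulmxA => -> ->.
by rewrite !mxE !eqxx !mulr1n.
Qed.

Lemma orth_chain_pcomp A G (l : seq ({poly R} * {poly R})) : isom A -> isom G ->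
  uniq (unzip1 l) -> uniq (unzip2 l) ->
  (forall c, c \in l -> [/\ is_factor A c.1, is_factor G c.2, posdef (pcomp A c.1) &
      posdef (pcomp G c.2)]) ->
  orth_chain [seq (pcomp A c.1, pcomp G c.2) | c <- l].
Proof.
move=> hA hG; elim: l => [|c l IH] //= /andP[c1 u1] /andP[c2 u2] hl.
have hl' d : d \in l -> [/\ is_factor A d.1, is_factor G d.2, posdef (pcomp A d.1) &
      posdef (pcomp G d.2)] by move=> dl; apply: hl; rewrite inE dl orbT.
have [f1 f2 p1 p2] := hl c (mem_head _ _).
split; last exact: IH.
- exact: posdef_cap_perp.
- rewrite big_map -(big_map (fun c => pcomp A c.1) xpredT id); apply: sums_sub => U /mapP[d dl ->].
  have [g1 g2 _ _] := hl' d dl; apply: posdef_pcomp_perp => //.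
  by apply: factors_coprime f1 g1 _; apply: contraNneq c1 => ->; apply: map_f.
rewrite big_map -(big_map (fun c => pcomp G c.2) xpredT id); apply: sums_sub => U /mapP[d dl ->].
have [g1 g2 _ _] := hl' d dl; apply: posdef_pcomp_perp => //.
by apply: factors_coprime f2 g2 _; apply: contraNneq c2 => ->; apply: map_f.
Qed.

(** With [B] the conjugate of [G] by the glued isometry, [A] and [B] are polynomials in each other
    on every component, so [commutant_transfer] applies both ways. *)
Lemma conj_commutant A G ps pt ps' pt' (l : seq ({poly R} * {poly R})) :
  isPO A -> isPO G -> space_time A ps pt -> space_time G ps' pt' ->
  perm_eq (unzip1 l) ps -> perm_eq (unzip2 l) ps' ->
  (forall c, c \in l -> size c.1 = size c.2 /\ \rank (pcomp A c.1) = \rank (pcomp G c.2)) ->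
  (exists X, local_twin A G (compsum A pt) (compsum G pt') X) ->
  exists X, isom X /\ forall h, h *m A = A *m h <-> (invmx X *m h *m X) *m G = G *m (invmx X *m h *m X).
Proof.
move=> pA pG sA sG l1 l2 hl tw; have hA := isPO_row pA; have hG := isPO_row pG.
have [us ut hs ht] := sA; have [us' ut' hs' ht'] := sG.
have hl' c : c \in l -> [/\ is_factor A c.1, is_factor G c.2, posdef (pcomp A c.1) &
      posdef (pcomp G c.2)].
  move=> cl; have /hs[] : c.1 \in ps by rewrite -(perm_mem l1) map_f.
  by have /hs'[] : c.2 \in ps' by rewrite -(perm_mem l2) map_f.
pose S0 := [seq (pcomp A c.1, pcomp G c.2) | c <- l].
pose S := (compsum A pt, compsum G pt') :: S0.
have sum1 : (\sum_(s <- S0) s.1)%MS = compsum A (unzip1 l) by rewrite /compsum !big_map.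
have sum2 : (\sum_(s <- S0) s.2)%MS = compsum G (unzip2 l) by rewrite /compsum !big_map.
have cE (B : M) (a b : seq {poly R}) : perm_eq a b -> (compsum B a :=: compsum B b)%MS.
  by move=> ab; apply/eqmxP/andP; split; apply: compsum_sub => p pa; apply: sub_compsum;
     rewrite ?(perm_mem ab) // -(perm_mem ab).
have oS : orth_chain S.
  split=> /=.
  - exact: (Vt_nondeg pA sA).
  - by rewrite sum1 (cE _ _ _ l1) perp_sym (Vt_perp_Vs pA sA).
  - by rewrite sum2 (cE _ _ _ l2) perp_sym (Vt_perp_Vs pG sG).
  apply: orth_chain_pcomp => //; first by rewrite (perm_uniq l1).
  by rewrite (perm_uniq l2).
have full : (\sum_(s <- S) s.1 :=: 1%:M)%MS.
  rewrite big_cons sum1 /=; apply: eqmx_trans (Vst_full sA).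
  apply: eqmx_trans (adds_eqmx (eqmx_refl _) (cE _ _ _ l1)) _.
  by rewrite addsmxC; exact: eqmx_refl.
have [|X [twX _ iX]] := glue_twins oS (A := A) (G := G).
  move=> s; rewrite inE => /orP[/eqP -> //|/mapP[c cl ->]] /=.
  have [[m1 [i1 _]] [m2 [i2 _]] p1 p2] := hl' c cl; have [sz rk] := hl c cl.
  exact: pcomp_twin.
have hX : isom X by apply: isom_of_form => u v; apply: iX; rewrite full submx1.
have [Xu _] := isom_invmx hX.
exists X; split=> // h.
pose B := X *m G *m invmx X.
have hB q : horner_mx B q = X *m horner_mx G q *m invmx X by rewrite /B horner_mx_uconj.
have eqB : invmx X *m h *m X *m G = G *m (invmx X *m h *m X) <-> h *m B = B *m h.
  exact: commute_conj (mulmxV Xu) (mulVmx Xu).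
have stA s : s \in S -> forall k, k *m A = A *m k -> (s.1 *m k <= s.1)%MS.
  move=> sS k kA; move: sS; rewrite inE => /orP[/eqP -> /=|/mapP[c cl -> /=]].
    exact: compsum_comm_stable.
  exact: comm_mx_stable_kermxpoly.
have stG s : s \in S -> forall k, k *m G = G *m k -> (s.2 *m k <= s.2)%MS.
  move=> sS k kA; move: sS; rewrite inE => /orP[/eqP -> /=|/mapP[c cl -> /=]].
    exact: compsum_comm_stable.
  exact: comm_mx_stable_kermxpoly.
have full1 : (\sum_(U <- map fst S) U :=: 1%:M)%MS by rewrite big_map.
rewrite eqB; split; move: h {eqB}.
  apply: commutant_transfer full1 _ => U /mapP[s sS ->]; split; first exact: stA.
  have [_ _ _ [q hq] _] := twX s sS; exists q => u us1.
  by rewrite /B !mulmxA -hq // mulmxK.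
apply: commutant_transfer full1 _ => U /mapP[s sS ->]; split.
  (* Conjugating [k] by [X] gives a matrix commuting with [G], which preserves the components of
     [G]; pulled back, [k] preserves those of [A]. *)
  move=> k kB; have [_ UX _ _ _] := twX s sS.
  have UE : (s.1 :=: s.2 *m invmx X)%MS.
    by have := eqmxMr (invmx X) UX; rewrite mulmxK.
  have h2 : (s.2 *m (invmx X *m k *m X) <= s.2)%MS.
    apply: (stG s sS); have := congr1 (fun Y => invmx X *m Y *m X) kB; rewrite /B /= !mulmxA.
    by rewrite !mulmxKV // mulVmx // mul1mx.
  rewrite (eqmxMr k UE) UE; have := submxMr (invmx X) h2.
  by rewrite !mulmxA mulmxK.
have [_ _ _ _ [q hq]] := twX s sS; exists q => u us1.
by rewrite hB !mulmxA -hq // mulmxK.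
Qed.

End Conjugation.

(** * Segre symbols through primary components *)

Section RowSegre.
Variables (R : rcfType) (n : nat).
Local Notation M := 'M[R]_(n.+1).
Local Notation V := 'rV[R]_(n.+1).
Local Notation J := (Jmx R n).
Implicit Types (u v w x y z : V) (A G T U W X : M) (p q : {poly R}).

Definition fixes_on A U := forall v, (v <= U)%MS -> v *m A = v.

(** The types as the dichotomy of the time part delivers them; [row_kindP] identifies them with the
    description by unipotency and eigenvalues. *)
Definition row_kind A (pt : seq {poly R}) (t : ptype) : Prop :=
  match t with
  | Ell => fixes_on A (compsum A pt)
  | Par => pt = [:: 'X - 1%:P] /\ ~ fixes_on A (compsum A pt)
  | Hyp => exists (z z' : V) l, hyperbolic_data A pt z z' l
  end.

(** [k] is a size, one more than the degree: 2 selects real eigenvalues, 3 the conjugate pairs. *)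
Definition rank_list A (ps : seq {poly R}) (k : nat) :=
  [seq \rank (pcomp A p) | p <- ps & size p == k].

Definition row_segre A (s : segre_data) : Prop :=
  let: (t, r, cs, rs) := s in
  exists ps pt, [/\ space_time A ps pt, row_kind A pt t, r = \rank (compsum A pt),
    cs = sort leq (map half (rank_list A ps 3)) & rs = sort leq (rank_list A ps 2)].

Lemma trmx_subX1 T k : ((T - 1) ^+ k)^T = (T^T - 1) ^+ k.
Proof.
have e B : B - 1 = horner_mx B ('X - 1%:P) by rewrite rmorphB /= horner_mx_X horner_mx_C.
by rewrite !e -!rmorphXn /= horner_mx_tr.
Qed.

Lemma pow_subX1 A k : (A - 1) ^+ k = horner_mx A (('X - 1%:P) ^+ k).
Proof. by rewrite rmorphXn /= rmorphB /= horner_mx_X horner_mx_C. Qed.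

Section Kind.
Variables (A : M) (ps pt : seq {poly R}).
Hypotheses (pA : isPO A) (st : space_time A ps pt).
Let Vt := compsum A pt.
Let unip := forall v, (v <= Vt)%MS -> v *m (A - 1) ^+ n.+1 = 0.
Let eig1 := exists p, [/\ p \is monic, irreducible_poly p, p != 'X - 1%:P &
  (kermxpoly A p :&: Vt)%MS != 0].

Lemma unipotent_part : pt = [:: 'X - 1%:P] -> unip /\ ~ eig1.
Proof.
move=> ptE; have VE v : (v <= Vt)%MS = (v *m (A - 1) ^+ n.+1 == 0).
  by rewrite /Vt /compsum ptE big_seq1 /pcomp kerP pow_subX1.
split=> [v|[p [mp ip p1 /rowV0Pn[v]]]]; first by rewrite VE => /eqP.
rewrite sub_capmx VE kerP pow_subX1 => /andP[/eqP vp /eqP v1]; case/eqP.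
apply: coprime_ker0 vp v1; rewrite coprimep_expr //.
by apply: monic_irreducible_coprime; rewrite ?monicXsubC //; apply: irredp_XsubC.
Qed.

Lemma hyperbolic_part (z z' : V) l : hyperbolic_data A pt z z' l ->
  [/\ ~ fixes_on A Vt, ~ unip, eig1 & \rank Vt = 2%N].
Proof.
move=> [l0 l1 zA z'A [zz zz' zz'' VE]].
have zV : (z <= Vt)%MS by rewrite VE -addsmxE addsmxSl.
have zn0 : z != 0 by apply: contra_eq_neq zz'' => ->; rewrite form0l eq_sym oppr_eq0 oner_neq0.
have zk k : z *m (A - 1) ^+ k = (l - 1) ^+ k *: z.
  elim: k => [|k IH]; first by rewrite !expr0 mulmx1 scale1r.
  rewrite exprS -mulmxE mulmxA mulmxBr mulmx1 zA -{2}(scale1r z) -scalerBl -scalemxAl IH.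
  by rewrite scalerA exprS.
have uni : ~ unip.
  move=> /(_ z zV)/eqP; rewrite zk scaler_eq0 (negPf zn0) orbF expf_eq0 subr_eq0 (negPf l1).
  by rewrite andbF.
split=> //.
- by move=> h; apply: uni => v vV; rewrite exprS -mulmxE mulmxA mulmxBr mulmx1 h // subrr mul0mx.
- exists ('X - l%:P); split; rewrite ?monicXsubC //; first exact: irredp_XsubC.
    by apply: contra_neq l1 => /(congr1 (fun q : {poly R} => q.[0])); rewrite !hornerE => /oppr_inj.
  apply/rowV0Pn; exists z => //.
  by rewrite sub_capmx kerP horner_XsubC_row zA subrr eqxx zV.
rewrite VE; apply/eqP; rewrite -[_ == _]/(row_free (col_mx z z')) -kermx_eq0; apply/rowV0P => x.
rewrite sub_kermx -[x]hsubmxK mul_row_col.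
rewrite [lsubmx x]mx11_scalar [rsubmx x]mx11_scalar !mul_scalar_mx => /eqP h.
have := congr1 (form z) h; have := congr1 (form z') h.
rewrite !formE (formC z' z) zz zz' zz'' !mulr0 addr0 add0r !mulrN1 => /eqP.
rewrite oppr_eq0 => /eqP -> /eqP; rewrite oppr_eq0 => /eqP ->.
by rewrite !raddf0 row_mx0.
Qed.

Lemma row_kind_exists : exists t, row_kind A pt t.
Proof.
case: (pt_dichotomy pA st) => h; last by exists Hyp.
have [h'|h'] := excluded_middle_informative (fixes_on A Vt); first by exists Ell.
by exists Par.
Qed.

Lemma row_kindP t : row_kind A pt t <->
  [/\ t = Ell <-> fixes_on A Vt, t = Par <-> (unip /\ ~ fixes_on A Vt) & t = Hyp <-> eig1].
Proof.
split; case: t => /=.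
- move=> h; split; split=> //; first by case.
  case: (pt_dichotomy pA st) => [/unipotent_part[]//|].
  by move=> [z [z' [l /hyperbolic_part[]]]].
- by move=> [/unipotent_part[h1 h2] h3]; split; split.
- move=> [z [z' [l /hyperbolic_part[h1 h2 h3 _]]]]; split; split=> //.
  by case.
- by move=> [[h _] _ _]; apply: h.
- move=> [_ [h _] _]; have [hu hi] := h erefl; split=> //.
  by case: (pt_dichotomy pA st) => // -[z [z' [l /hyperbolic_part[]]]].
move=> [_ _ [h _]]; have e1 := h erefl.
by case: (pt_dichotomy pA st) => // /unipotent_part[].
Qed.

End Kind.

Section Spectrum.
Variables (A : M) (ps pt : seq {poly R}).
Hypotheses (pA : isPO A) (st : space_time A ps pt).
Let Vs := compsum A ps.
Let hA := isPO_row pA.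

Lemma ker_cap_Vs_in p : p \in ps -> (kermxpoly A p :&: Vs :=: pcomp A p)%MS.
Proof.
case: st => _ _ hs _ pp; have [fp pU] := (hs p).1 pp.
apply/eqmxP; rewrite sub_capmx (sub_compsum A pp) andbT.
rewrite (submx_trans (capmxSl _ _) (ker_sub_pcomp A p)) /=.
by rewrite (posdef_pcomp_ker hA pU) submx_refl.
Qed.

Lemma pcomp_neq0 p : is_factor A p -> pcomp A p != 0.
Proof.
move=> [_ [ip pc]]; apply: contraNneq (factor_ker_neq0 ip pc) => h.
by rewrite -submx0 -h ker_sub_pcomp.
Qed.

(** The kernel of a factor with non-definite component lies in the time part, which is orthogonal to
    the definite [Vs] and so meets it in 0. *)
Lemma ker_cap_Vs_neq0 p : p \is monic -> irreducible_poly p ->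
  ((kermxpoly A p :&: Vs)%MS != 0) = (p \in ps).
Proof.
move=> mp ip; have [us ut hs ht] := st.
apply/idP/idP => [/rowV0Pn[v]|pp].
  rewrite sub_capmx kerP => /andP[/eqP vp vV] vn0.
  have fp : is_factor A p by split=> //; split=> //; apply: ker_factor vn0 vp.
  have [pU|npU] := excluded_middle_informative (posdef (pcomp A p)); first exact/hs.
  have ppt : p \in pt by apply/ht.
  have vt : (v <= compsum A pt)%MS.
    apply: submx_trans (sub_compsum A ppt); apply: submx_trans (ker_sub_pcomp A p).
    by rewrite kerP vp.
  have vperp := submx_trans vt (Vt_perp_Vs pA st).
  by rewrite (perp_cap0 (Vs_posdef pA st) vV vperp) eqxx in vn0.
rewrite -mxrank_eq0 ker_cap_Vs_in // mxrank_eq0 pcomp_neq0 //.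
by have [] := (hs p).1 pp.
Qed.

(** A real eigenvector in a definite component has non-zero norm, so its eigenvalue squares to 1. *)
Lemma size2_factors : perm_eq [seq p : {poly R} <- ps | size p == 2%N]
  [seq p : {poly R} <- [:: 'X - 1%:P; 'X - (-1)%:P] | p \in ps].
Proof.
have [us ut hs ht] := st.
have n1 : 'X - 1%:P != 'X - (-1)%:P :> {poly R}.
  apply/eqP => /(congr1 (fun q : {poly R} => q.[0])); rewrite !hornerE => h.
  have : (1 : R) = 0 by lra.
  by move/eqP; rewrite oner_eq0.
apply: uniq_perm; rewrite ?filter_uniq //; first by rewrite /= inE n1.
move=> p; rewrite !mem_filter andbC; case pp: (p \in ps); last by rewrite !andFb.
have [[mp [ip pc]] pU] := (hs p).1 pp.
rewrite !andTb !inE; apply/idP/idP => [sz|/orP[] /eqP ->]; rewrite ?size_XsubC //.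
case: (monic_irreducible_rcfP mp ip) sz => [[a pE]|[s [d [-> _]]]]; last by rewrite size_quad.
move=> _; have /rowV0Pn[v] := factor_ker_neq0 ip pc.
rewrite kerP pE horner_XsubC_row subr_eq0 => /eqP vA vn0.
have qv : 0 < form v v.
  apply: pU => //; apply: submx_trans (ker_sub_pcomp A p).
  by rewrite kerP pE horner_XsubC_row vA subrr.
case: (isom_eigen hA vA) => [h|/eqP]; first by rewrite h ltxx in qv.
by rewrite sqrf_eq1 => /orP[] /eqP ->; rewrite eqxx ?orbT.
Qed.

Lemma real_ranks : sort leq [seq d <- [seq \rank (kermxpoly A ('X - e%:P) :&: Vs)%MS | e <- [:: 1; -1]]
    | d != 0%N] = sort leq (rank_list A ps 2).
Proof.
have [us ut hs ht] := st.
apply/perm_sortP => //; [exact: leq_total|exact: leq_trans|exact: anti_leq|].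
rewrite /rank_list perm_sym (perm_trans (perm_map _ size2_factors)) //.
have -> : [seq \rank (kermxpoly A ('X - e%:P) :&: Vs)%MS | e <- [:: 1; -1]] =
   [seq \rank (kermxpoly A p :&: Vs)%MS | p <- [:: 'X - 1%:P; 'X - (-1)%:P]] by [].
rewrite filter_map.
have hp p : p \in [:: 'X - 1%:P; 'X - (-1)%:P] -> p \is monic /\ irreducible_poly p.
  by rewrite !inE => /orP[] /eqP ->; split; rewrite ?monicXsubC //; apply: irredp_XsubC.
set F := fun p => \rank (kermxpoly A p :&: Vs)%MS; set l := [:: _; _].
have -> : [seq p <- l | preim F (fun d => d != 0%N) p] = [seq p <- l | p \in ps].
  by apply: eq_in_filter => p /hp[mp ip]; rewrite /F /= mxrank_eq0 ker_cap_Vs_neq0.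
have -> : [seq \rank (pcomp A p) | p <- [seq p <- l | p \in ps]] = map F [seq p <- l | p \in ps].
  by apply/eq_in_map => p; rewrite mem_filter => /andP[pp _]; rewrite /F ker_cap_Vs_in.
exact: perm_refl.
Qed.

Lemma complex_ranks (qs : seq {poly R}) : uniq qs ->
  (forall p, p \in qs <-> [/\ p \is monic, irreducible_poly p, size p = 3%N &
     (kermxpoly A p :&: Vs)%MS != 0]) ->
  sort leq [seq (\rank (kermxpoly A p :&: Vs)%MS)./2 | p <- qs] = sort leq (map half (rank_list A ps 3)).
Proof.
have [us ut hs ht] := st; move=> uq hq.
have qE : perm_eq qs [seq p : {poly R} <- ps | size p == 3%N].
  apply: uniq_perm; rewrite ?filter_uniq // => p; rewrite mem_filter.
  apply/idP/andP => [/hq[mp ip -> h]|[/eqP sz pp]].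
    by rewrite eqxx -ker_cap_Vs_neq0.
  have [[mp [ip _]] _] := (hs p).1 pp.
  by apply/hq; split=> //; rewrite ker_cap_Vs_neq0.
apply/perm_sortP => //; [exact: leq_total|exact: leq_trans|exact: anti_leq|].
rewrite /rank_list -map_comp (perm_trans (perm_map _ qE)) //.
set l := [seq p : {poly R} <- _ | _].
suff -> : [seq (\rank (kermxpoly A p :&: Vs)%MS)./2 | p <- l] = [seq half (\rank (pcomp A p)) | p <- l] by apply: perm_refl.
by apply/eq_in_map => p; rewrite mem_filter => /andP[_ pp]; rewrite ker_cap_Vs_in.
Qed.

End Spectrum.

Lemma is_segreP T (s : segre_data) : isPO T -> is_segre T s <-> row_segre T^T s.
Proof.
case: s => [[[t r] cs] rs] pT; set A := T^T; have pA : isPO A by rewrite isPO_trE.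
have sumE (l : seq {poly R}) : (\sum_(p <- l) primcomp T p)%MS = compsum A l.
  by apply: eq_bigr => p _; rewrite primcompE.
have XE : 'X - 1 = 'X - 1%:P :> {poly R} by [].
have kE (e : R) : mxker (T - e%:M) = kermxpoly A ('X - e%:P).
  by rewrite -mxker_horner rmorphB /= horner_mx_X horner_mx_C.
have stE ps pt : space_time A ps pt <->
  [/\ (forall p, p \in ps <-> is_factor T p /\ posdef (primcomp T p)),
      (forall p, p \in pt <-> is_factor T p /\ ~ posdef (primcomp T p)), uniq ps & uniq pt].
  split=> [[us ut hs ht]|[hs ht us ut]]; split=> // p; rewrite ?hs ?ht primcompE -/A.
  - by rewrite is_factor_tr.
  - by rewrite is_factor_tr.
  - by rewrite is_factor_tr.
  by rewrite is_factor_tr.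
split.
  move=> [ps [pt [hs [ht [us [ut]]]]]] /=; rewrite !sumE trmx_subX1 -/A => -[typ [rE [[qs [uq [hq csE]]] rsE]]].
  have st : space_time A ps pt by apply/stE.
  exists ps, pt; split=> //.
  - apply/(row_kindP pA st); case: typ => t1 t2 t3; split=> //.
    rewrite t3; split=> -[p [mp ip p1 h]]; exists p; split=> //; move: h; by rewrite mxker_horner.
  - rewrite csE -(complex_ranks pA st uq).
      by congr (sort _ _); apply: eq_map => p; rewrite mxker_horner.
    by move=> p; rewrite hq mxker_horner.
  rewrite rsE -(real_ranks pA st) /=; by rewrite !kE.
move=> [ps [pt [st kd rE csE rsE]]]; have [hs ht us ut] := (stE ps pt).1 st.
exists ps, pt; do 4!split=> //; rewrite /= !sumE trmx_subX1 -/A.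
have [t1 t2 t3] := (row_kindP pA st t).1 kd.
split; first split=> //.
  by rewrite t3; split=> -[p [mp ip p1 h]]; exists p; split=> //; move: h; rewrite mxker_horner.
split=> //; split; last by rewrite rsE -(real_ranks pA st) /= !kE.
pose qs := [seq p : {poly R} <- ps | size p == 3%N].
have hq p : p \in qs <-> [/\ p \is monic, irreducible_poly p, size p = 3%N &
     (kermxpoly A p :&: compsum A ps)%MS != 0].
  rewrite mem_filter; split=> [/andP[/eqP sz pp]|[mp ip -> h]].
    have [[mp [ip _]] _] := (hs p).1 pp; split=> //.
    by rewrite (ker_cap_Vs_neq0 pA st).
  by rewrite eqxx -(ker_cap_Vs_neq0 pA st).
have uq : uniq qs by rewrite filter_uniq.
exists qs; split=> //; split=> [p|]; first by rewrite hq mxker_horner.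
rewrite csE -(complex_ranks pA st uq) //.
by congr (sort _ _); apply: eq_map => p; rewrite mxker_horner.
Qed.

Lemma row_segre_exists A : isPO A -> exists s, row_segre A s.
Proof.
move=> pA; have [ps [pt st]] := space_time_exists A; have [t kt] := row_kind_exists pA st.
exists (t, \rank (compsum A pt), sort leq (map half (rank_list A ps 3)), sort leq (rank_list A ps 2)).
by exists ps, pt.
Qed.

(** The choice made by [epsilon] is meaningful because some valid symbol exists. *)
Lemma segreP T : isPO T -> row_segre T^T (segre T).
Proof.
move=> pT; apply/is_segreP => //; apply: epsilon_spec.
have pA : isPO T^T by rewrite isPO_trE.
by have [s hs] := row_segre_exists pA; exists s; apply/is_segreP.
Qed.

End RowSegre.

(** * From equal Segre symbols to conjugate commutants *)

Section Forward.
Variables (R : rcfType) (n : nat).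
Local Notation M := 'M[R]_(n.+1).
Local Notation V := 'rV[R]_(n.+1).
Local Notation J := (Jmx R n).
Implicit Types (u v w x y z : V) (A G T U W X : M) (p q : {poly R}).

Lemma factor_size A ps pt p : space_time A ps pt -> p \in ps -> size p = 2%N \/ size p = 3%N.
Proof.
move=> [_ _ hs _] /hs[[mp [ip _]] _].
by case: (monic_irreducible_rcfP mp ip) => [[a ->]|[s [d [-> _]]]];
  rewrite ?size_XsubC ?size_quad; [left|right].
Qed.

(** The component carries a complex structure; hence halving the ranks in the symbol loses no
    information. *)
Lemma even_rank A ps pt p : isPO A -> space_time A ps pt -> p \in ps -> size p = 3%N ->
  (\rank (pcomp A p))./2.*2 = \rank (pcomp A p).
Proof.
move=> pA [_ _ hs _] /hs[[mp [ip _]] pU] sz; have hA := isPO_row pA.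
case: (monic_irreducible_rcfP mp ip) => [[a pE]|[s [d [pE sd]]]]; first by rewrite pE size_XsubC in sz.
have [||k [E [a [b [rk _ _ _ _]]]]] := @quad_frame _ _ A (pcomp A p) s d hA pU _ sd.
- exact: pcomp_stable.
- by move=> u; rewrite (posdef_pcomp_ker hA pU) kerP -pE => /eqP.
by rewrite rk doubleK.
Qed.

Lemma parabolic_kind A ps pt : isPO A -> space_time A ps pt -> row_kind A pt Par ->
  exists m e k : V, parabolic_data A (compsum A pt) m e k.
Proof.
move=> pA st [ptE nf]; have hA := isPO_row pA; have [uni _] := unipotent_part A ptE.
apply: (parabolic_normal_form hA _ _ uni).
- exact: compsum_comm_stable.
- exact: (Vt_nondeg pA st).
apply: NNPP => h; apply: nf => v vV; apply/eqP; apply: contraT => vA.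
by case: h; exists v.
Qed.

Lemma perm_rank_lists A G ps pt ps' pt' : isPO A -> isPO G ->
  space_time A ps pt -> space_time G ps' pt' ->
  perm_eq (map half (rank_list A ps 3)) (map half (rank_list G ps' 3)) ->
  perm_eq (rank_list A ps 2) (rank_list G ps' 2) ->
  exists l : seq ({poly R} * {poly R}), [/\ perm_eq (unzip1 l) ps, perm_eq (unzip2 l) ps' &
    forall c, c \in l -> size c.1 = size c.2 /\ \rank (pcomp A c.1) = \rank (pcomp G c.2)].
Proof.
move=> pA pG st st'; rewrite /rank_list -!map_comp.
move=> /(@perm_map_match _ _ _ _ _ _ _) [z3 [a3 b3 c3]] /(@perm_map_match _ _ _ _ _ _ _) [z2 [a2 b2 c2]].
(* Definite factors have size 2 or 3, so the two filters partition the list. *)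
have split23 (B : M) qs qt : space_time B qs qt ->
    perm_eq ([seq p : {poly R} <- qs | size p == 3%N] ++ [seq p : {poly R} <- qs | size p == 2%N]) qs.
  move=> sB; have -> : [seq p : {poly R} <- qs | size p == 2%N] = filter (predC (fun p : {poly R} => size p == 3%N)) qs.
    by apply: eq_in_filter => p pq /=; case: (factor_size sB pq) => ->.
  exact/permPl/perm_filterC.
exists (z3 ++ z2); split.
- by rewrite /unzip1 map_cat (perm_trans (perm_cat a3 a2)) // (split23 _ _ _ st).
- by rewrite /unzip2 map_cat (perm_trans (perm_cat b3 b2)) // (split23 _ _ _ st').
move=> c; rewrite mem_cat => /orP[cz|cz].
  have : c.1 \in [seq p : {poly R} <- ps | size p == 3%N] by rewrite -(perm_mem a3) map_f.
  have : c.2 \in [seq p : {poly R} <- ps' | size p == 3%N] by rewrite -(perm_mem b3) map_f.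
  rewrite !mem_filter => /andP[/eqP s2 i2] /andP[/eqP s1 i1]; rewrite s1 s2; split=> //.
  rewrite -(even_rank pA st i1 s1) -(even_rank pG st' i2 s2).
  exact: (congr1 double (c3 c cz)).
have : c.1 \in [seq p : {poly R} <- ps | size p == 2%N] by rewrite -(perm_mem a2) map_f.
have : c.2 \in [seq p : {poly R} <- ps' | size p == 2%N] by rewrite -(perm_mem b2) map_f.
rewrite !mem_filter => /andP[/eqP s2 i2] /andP[/eqP s1 i1]; rewrite s1 s2; split=> //.
exact: c2.
Qed.

Lemma row_segre_commutant A G s : isPO A -> isPO G -> row_segre A s -> row_segre G s ->
  exists X, isom X /\ forall h, h *m A = A *m h <-> (invmx X *m h *m X) *m G = G *m (invmx X *m h *m X).
Proof.
case: s => [[[t r] cs] rs] pA pG [ps [pt [st kd rE csE rsE]]] [ps' [pt' [st' kd' rE' csE' rsE']]].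
rewrite csE in csE'; rewrite rsE in rsE'; rewrite rE in rE'.
have psort (a b : seq nat) : sort leq a = sort leq b -> perm_eq a b.
  by move/(perm_sortP leq_total leq_trans anti_leq).
have [l [l1 l2 hl]] := perm_rank_lists pA pG st st' (psort _ _ csE') (psort _ _ rsE').
apply: (conj_commutant pA pG st st' l1 l2 hl).
case: t kd kd' => kd kd'.
- apply: identity_twin kd kd' rE'; [exact: Vt_nondeg pA st|exact: Vt_nondeg pG st'| |].
    exact: Vt_nonspacelike pA st.
  exact: Vt_nonspacelike pG st'.
- have [m [e [k d]]] := parabolic_kind pA st kd.
  have [m' [e' [k' d']]] := parabolic_kind pG st' kd'.
  exact: parabolic_twin d d' rE'.
have [z [z' [a d]]] := kd; have [w [w' [b d']]] := kd'.
exact: hyperbolic_twin d d'.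
Qed.

End Forward.

(** * Reflections in definite subspaces *)

Section Reflections.
Variables (R : rcfType) (n : nat).
Local Notation M := 'M[R]_(n.+1).
Local Notation V := 'rV[R]_(n.+1).
Local Notation J := (Jmx R n).
Implicit Types (u v w x y z : V) (A G L U W X : M) (p q : {poly R}).

(** [s] is 1 - 2 P with [P] the orthogonal projection onto [L]. Its -1 eigenspace is [L], which
    anything commuting with [s] preserves; conversely an isometry preserving [L] preserves [perp L]
    as well. *)
Lemma reflection_exists L : posdef L -> exists s : M, [/\ isPO s,
  forall h, isom h -> (L *m h <= L)%MS -> s *m h = h *m s &
  forall h, s *m h = h *m s -> (L *m h <= L)%MS].
Proof.
move=> pL; have [E EL gE] := orthonormal_basis pL erefl.
pose P := J *m E^T *m E.
have EP : E *m P = E by rewrite /P !mulmxA gE mul1mx.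
have LP v : (v <= L)%MS -> v *m P = v.
  by rewrite -EL => /submxP[c ->]; rewrite -mulmxA EP.
have NP v : (v <= perp L)%MS -> v *m P = 0.
  move=> vp; have : (v <= perp E)%MS by rewrite perp_sym EL perp_sym.
  by rewrite sub_perp /P !mulmxA => /eqP ->; rewrite mul0mx.
pose s := 1%:M - 2 *: P.
have sE (v : V) : v *m s = v - 2 *: (v *m P) by rewrite /s mulmxBr mulmx1 -scalemxAr.
have Ls v : (v <= L)%MS -> v *m s = - v.
  by move=> vL; rewrite sE LP // scaler_nat mulr2n opprD addrA subrr add0r.
have Ns v : (v <= perp L)%MS -> v *m s = v.
  by move=> vN; rewrite sE NP // scaler0 subr0.
have dec v := perp_decomp v (posdef_cap_perp pL).
have hs : isom s.
  apply: isom_of_form => u v.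
  have [a [b [-> aL bN]]] := dec u; have [c [d [-> cL dN]]] := dec v.
  rewrite !mulmxDl (Ls a) // (Ls c) // (Ns b) // (Ns d) // !formE.
  by move/perpP: bN => /(_ c cL) ->; move/perpP: dN => /(_ a aL); rewrite (formC d) => ->; ring.
exists s; split.
- rewrite isPO_future0 // -[X in 0 < X]opprK -e0_form sE formDl formNl formZl e0_form mxE /=.
  set e := delta_mx _ _; pose w := e *m J *m E^T.
  (* Definiteness of [L] makes this a sum of squares, so the time coordinate of [e *m s] is at least
     1 and time orientation is kept. *)
  have -> : form (e *m P) e = \sum_i w 0 i ^+ 2.
    rewrite /form /P; have -> : e *m (J *m E^T *m E) *m J *m e^T = w *m w^T.
      by rewrite /w !trmx_mul trmxK trmx_J !mulmxA.
    by rewrite mxE; apply: eq_bigr => i _; rewrite [w^T _ _]mxE expr2.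
  have : 0 <= \sum_i w 0 i ^+ 2 by apply: sumr_ge0 => i _; rewrite sqr_ge0.
  by rewrite ?eqxx /=; lra.
- move=> h hh Lh; have Nh := perp_stable hh Lh.
  apply/row_matrixP => i; rewrite !rowE !mulmxA; have [a [b [-> aL bN]]] := dec (delta_mx 0 i).
  by rewrite !mulmxDl (Ls a) // (Ns b) // (Ls (a *m h)) ?(stable_row Lh) // (Ns (b *m h)) ?(stable_row Nh) // mulNmx.
move=> h sh; apply/row_subP => i; rewrite row_mul.
have uL := row_sub i L; move: (row i L) uL => u uL.
have : u *m h *m s = - (u *m h) by rewrite -mulmxA -sh mulmxA Ls // mulNmx.
rewrite sE => e; have -> : u *m h = u *m h *m P.
  have two : (2 : R) != 0 by rewrite pnatr_eq0.
  apply: (scalerI two); apply/eqP; rewrite -subr_eq0 scaler_nat mulr2n -addrA e subrr //.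
by rewrite /P -EL mulmxA submxMl.
Qed.

End Reflections.

(** * From conjugate centralizers to equal Segre symbols *)

Section Backward.
Variables (R : rcfType) (n : nat).
Local Notation M := 'M[R]_(n.+1).
Local Notation V := 'rV[R]_(n.+1).
Local Notation J := (Jmx R n).
Implicit Types (u v w x y z : V) (A G L U W X : M) (p q r : {poly R}).

Definition centralizer_sub A G := forall h, isPO h -> h *m A = A *m h -> h *m G = G *m h.

Lemma centralizer_sub_stable A G L : isPO A -> centralizer_sub A G -> posdef L ->
  (L *m A <= L)%MS -> (L *m G <= L)%MS.
Proof.
move=> pA sub pL LA; have [s [ps s1 s2]] := reflection_exists pL.
by apply/s2/sub => //; apply: s1 => //; apply: isPO_row.
Qed.

Lemma centralizer_sub_line A G v : isPO A -> centralizer_sub A G -> 0 < form v v ->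
  (exists a, v *m A = a *: v) -> exists a, v *m G = a *: v.
Proof.
move=> pA sub qv [a vA].
have LG : (<<v>> *m G <= <<v>>)%MS.
  apply: (centralizer_sub_stable pA sub); last by rewrite (eqmxMr A (genmxE v)) genmxE vA scalemx_sub.
  move=> w; rewrite genmxE => /sub_rVP[c ->] cv; rewrite QfE !formE mulrA.
  rewrite pmulr_lgt0 // -expr2 exprn_even_gt0 //=.
  by apply: contraNneq cv => ->; rewrite scale0r.
have : (v *m G <= v)%MS by rewrite -(genmxE v) -(eqmxMr G (genmxE v)).
by move=> /sub_rVP[c cE]; exists c.
Qed.

(** The cyclic module of [v] is a module over the field R[X]/(p), where a polynomial not killing [v]
    is invertible by Bezout. *)
Lemma field_inverse A p q v : irreducible_poly p -> v *m horner_mx A p = 0 ->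
  v *m horner_mx A q != 0 -> exists r, v *m horner_mx A q *m horner_mx A r = v.
Proof.
move=> ip vp vq; case: (irreducible_coprime_or_dvd q ip) => [|/dvdpP[r qE]]; last first.
  by rewrite qE mulrC hornerM_row vp mul0mx eqxx in vq.
move=> /Bezout_eq1_coprimepP[[a b] /= ab]; exists b.
rewrite -hornerM_row mulrC; have := congr1 (fun r => v *m horner_mx A r) ab.
by rewrite rmorphD mulmxDr [a * p]mulrC hornerM_row vp mul0mx add0r rmorph1 mulmx1.
Qed.

Lemma comm_horner_row A D q v : D *m A = A *m D ->
  v *m horner_mx A q *m D = v *m D *m horner_mx A q.
Proof.
move=> DA; rewrite -!mulmxA; congr (_ *m _); symmetry; exact: comm_mx_horner.
Qed.

(* Each vector of a definite component spans, with its image under [A], a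
   definite [A]-stable plane or line; the reflection in it commutes with [A]. *)
Lemma centralizer_sub_cyclic A G p v : isPO A -> centralizer_sub A G ->
  p \is monic -> irreducible_poly p -> posdef (pcomp A p) -> (v <= pcomp A p)%MS ->
  exists q, v *m G = v *m horner_mx A q.
Proof.
move=> pA sub mp ip pU vU; have hA := isPO_row pA; have UA := pcomp_stable A p.
have vp : v *m horner_mx A p = 0 by apply/eqP; rewrite -kerP -(posdef_pcomp_ker hA pU).
pose L : M := <<col_mx v (v *m A)>>%MS.
have LE : (L :=: v + v *m A)%MS by apply: eqmx_trans (genmxE _) (eqmx_sym (addsmxE _ _)).
have LU : (L <= pcomp A p)%MS by rewrite LE addsmx_sub vU stable_row.
have vAA : (v *m A *m A <= v + v *m A)%MS.
  case: (monic_irreducible_rcfP mp ip) vp => [[a ->]|[s [d [-> _]]]].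
    rewrite horner_XsubC_row => /eqP; rewrite subr_eq0 => /eqP e.
    by rewrite {1}e -scalemxAl scalemx_sub // addsmxSr.
  rewrite horner_quad_row => /eqP; rewrite -addrA addr_eq0 opprD opprK => /eqP ->.
  by rewrite addmx_sub ?eqmx_opp // scalemx_sub ?addsmxSl ?addsmxSr.
have LA : (L *m A <= L)%MS.
  by rewrite (eqmxMr A LE) LE addsmxMr addsmx_sub addsmxSr.
have LG := centralizer_sub_stable pA sub (posdef_sub LU pU) LA.
have : (v *m G <= L)%MS by apply: stable_row LG _; rewrite LE addsmxSl.
rewrite LE => /sub_addsmxP[[a b] /= ->]; rewrite [a]mx11_scalar [b]mx11_scalar !mul_scalar_mx.
exists (b 0 0 *: 'X + (a 0 0)%:P).
by rewrite rmorphD /= linearZ /= horner_mx_X horner_mx_C mulmxDr -scalemxAr mul_mx_scalar addrC.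
Qed.

(** A semilinear-algebra argument over R[X]/(p): a map preserving every line is a scalar.
    Subtracting the scalar found at one [v] leaves [D] with [v *m D = 0]; comparing [w] with [v + w]
    shows that [D] also kills [w]. *)
Lemma centralizer_sub_poly A G p : isPO A -> centralizer_sub A G ->
  p \is monic -> irreducible_poly p -> posdef (pcomp A p) ->
  exists q, forall w, (w <= pcomp A p)%MS -> w *m G = w *m horner_mx A q.
Proof.
move=> pA sub mp ip pU; have hA := isPO_row pA.
have cyc := centralizer_sub_cyclic pA sub mp ip pU.
have kp w : (w <= pcomp A p)%MS -> w *m horner_mx A p = 0.
  by rewrite (posdef_pcomp_ker hA pU) kerP => /eqP.
have [U0|/rowV0Pn[v vU vn0]] := eqVneq (pcomp A p) 0.
  by exists 0 => w; rewrite U0 submx0 => /eqP ->; rewrite !mul0mx.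
have [q vG] := cyc v vU; exists q => w wU.
pose D := G - horner_mx A q.
have DA : D *m A = A *m D.
  have cAq : A *m horner_mx A q = horner_mx A q *m A by apply: comm_mx_horner.
  by rewrite /D mulmxBl mulmxBr -(sub A pA erefl) cAq.
have vD : v *m D = 0 by rewrite /D mulmxBr vG subrr.
apply/eqP; rewrite -subr_eq0 -mulmxBr -/D; apply: contraT => wD.
have [r1 r1E] : exists r, w *m D = w *m horner_mx A r.
  by have [r rE] := cyc w wU; exists (r - q); rewrite rmorphB !mulmxBr rE.
have [r2 r2E] : exists r, (v + w) *m D = (v + w) *m horner_mx A r.
  have [|r rE] := cyc (v + w); first by rewrite addmx_sub.
  by exists (r - q); rewrite rmorphB !(mulmxBr (v + w)) rE.
rewrite mulmxDl vD add0r in r2E.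
have [|r3 r3E] := @field_inverse A p r2 (v + w) ip (kp _ (addmx_sub vU wU)); first by rewrite -r2E.
rewrite -r2E r1E -hornerM_row in r3E.
(* If [w *m D] were non-zero, [v] and [w] would be multiples of each other over R[X]/(p), and [D],
   which commutes with [A], would kill [w] along with [v]. *)
have vE : v = w *m horner_mx A (r1 * r3 - 1).
  by rewrite rmorphB rmorph1 mulmxBr r3E mulmx1 addrK.
have [|r4 r4E] := @field_inverse A p (r1 * r3 - 1) w ip (kp _ wU); first by rewrite -vE.
by move: wD; rewrite -r4E -vE comm_horner_row // vD mul0mx eqxx.
Qed.

Lemma horner_comp_row A G U q : (U *m A <= U)%MS ->
  (forall w, (w <= U)%MS -> w *m G = w *m horner_mx A q) ->
  forall r w, (w <= U)%MS -> w *m horner_mx G r = w *m horner_mx A (r \Po q).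
Proof.
move=> UA hG; elim/poly_ind => [|r c IH] w wU; first by rewrite comp_poly0 !rmorph0.
rewrite comp_polyD comp_polyM comp_polyX comp_polyC !rmorphD !rmorphM /= horner_mx_X !horner_mx_C.
rewrite !mulmxDr; congr (_ + _); rewrite -!mulmxE !mulmxA IH //.
by rewrite hG // horner_stable_row.
Qed.

Lemma prod_kernel G (l : seq {poly R}) v : v != 0 -> v *m horner_mx G (\prod_(p <- l) p) = 0 ->
  exists p r, [/\ p \in l, v *m horner_mx G r != 0 & v *m horner_mx G r *m horner_mx G p = 0].
Proof.
elim: l v => [|p l IH] v vn0.
  by rewrite big_nil rmorph1 mulmx1 => v0; rewrite v0 eqxx in vn0.
rewrite big_cons hornerM_row; have [vp _|vp h] := eqVneq (v *m horner_mx G p) 0.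
  by exists p, 1; rewrite mem_head rmorph1 mulmx1.
have [p' [r [p'l h1 h2]]] := IH _ vp h; exists p', (p * r).
by rewrite hornerM_row inE p'l orbT.
Qed.

(** On the component [G] is q(A). Some irreducible [p'] has p'(G) killing a non-zero vector there,
    so [p' \Po q] is not coprime to [p]; being divisible by [p], it kills the whole component. *)
Lemma centralizer_sub_component A G p : isPO A -> centralizer_sub A G ->
  is_factor A p -> posdef (pcomp A p) ->
  exists p' q, [/\ is_factor G p', (pcomp A p <= kermxpoly G p')%MS &
    forall w, (w <= pcomp A p)%MS -> w *m G = w *m horner_mx A q].
Proof.
move=> pA sub fp pU; have [mp [ip pc]] := fp; have hA := isPO_row pA.
have UA := pcomp_stable A p.
have [q hq] := centralizer_sub_poly pA sub mp ip pU.
have hr := horner_comp_row UA hq.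
have kp w : (w <= pcomp A p)%MS -> w *m horner_mx A p = 0.
  by rewrite (posdef_pcomp_ker hA pU) kerP => /eqP.
have [l cE hl] := monic_factorization (char_poly_monic G).
have /rowV0Pn[v vU vn0] := pcomp_neq0 fp.
have [|p' [r [p'l yn0 yp']]] := @prod_kernel G l v vn0.
  by rewrite -cE Cayley_Hamilton mulmx0.
have [mp' ip'] := hl p' p'l.
exists p', q; split=> //; first by do 2!split=> //; rewrite cE (big_rem p') //= dvdp_mulr.
rewrite hr // in yn0 yp'; set y := v *m _ in yn0 yp'.
have yU : (y <= pcomp A p)%MS by apply: horner_stable_row.
rewrite hr // in yp'.
case: (irreducible_coprime_or_dvd (p' \Po q) ip) => [cp|/dvdpP[c cE']].
  by rewrite (coprime_ker0 cp (kp y yU) yp') eqxx in yn0.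
apply/rV_subP => w wU; rewrite kerP hr // cE' mulrC hornerM_row kp // mul0mx //.
Qed.

(* If the component of [G] were not definite, [G] would fix the component of [A]
   and a nonspacelike vector orthogonal to it; reflecting in the sum of the two
   forces [A] to fix that vector as well. *)
Lemma centralizer_eq_posdef A G p p' : isPO A -> isPO G ->
  centralizer_sub A G -> centralizer_sub G A ->
  is_factor A p -> posdef (pcomp A p) -> is_factor G p' ->
  (pcomp A p <= kermxpoly G p')%MS -> posdef (pcomp G p').
Proof.
move=> pA pG sAG sGA fp pU fp' Up'; have hA := isPO_row pA; have hG := isPO_row pG.
have [mp [ip _]] := fp.
have UA := pcomp_stable A p; have PA := perp_stable hA UA.
apply: NNPP => np; have [ps' [pt' st']] := space_time_exists G.
have [_ _ _ ht'] := st'; have ppt : p' \in pt' by apply/ht'.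
have [l [z [l0 pE zn0 qz zG]]] := ptP pG st' ppt.
have /rowV0Pn[w0 w0U w0n] := pcomp_neq0 fp.
have UG w : (w <= pcomp A p)%MS -> w *m G = l *: w.
  by move/submx_trans/(_ Up'); rewrite kerP pE horner_XsubC_row subr_eq0 => /eqP.
have qw0 : 0 < form w0 w0 by apply: pU.
have l1 : l = 1.
  case: (isom_eigen hG (UG _ w0U)) => [h|/sqr1_gt0]; last exact.
  by rewrite h ltxx in qw0.
(* Removing the part of [z] in the definite component only lowers the norm, so [z1] stays
   nonspacelike. *)
have [u [z1 [zE uU z1P]]] := perp_decomp z (posdef_cap_perp pU).
have uz1 : form u z1 = 0 by rewrite formC; move/perpP: z1P; apply.
have qu : 0 <= form u u.
  by have [->|un0] := eqVneq u 0; [rewrite form0l | apply/ltW/pU].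
have qz1 : form z1 z1 <= 0 by move: qz; rewrite zE !formE (formC z1) uz1; lra.
have z1n0 : z1 != 0.
  apply: contraNneq zn0 => z10; rewrite z10 addr0 in zE.
  by rewrite (posdef_le pU _ qz) // zE.
have z1G : z1 *m G = z1.
  have := zG; rewrite zE mulmxDl (UG u uU) scalerDr l1 !scale1r; exact: addrI.
(* Scales [w0] so that [w + z1] is spacelike: [c >= 1] and
   [c * form w0 w0 = form w0 w0 - form z1 z1], so the norm of [c *: w0] exceeds [- form z1 z1]. *)
pose c := 1 - form z1 z1 / form w0 w0.
have c1 : 1 <= c by rewrite lerDl oppr_ge0 pmulr_lle0 ?invr_gt0.
pose w := c *: w0.
have wU : (w <= pcomp A p)%MS by rewrite scalemx_sub.
have wz1 : form w z1 = 0 by rewrite formC; move/perpP: z1P; apply.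
have qw : 0 < form w w + form z1 z1.
  have e : c * form w0 w0 = form w0 w0 - form z1 z1 by rewrite /c; field; rewrite gt_eqF.
  have : c * form w0 w0 <= c * (c * form w0 w0) by rewrite ler_peMl // mulr_ge0 ?ltW // (lt_le_trans ltr01).
  by rewrite /w !formE e; lra.
have wn0 : w != 0.
  by apply: contraTneq qw => ->; rewrite form0l add0r -leNgt.
clearbody w.
have [||a yA] := @centralizer_sub_line G A (w + z1) pG sGA.
- by rewrite !formE (formC z1) wz1; lra.
- by exists 1; rewrite mulmxDl (UG w wU) z1G l1 !scale1r.
(* The eigenvector equation for [w + z1] splits along the component and its complement, both stable
   under [A]. *)
have split0 : w *m A - a *: w = 0.
  apply: (perp_cap0 pU); first by rewrite addmx_sub ?eqmx_opp ?scalemx_sub // stable_row.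
  have -> : w *m A - a *: w = - (z1 *m A - a *: z1).
    apply/eqP; rewrite -addr_eq0; apply/eqP.
    have := yA; rewrite mulmxDl scalerDr => /eqP; rewrite -subr_eq0 => /eqP <-.
    by rewrite opprD addrACA.
  by rewrite eqmx_opp addmx_sub ?eqmx_opp ?scalemx_sub // stable_row.
have wA : w *m A = a *: w by apply/eqP; rewrite -subr_eq0 split0.
have z1A : z1 *m A = a *: z1.
  by have := yA; rewrite mulmxDl scalerDr wA; apply: addrI.
have a0 := isPO_eigen_gt0 pA z1n0 qz1 z1A.
have a1 : a = 1.
  case: (isom_eigen hA wA) => [h|/sqr1_gt0]; last exact.
  by have := pU w wU wn0; rewrite QfE h ltxx.
have wp : w *m horner_mx A p = 0 by apply/eqP; rewrite -kerP -(posdef_pcomp_ker hA pU).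
case: (irreducible_coprime_or_dvd ('X - a%:P) ip) => [cp|pd].
  have := coprime_ker0 cp wp; rewrite horner_XsubC_row wA subrr => /(_ erefl) h.
  by rewrite h eqxx in wn0.
(* Now [p] is ['X - a%:P], so the eigenvector [z1] belongs to the component to which it is
   orthogonal. *)
have pE' := irreducible_dvd_eq mp (monicXsubC a) ip (irredp_XsubC a) pd.
have z1U : (z1 <= pcomp A p)%MS.
  by rewrite (posdef_pcomp_ker hA pU) kerP pE' horner_XsubC_row z1A subrr.
by rewrite (perp_cap0 pU z1U z1P) eqxx in z1n0.
Qed.

Lemma eigen_horner A a q v : v *m A = a *: v -> v *m horner_mx A q = q.[a] *: v.
Proof.
move=> vA; elim/poly_ind: q => [|q c IH]; first by rewrite rmorph0 mulmx0 horner0 scale0r.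
rewrite rmorphD rmorphM /= horner_mx_X horner_mx_C mulmxDr mul_mx_scalar -mulmxE mulmxA IH.
by rewrite -scalemxAl vA scalerA -scalerDl !hornerE.
Qed.

(** An eigenvector of [A] is one of q(A), so [p'] must be linear. Applied in both directions this
    equates the degrees. *)
Lemma linear_component A G p p' q v : p \is monic -> irreducible_poly p ->
  p' \is monic -> irreducible_poly p' -> v != 0 -> v *m horner_mx A p = 0 ->
  v *m horner_mx G p' = 0 -> v *m G = v *m horner_mx A q -> size p = 2%N -> size p' = 2%N.
Proof.
move=> mp ip mp' ip' vn0 vp vp' vG sp.
case: (monic_irreducible_rcfP mp ip) => [[a pE]|[s [d [pE _]]]]; last by rewrite pE size_quad in sp.
have vA : v *m A = a *: v by apply/eqP; rewrite -subr_eq0 -horner_XsubC_row -pE vp.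
rewrite (eigen_horner q vA) in vG.
case: (irreducible_coprime_or_dvd ('X - (q.[a])%:P) ip') => [cp|pd].
  have := coprime_ker0 cp vp'; rewrite horner_XsubC_row vG subrr => /(_ erefl) h.
  by rewrite h eqxx in vn0.
by rewrite (irreducible_dvd_eq mp' (monicXsubC _) ip' (irredp_XsubC _) pd) size_XsubC.
Qed.

(** Passing from [A] to [G] and back encloses the component of [G] between the component of [p] and
    the kernel of some factor [p2] of [A]; coprimality forces [p2 = p], so all coincide. *)
Lemma centralizer_eq_component A G p : isPO A -> isPO G ->
  centralizer_sub A G -> centralizer_sub G A -> is_factor A p -> posdef (pcomp A p) ->
  exists p', [/\ is_factor G p', posdef (pcomp G p'), (pcomp A p :=: pcomp G p')%MS & size p = size p'].
Proof.
move=> pA pG sAG sGA fp pU; have hA := isPO_row pA; have hG := isPO_row pG.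
have [p' [q [fp' Up' hq]]] := centralizer_sub_component pA sAG fp pU.
have pU' := centralizer_eq_posdef pA pG sAG sGA fp pU fp' Up'.
have [p2 [q' [fp2 Up2 hq']]] := centralizer_sub_component pG sGA fp' pU'.
have UU' : (pcomp A p <= pcomp G p')%MS := submx_trans Up' (ker_sub_pcomp G p').
have p2E : p = p2.
  apply/eqP; apply: contraT => np.
  have cp := factors_coprime fp fp2 np.
  have /rowV0Pn[v vU vn0] := pcomp_neq0 fp.
  have v2 : v *m horner_mx A p2 = 0 by apply/eqP; rewrite -kerP (submx_trans vU) // (submx_trans UU').
  have v1 : v *m horner_mx A p = 0 by apply/eqP; rewrite -kerP -(posdef_pcomp_ker hA pU).
  by rewrite (coprime_ker0 cp v1 v2) eqxx in vn0.
have UE : (pcomp A p :=: pcomp G p')%MS.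
  by apply/eqmxP; rewrite UU' /= p2E (submx_trans Up2) // ker_sub_pcomp.
exists p'; split=> //.
have /rowV0Pn[v vU vn0] := pcomp_neq0 fp.
have vU' : (v <= pcomp G p')%MS by rewrite -UE.
have v1 : v *m horner_mx A p = 0 by apply/eqP; rewrite -kerP -(posdef_pcomp_ker hA pU).
have v2 : v *m horner_mx G p' = 0 by apply/eqP; rewrite -kerP -(posdef_pcomp_ker hG pU').
have [mp [ip _]] := fp; have [mp' [ip' _]] := fp'.
have s12 := linear_component mp ip mp' ip' vn0 v1 v2 (hq v vU).
have s21 := linear_component mp' ip' mp ip vn0 v2 v1 (hq' v vU').
have sz r : r \is monic -> irreducible_poly r -> size r = 2%N \/ size r = 3%N.
  by move=> mr ir; case: (monic_irreducible_rcfP mr ir) => [[a ->]|[s [d [-> _]]]];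
    rewrite ?size_XsubC ?size_quad; [left|right].
case: (sz p mp ip) => sp; first by rewrite sp s12.
by case: (sz p' mp' ip') => sp'; [rewrite s21|rewrite sp sp'].
Qed.

Section SameCentralizer.
Variables (A G : M) (ps pt ps' pt' : seq {poly R}).
Hypotheses (pA : isPO A) (pG : isPO G) (sAG : centralizer_sub A G) (sGA : centralizer_sub G A).
Hypotheses (st : space_time A ps pt) (st' : space_time G ps' pt').

Lemma same_component p : p \in ps ->
  exists2 p', p' \in ps' & (pcomp A p :=: pcomp G p')%MS /\ size p = size p'.
Proof.
have [_ _ hs _] := st; have [_ _ hs' _] := st'.
move=> /hs[fp pU]; have [p' [fp' pU' UE sz]] := centralizer_eq_component pA pG sAG sGA fp pU.
by exists p' => //; apply/hs'.
Qed.

Lemma same_Vs_sub : (compsum A ps <= compsum G ps')%MS.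
Proof.
apply: compsum_sub => p /same_component[p' pp' [-> _]]; exact: sub_compsum.
Qed.

End SameCentralizer.

Lemma perp_Vs A (ps pt : seq {poly R}) : isPO A -> space_time A ps pt -> (perp (compsum A ps) :=: compsum A pt)%MS.
Proof.
move=> pA st; apply: eqmx_sym; apply/eqmxP; rewrite -mxrank_leqif_eq ?(Vt_perp_Vs pA st) //.
by rewrite rank_perp -(perp_Vt pA st) rank_perp subKn // rank_leq_col.
Qed.

(** The canonical generator [<<_>>] turns equality of row spaces into equality of matrices, so that
    components of different isometries can be compared with [perm_eq]. *)
Definition component_data A (ps : seq {poly R}) := [seq (<<pcomp A p>>%MS, size p) | p : {poly R} <- ps].

Lemma component_data_uniq A (ps pt : seq {poly R}) : space_time A ps pt -> uniq (component_data A ps).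
Proof.
move=> [us _ hs _]; rewrite map_inj_in_uniq // => p q /hs[fp _] /hs[fq _] [/eqP e _].
apply/eqP; apply: contraT => pq; have cp := factors_coprime fp fq pq.
have /rowV0Pn[v vU vn0] := pcomp_neq0 fp.
have vU' : (v <= pcomp A q)%MS by rewrite -(genmxE (pcomp A q)) -(eqP e) genmxE.
have cp' : coprimep (p ^+ n.+1) (q ^+ n.+1) by rewrite coprimep_expl // coprimep_expr.
by rewrite (@coprime_ker0 _ _ A _ _ v cp') ?eqxx // in vn0; apply/eqP; rewrite -kerP.
Qed.

Lemma perm_rank_list A G (ps ps' : seq {poly R}) k : perm_eq (component_data A ps) (component_data G ps') ->
  perm_eq (rank_list A ps k) (rank_list G ps' k).
Proof.
have e (B : M) qs : rank_list B qs k = [seq \rank c.1 | c <- component_data B qs & c.2 == k].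
  rewrite /rank_list /component_data filter_map -map_comp; apply/eq_map => p /=.
  by rewrite mxrank_gen.
by move=> h; rewrite !e; apply/perm_map/perm_filter.
Qed.

Lemma same_centralizer_component_data A G (ps pt ps' pt' : seq {poly R}) : isPO A -> isPO G ->
  centralizer_sub A G -> centralizer_sub G A -> space_time A ps pt -> space_time G ps' pt' ->
  {subset component_data A ps <= component_data G ps'}.
Proof.
move=> pA pG sAG sGA st st' _ /mapP[p pp ->].
have [p' pp' [UE ->]] := same_component pA pG sAG sGA st st' pp.
apply/mapP; exists p' => //; congr (_, _).
by apply/genmxP; apply/eqmxP.
Qed.

(** Spacelike lines are what reflections can test. In the parabolic case the middle vector [e] of
    the Jordan block works. *)
Lemma not_fixed_spacelike G (ps pt : seq {poly R}) : isPO G -> space_time G ps pt -> ~ fixes_on G (compsum G pt) ->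
  exists e : V, [/\ (e <= compsum G pt)%MS, 0 < form e e & forall c, e *m G <> c *: e].
Proof.
move=> pG st nf; case: (pt_dichotomy pG st) => [ptE|[z [z' [l [l0 l1 zG z'G [zz zz' zz'' VE]]]]]].
  have [m [e [k [[mU eU kU] [_ eG _] [_ _ mk] [ee ek _] _]]]] := parabolic_kind pG st (conj ptE nf).
  exists e; split=> //; first by rewrite ee.
  move=> c; rewrite eG => h.
  have := congr1 (form e) h; rewrite !formE ee ek addr0 mulr1 => c1.
  have k0 : k = 0 by move: h; rewrite -c1 scale1r -[X in _ = X]addr0 => /addrI.
  by move/eqP: mk; rewrite k0 form0r eq_sym oppr_eq0 oner_eq0.
(* Norm 2; if it were an eigenvector, [l] and [l^-1] would coincide. *)
exists (z - z'); split.
- by rewrite VE -addsmxE addmx_sub_adds // eqmx_opp.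
- by rewrite !formE (formC z') zz zz' zz''; lra.
move=> c; rewrite mulmxBl zG z'G => h.
have := congr1 (form z) h; have := congr1 (form z') h.
rewrite !formE (formC z') zz zz' zz'' !mulr0 !subr0 !sub0r !mulrN1 !opprK mulr1 => h1 h2.
have lc : l = c by lra.
have li : l^-1 = c by lra.
have : l ^+ 2 = 1 by rewrite expr2 {2}lc -li mulfV // gt_eqF.
by move/sqr1_gt0 => /(_ l0) le; rewrite le eqxx in l1.
Qed.

(** If [A] fixes the time part, every spacelike line in it is stable under [A], hence under [G]. *)
Lemma same_centralizer_fixes A G (pt ps' pt' : seq {poly R}) : isPO A -> isPO G -> centralizer_sub A G ->
  space_time G ps' pt' -> (compsum A pt :=: compsum G pt')%MS ->
  fixes_on A (compsum A pt) -> fixes_on G (compsum G pt').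
Proof.
move=> pA pG sAG st' VE fA; apply: NNPP => nf.
have [e [eV qe eG]] := not_fixed_spacelike pG st' nf.
have [|a aE] := centralizer_sub_line pA sAG qe; last exact: (eG a aE).
by exists 1; rewrite scale1r fA // VE.
Qed.

Lemma parabolic_rank A (ps pt : seq {poly R}) : isPO A -> space_time A ps pt -> row_kind A pt Par ->
  (2 < \rank (compsum A pt))%N.
Proof.
move=> pA st kd; have [m [e [k d]]] := parabolic_kind pA st kd.
have [LU fL _ _] := parabolic_frame d.
by rewrite (leq_trans _ (mxrankS LU)) // (eqP fL).
Qed.

Lemma same_centralizer_segre A G (s s' : segre_data) : isPO A -> isPO G ->
  centralizer_sub A G -> centralizer_sub G A -> row_segre A s -> row_segre G s' -> s = s'.
Proof.
case: s s' => [[[t r] cs] rs] [[[t' r'] cs'] rs'] pA pG sAG sGA.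
move=> [ps [pt [st kd -> -> ->]]] [ps' [pt' [st' kd' -> -> ->]]].
have cd : perm_eq (component_data A ps) (component_data G ps').
  apply: uniq_perm; rewrite ?(component_data_uniq st) ?(component_data_uniq st') // => c.
  apply/idP/idP; first exact: (same_centralizer_component_data pA pG sAG sGA st st').
  exact: (same_centralizer_component_data pG pA sGA sAG st' st).
have VsE : (compsum A ps :=: compsum G ps')%MS.
  apply/eqmxP; rewrite (same_Vs_sub pA pG sAG sGA st st').
  by rewrite (same_Vs_sub pG pA sGA sAG st' st).
have VtE : (compsum A pt :=: compsum G pt')%MS.
  apply: eqmx_trans (eqmx_sym (perp_Vs pA st)) _; apply: eqmx_trans (perp_Vs pG st').
  by apply/eqmxP; rewrite !perpS ?VsE.
have psort (a b : seq nat) : perm_eq a b -> sort leq a = sort leq b.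
  by move/(perm_sortP leq_total leq_trans anti_leq).
rewrite (psort _ _ (perm_map half (perm_rank_list 3 cd))) (psort _ _ (perm_rank_list 2 cd)).
rewrite VtE; suff -> : t = t' by [].
have fAG := same_centralizer_fixes pA pG sAG st' VtE.
have fGA := same_centralizer_fixes pG pA sGA st (eqmx_sym VtE).
have nfH (B : M) qt : row_kind B qt Hyp -> ~ fixes_on B (compsum B qt) /\ \rank (compsum B qt) = 2%N.
  by move=> [z [z' [l /hyperbolic_part[h1 _ _ h4]]]].
case: t kd => kd; case: t' kd' => kd' //.
- by case: kd' => _ /(_ (fAG kd)).
- by case: (nfH _ _ kd') => /(_ (fAG kd)).
- by case: kd => _ /(_ (fGA kd')).
- by have := parabolic_rank pA st kd; have [_ h] := nfH _ _ kd'; rewrite VtE h.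
- by case: (nfH _ _ kd) => /(_ (fGA kd')).
by have := parabolic_rank pG st' kd'; have [_ h] := nfH _ _ kd; rewrite -VtE h.
Qed.

Lemma char_poly_conj A (K : M) : K \in unitmx -> char_poly (K *m A *m invmx K) = char_poly A.
Proof.
move=> Ku; rewrite /char_poly.
pose c := map_mx (@polyC R).
have cc : c _ _ K *m c _ _ (invmx K) = 1%:M by rewrite -map_mxM mulmxV // map_mx1.
have -> : char_poly_mx (K *m A *m invmx K) = c _ _ K *m char_poly_mx A *m c _ _ (invmx K).
  by rewrite /char_poly_mx mulmxBr mulmxBl mul_mx_scalar -scalemxAl cc scalemx1 !map_mxM.
by rewrite !det_mulmx mulrAC -det_mulmx cc det1 mul1r.
Qed.

(** Components, ranks and normal forms are carried along by the isometry [invmx K]. This reduces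
    conjugate centralizers to equal ones. *)
Lemma row_segre_conj A K (s : segre_data) : isPO K -> row_segre A s ->
  row_segre (K *m A *m invmx K) s.
Proof.
case: s => [[[t r] cs] rs] pK [ps [pt [st kd -> -> ->]]].
have hK := isPO_row pK; have Ku := isPO_unit pK; set B := K *m A *m invmx K.
have hB q : horner_mx B q = K *m horner_mx A q *m invmx K by rewrite /B horner_mx_uconj.
have kE p v : (v <= kermxpoly B p)%MS = (v *m K <= kermxpoly A p)%MS.
  rewrite !kerP hB !mulmxA; apply/eqP/eqP => [h|->]; last by rewrite mul0mx.
  by rewrite -[LHS](mulmxKV Ku) h mul0mx.
have subK (U W : M) : (forall v, (v <= U)%MS = (v *m K <= W)%MS) -> (U :=: W *m invmx K)%MS.
  move=> h; apply/eqmxP/andP; split; apply/rV_subP => v.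
    by rewrite h => vW; rewrite -[v](mulmxK Ku) submxMr.
  by move=> vW; rewrite h -[W](mulmxKV Ku) submxMr.
have pE p : (pcomp B p :=: pcomp A p *m invmx K)%MS by apply: subK => v; exact: kE.
have cE l : (compsum B l :=: compsum A l *m invmx K)%MS.
  apply/eqmxP/andP; split.
    by apply: compsum_sub => p pl; rewrite pE submxMr // sub_compsum.
  rewrite -[X in (_ <= X)%MS](mulmxK Ku) submxMr //; apply: compsum_sub => p pl.
  rewrite -[X in (X <= _)%MS](mulmxKV Ku) submxMr // -pE; exact: sub_compsum.
have cP : char_poly B = char_poly A by exact: char_poly_conj.
have fE p : is_factor B p <-> is_factor A p by rewrite /is_factor cP.
have rE p : \rank (pcomp B p) = \rank (pcomp A p).
  by rewrite pE mxrankMfree // row_free_unit unitmx_inv.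
have vE v l : (v <= compsum B l)%MS = (v *m K <= compsum A l)%MS.
  apply/idP/idP; rewrite cE => h.
    by have := submxMr K h; rewrite mulmxKV.
  by rewrite -[v](mulmxK Ku) submxMr.
have pdE p : posdef (pcomp B p) <-> posdef (pcomp A p).
  split=> h v vU vn0.
    have := h (v *m invmx K); rewrite /pcomp kE mulmxKV // => /(_ vU).
    rewrite !QfE -(form_mulmx (v *m _) _ hK) mulmxKV //; apply.
    by apply: contraNneq vn0 => h0; rewrite -[v](mulmxKV Ku) h0 mul0mx.
  rewrite QfE -(form_mulmx v v hK); apply: h; first by rewrite /pcomp -kE.
  by apply: contraNneq vn0 => h0; rewrite -[v](mulmxK Ku) h0 mul0mx.
have fixE : fixes_on B (compsum B pt) <-> fixes_on A (compsum A pt).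
  split=> h v vU.
    have := h (v *m invmx K); rewrite vE mulmxKV // => /(_ vU) e.
    have := congr1 (mulmx^~ K) e; by rewrite /B !mulmxA !mulmxKV.
  rewrite vE in vU; have := h _ vU; rewrite /B !mulmxA => ->; by rewrite mulmxK.
have rlE k : rank_list B ps k = rank_list A ps k by apply: eq_map => p; exact: rE.
exists ps, pt; split; rewrite ?rlE //.
- by case: st => us ut hs ht; split=> // p; rewrite fE pdE ?hs ?ht.
- case: t kd => /=; first by move/fixE.
    by case=> ptE nf; split=> // /fixE.
  move=> [z [z' [l [l0 l1 zA z'A [zz zz' zz'' VE]]]]].
  have fi u v : form (u *m invmx K) (v *m invmx K) = form u v.
    by rewrite -(form_mulmx _ _ hK) !mulmxKV.
  exists (z *m invmx K), (z' *m invmx K), l; split=> //.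
  - by rewrite /B !mulmxA mulmxKV // zA scalemxAl.
  - by rewrite /B !mulmxA mulmxKV // z'A scalemxAl.
  rewrite !fi; split=> //; apply: eqmx_trans (cE pt) _.
  by rewrite -mul_col_mx; apply: eqmxMr.
by rewrite cE mxrankMfree // row_free_unit unitmx_inv.
Qed.

End Backward.

(** * Passage between column and row action, and the equivalence *)

Lemma commute_tr (R : comNzRingType) m (h a : 'M[R]_m) :
  h *m a = a *m h <-> h^T *m a^T = a^T *m h^T.
Proof. by rewrite -!trmx_mul; split=> [->|/trmx_inj ->]. Qed.

Lemma invmxN (R : comUnitRingType) m (X : 'M[R]_m) : X \in unitmx -> invmx (- X) = - invmx X.
Proof.
move=> Xu; have Xn : - X \in unitmx by rewrite -scaleN1r unitmxZ // unitrN1.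
by apply: (can_inj (mulmxK Xn)); rewrite mulVmx // mulNmx mulmxN opprK mulVmx.
Qed.

(** Transposition reverses products, so the conjugator becomes the inverse transpose of [k].
    Membership in the group can be assumed beforehand because conjugation by one of its elements
    preserves it. *)
Lemma conj_centralizersP (R : rcfType) (n : nat) (f g : 'M[R]_(n.+1)) :
  conj_centralizers f g <-> exists Y, isPO Y /\ forall h, isPO h ->
    (h *m g^T = g^T *m h <-> (invmx Y *m h *m Y) *m f^T = f^T *m (invmx Y *m h *m Y)).
Proof.
have trinv (Y : 'M[R]_(n.+1)) : invmx (invmx Y)^T = Y^T by rewrite -trmx_inv invmxK.
have conjPO (k h : 'M[R]_(n.+1)) : isPO k -> isPO (invmx k *m h *m k) <-> isPO h.
  move=> pk; split=> ph; last exact: isPO_mul (isPO_mul (isPO_inv pk) ph) pk.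
  have := isPO_mul (isPO_mul pk ph) (isPO_inv pk).
  by rewrite !mulmxA mulmxV ?mul1mx ?mulmxK // isPO_unit.
split=> -[k [pk hk]].
  exists (invmx k)^T; split; first exact: isPO_tr (isPO_inv pk).
  move=> h ph; have [h1 h2] := hk h^T; rewrite trinv.
  have E : k^T *m h *m (invmx k)^T = (invmx k *m h^T *m k)^T by rewrite !trmx_mul trmxK mulmxA.
  have ph' := isPO_tr ph.
  have c1 : h *m g^T = g^T *m h <-> h^T *m g = g *m h^T by rewrite (commute_tr h) trmxK.
  rewrite E -commute_tr; split=> [/c1 e|e].
    by have [_] := h1 (conj ph' e).
  by have [_ /c1] := h2 (conj ((conjPO _ _ pk).2 ph') e).
exists (invmx k)^T; split; first exact: isPO_tr (isPO_inv pk).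
move=> h; rewrite trinv.
have E : (k^T *m h *m (invmx k)^T)^T = invmx k *m h^T *m k by rewrite !trmx_mul !trmxK mulmxA.
split=> -[ph e].
  have ph' := isPO_tr ph; split.
    rewrite -isPO_trE E; exact: (conjPO _ _ pk).2 ph'.
  apply: (commute_tr _ _).2; rewrite E.
  exact: (hk _ ph').1 ((commute_tr h g).1 e).
have ph' : isPO h^T by apply: (conjPO k h^T pk).1; rewrite -E; apply: isPO_tr.
split; first by rewrite -isPO_trE.
have := (commute_tr _ _).1 e; rewrite E => e'.
exact: (commute_tr h g).2 ((hk _ ph').2 e').
Qed.

Theorem mainTheorem3 (R : rcfType) (n : nat) (hn : (1 <= n)%N)
  (f g : 'M[R]_(n.+1)) (hf : isPO f) (hg : isPO g) :
  segre f = segre g <-> conj_centralizers f g.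
Proof.
have pf := isPO_tr hf; have pg := isPO_tr hg.
have sf := segreP hf; have sg := segreP hg.
rewrite conj_centralizersP; split=> [e|[Y [pY hY]]].
  (* The transposed criterion starts from matrices commuting with [g^T], hence [g] comes first. *)
  rewrite e in sf; have [X [hX XP]] := row_segre_commutant pg pf sg sf.
  case: (isPO_opp hX) => pX.
    by exists X; split=> [|h _]; [exact: pX | exact: XP].
  exists (- X); split=> [|h _]; first exact: pX.
  have [Xu _] := isom_invmx hX.
  have -> : invmx (- X) *m h *m (- X) = invmx X *m h *m X.
    by rewrite (invmxN Xu) mulNmx mulNmx mulmxN opprK.
  exact: XP.
have Yu := isPO_unit pY; have YV := mulmxV Yu; have VY := mulVmx Yu.
(* The conjugate of [f^T] by [Y] keeps the symbol of [f] and has the same centralizer as [g^T]. *)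
have sf' := row_segre_conj pY sf.
have eqc (h : 'M[R]_(n.+1)) : isPO h -> (h *m g^T = g^T *m h <->
    h *m (Y *m f^T *m invmx Y) = Y *m f^T *m invmx Y *m h).
  by move=> ph; apply: iff_trans (hY h ph) _; apply: commute_conj.
have pB : isPO (Y *m f^T *m invmx Y) := isPO_mul (isPO_mul pY pf) (isPO_inv pY).
by apply: (same_centralizer_segre pB pg _ _ sf' sg) => h ph /(eqc h ph).
Qed.
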